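(* For every integer $n\geq 1$ and every $\ell\geq 0$ there is a constant $s(n,\ell)<n$, depending only on $n$ and $\ell$, such that if $\Lambda\subset\mathbb{S}^n$ is a closed set whose convex hull $H(\Lambda)$ in $\mathbb{B}^{n+1}$ is weakly $\ell$-tight, then $$h_c(\Lambda)\leq s(n,\ell)<n.$$ In particular, if a Kleinian group $G$ acting on $\mathbb{B}^{n+1}$ is geometrically tight, then $h_c(\Lambda(G))<n$.
   Context: $(\mathbb{B}^{n+1},d)$ is the unit ball model of $(n+1)$-dimensional hyperbolic space, with boundary at infinity the unit sphere $\mathbb{S}^n$; $\mathrm{vol}$ is hyperbolic volume and $B_R(z)$ the hyperbolic ball of centre $z$ and radius $R$. A horoball is an open $(n+1)$-dimensional Euclidean ball in $\mathbb{B}^{n+1}$ whose bounding sphere is tangent to $\mathbb{S}^n$. A Kleinian group is a discrete subgroup of the group of orientation preserving isometries of $\mathbb{B}^{n+1}$; its limit set $\Lambda(G)\subset\mathbb{S}^n$ is the set of accumulation points of any $G$-orbit. For a closed set $\Lambda\subset\mathbb{S}^n$, the convex hull $H(\Lambda)\subset\mathbb{B}^{n+1}$ is the hyperbolic convex hull of the union of all geodesics both of whose end points lie in $\Lambda$; $\partial H(\Lambda)$ is its boundary in $\mathbb{B}^{n+1}$, and $H_\varepsilon(\Lambda)$ is its $\varepsilon$-neighbourhood, $\varepsilon>0$. The convex core entropy of $\Lambda$ is $$h_c(\Lambda)=\limsup_{R\to\infty}\frac{\log \mathrm{vol}(B_R(z)\cap H_\varepsilon(\Lambda))}{R},$$ which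 is independent of $z\in\mathbb{B}^{n+1}$ and of $\varepsilon>0$. $H(\Lambda)$ is weakly $\ell$-tight if there exist mutually disjoint horoballs $\{D_p\}_{p\in\Phi}$, with set of tangency points $\Phi\subset\mathbb{S}^n$, such that every point $z\in H(\Lambda)\setminus\bigcup_{p\in\Phi}D_p$ is within distance $\ell$ from $\partial H(\Lambda)$ (the family may be empty). A Kleinian group $G$ is geometrically tight if $H(\Lambda(G))$ is weakly $\ell$-tight for some $\ell\ge0$. *)

(* Defs.v *)
From HB Require Import structures.
From mathcomp Require Import all_boot all_order all_algebra.
From mathcomp Require Import all_classical all_reals all_analysis.

Set Implicit Arguments.
Unset Strict Implicit.
Unset Printing Implicit Defensive.

Import Order.TTheory GRing.Theory Num.Theory.
Import numFieldNormedType.Exports.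

Local Open Scope classical_set_scope.
Local Open Scope ring_scope.

(* Lebesgue measure on R^k, carried by k-tuples: R x R^k is identified with
   R^(k+1) and the product measure is transported by induction on k. *)
Section lebesgue_tuple.
Variable R : realType.
Local Notation RT := (measurableTypeR R).

Definition tcons k (p : RT * k.-tuple RT) : k.+1.-tuple RT :=
  [the k.+1.-tuple RT of p.1 :: p.2].

Lemma measurable_tcons k : measurable_fun setT (@tcons k).
Proof. exact: (measurable_cons measurable_fst measurable_snd). Qed.

Section step.
Variables (k : nat) (mu : {sigma_finite_measure set (k.-tuple RT) -> \bar R}).

Definition lebesgue_step : set (k.+1.-tuple RT) -> \bar R :=
  pushforward (@lebesgue_measure R \x mu)%E (@tcons k).

Let step0 : lebesgue_step set0 = 0%E.
Proof. by rewrite /lebesgue_step /pushforward preimage_set0 measure0. Qed.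

Let step_ge0 A : (0 <= lebesgue_step A)%E.
Proof. exact: (measure_ge0 (@lebesgue_measure R \x mu)%E). Qed.

Let step_sigma_additive : semi_sigma_additive lebesgue_step.
Proof.
move=> F mF tF mUF; rewrite /lebesgue_step /pushforward preimage_bigcup.
have mp A : measurable A -> measurable (@tcons k @^-1` A).
  by move=> mA; rewrite -[X in measurable X]setTI; exact: measurable_tcons.
apply: measure_semi_sigma_additive => //.
- by move=> n; exact: mp.
- apply/trivIsetP => /= i j _ _ ij; rewrite -preimage_setI.
  by move/trivIsetP : tF => /(_ _ _ _ _ ij) ->//; rewrite preimage_set0.
- by rewrite -preimage_bigcup; exact: mp.
Qed.

HB.instance Definition _ :=
  isMeasure.Build _ _ _ lebesgue_step step0 step_ge0 step_sigma_additive.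

Let step_sigma_finite : sigma_finite setT lebesgue_step.
Proof.
have /sigma_finiteP[F [TF ndF Foo]] := sigma_finiteT (@lebesgue_measure R).
have /sigma_finiteP[G [TG ndG Goo]] := sigma_finiteT mu.
exists (fun n => [set t | F n (tnth t ord0) /\ G n [tuple of behead t]]).
  apply/esym; rewrite -subTset => t _.
  have [i _ Fi] : (\bigcup_i F i) (tnth t ord0) by rewrite -TF.
  have [j _ Gj] : (\bigcup_i G i) [tuple of behead t] by rewrite -TG.
  exists (maxn i j) => //; split.
    by move: Fi; apply/subsetPset/ndF; rewrite leq_maxl.
  by move: Gj; apply/subsetPset/ndG; rewrite leq_maxr.
move=> n; have [mF Fn] := Foo n; have [mG Gn] := Goo n; split.
  apply: measurableI.
    rewrite -[X in measurable X]setTI.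
    exact: (@measurable_tnth _ RT k.+1 ord0).
  rewrite -[X in measurable X]setTI.
  exact: (@measurable_behead _ RT k).
rewrite /lebesgue_step /pushforward.
rewrite (_ : _ @^-1` _ = F n `*` G n).
  by rewrite product_measure1E// lte_mul_pinfty// ge0_fin_numE.
apply/seteqP; split => -[x t] /= [Fx Gt]; split => //=.
  by rewrite (_ : t = [tuple of behead (tcons (x, t))])//; apply/val_inj.
by rewrite (_ : [tuple of _] = t)//; apply/val_inj.
Qed.

HB.instance Definition _ :=
  Measure_isSigmaFinite.Build _ _ _ lebesgue_step step_sigma_finite.
End step.

Fixpoint lebesgue_tuple k : {sigma_finite_measure set (k.-tuple RT) -> \bar R} :=
  if k is k'.+1 return {sigma_finite_measure set (k.-tuple RT) -> \bar R}
  then lebesgue_step (lebesgue_tuple k') else \d_[tuple].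

End lebesgue_tuple.

Section hyperbolic_ball.
Variables (R : realType) (n : nat).
Local Notation V := 'rV[R]_n.+1.
Implicit Types (x y z p : V) (A C D L H : set V) (g : V -> V).

(* Euclidean norm; the norm `| x | of the library on row vectors is the sup
   norm, which induces the same topology. *)
Definition enorm x : R := Num.sqrt (\sum_i x ord0 i ^+ 2).

Definition uball : set V := [set x | enorm x < 1].
Definition usphere : set V := [set x | enorm x = 1].

Definition arcosh (t : R) : R := ln (t + Num.sqrt (t ^+ 2 - 1)).

(* Distance of the metric 2|dx| / (1 - |x|^2), of constant curvature -1;
   meaningful for x and y in uball. *)
Definition hdist x y : R :=
  arcosh (1 + 2 * enorm (x - y) ^+ 2 /
              ((1 - enorm x ^+ 2) * (1 - enorm y ^+ 2))).

Definition hball z (r : R) : set V := uball `&` [set w | hdist z w < r].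

Definition hnbhd (e : R) A : set V :=
  uball `&` [set z | exists2 w, A w & hdist z w < e].

(* Boundary relative to the (open) unit ball. *)
Definition hboundary A : set V := (closure A `\` A°) `&` uball.

(* Volume of a subset of uball, with the density of the metric above. *)
Definition hvol A : \bar R :=
  (\int[lebesgue_tuple R n.+1]_(t in [set t | A (\row_i tnth t i)%R])
     ((2 / (1 - enorm (\row_i tnth t i) ^+ 2)) ^+ n.+1)%:E)%E.

(* Unit speed parametrization over I of a globally length-minimizing
   hyperbolic geodesic. *)
Definition hgeodesic (I : set R) (c : R -> V) : Prop :=
  (forall t, I t -> uball (c t)) /\
  (forall s t, I s -> I t -> hdist (c s) (c t) = `|s - t|).

Definition hconvex C : Prop := C `<=` uball /\
  forall (c : R -> V) (a b : R), a <= b -> hgeodesic `[a, b] c ->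
    C (c a) -> C (c b) -> forall t, a <= t <= b -> C (c t).

Definition geodesics_between L : set V :=
  [set z | exists c : R -> V, exists x, exists y,
    [/\ hgeodesic setT c, c t @[t --> -oo] --> x, c t @[t --> +oo] --> y,
        L x /\ L y & range c z]].

Definition convex_hull L : set V := smallest hconvex (geodesics_between L).

Definition convex_core_entropy z (e : R) L : \bar R :=
  limf_esup (fun r : R =>
    (lne (hvol (hball z r `&` hnbhd e (convex_hull L))) * (r^-1)%:E)%E) +oo.

Definition horoball p D : Prop := exists x (r : R),
  [/\ 0 < r, D = [set w | enorm (w - x) < r], D `<=` uball &
      [set w | enorm (w - x) = r] `&` usphere = [set p]].

Definition weakly_tight (l : R) L : Prop :=
  exists (Phi : set V) (D : V -> set V),
    [/\ forall p, Phi p -> horoball p (D p),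
        trivIset Phi D &
        forall z, convex_hull L z -> ~ (\bigcup_(p in Phi) D p) z ->
          exists2 w, hboundary (convex_hull L) w & hdist z w <= l].

(* An isometry of the ball is encoded as a map of the ambient space that is
   the identity outside the ball, so that composition and equality of
   isometries are those of functions. *)
Definition hisometry g : Prop :=
  [/\ set_bij uball uball g,
      forall x y, uball x -> uball y -> hdist (g x) (g y) = hdist x y &
      forall x, ~ uball x -> g x = x].

Definition orientation_preserving g : Prop :=
  forall x, uball x -> differentiable g x /\ 0 < \det ('J g x).

(* Discreteness for the topology of uniform convergence on the compact
   subsets of the ball. *)
Definition discrete_isometries (G : set (V -> V)) : Prop :=
  forall g, G g -> exists (K : set V) (e : R),
    [/\ compact K, K `<=` uball, 0 < e &
        forall h, G h -> (forall x, K x -> hdist (g x) (h x) < e) -> h = g].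

Definition kleinian (G : set (V -> V)) : Prop :=
  [/\ forall g, G g -> hisometry g /\ orientation_preserving g,
      G idfun,
      forall g h, G g -> G h -> G (g \o h),
      forall g, G g -> exists2 h, G h & cancel g h &
      discrete_isometries G].

(* The accumulation points do not depend on the orbit. *)
Definition limit_set (G : set (V -> V)) : set V :=
  [set x | usphere x /\
    forall z, uball z -> limit_point [set g z | g in G] x].

Definition geometrically_tight (G : set (V -> V)) : Prop :=
  exists2 l : R, 0 <= l & weakly_tight l (limit_set G).

End hyperbolic_ball.

(* Main.v *)
(* Only convexity of the hull H is used.  In the Klein model H is Euclidean
   convex.  Cut the boundary of the cube [-1, 1]^(n+1) into dyadic cells, project
   them radially to the sphere, and call a cell of size 2^-k a node when its cone
   contains a point of H at depth at least k; the volume of B_R(z) inside a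
   neighbourhood of H is at most a constant times the number of nodes of level
   at most R / ln 2 + O(1).

   A cell has 2^(n m) descendants m levels down.  If no descendant of a deep
   enough cell were missing, H would contain a point outside every horoball near
   the centre of the cell (either at once, or by following a segment of H until
   it leaves the horoball), hence a point of the ball outside H nearby, and a
   hyperplane separating that point from finitely many points of H would cut off
   a descendant.  So some descendant at a bounded depth is missing, unless the
   cell sits deep inside one of the horoballs.  Such cells are handled by a
   potential, a power of the exponential of the depth in the horoball: deep
   inside, its average over the descendants at least halves, because only the
   descendants close to the point of tangency stay deep.  With the weight
   1 + eps * potential, eps tiny, both cases lose a definite proportion, so the
   number of nodes grows at most like lam^k with lam < 2^n. *)
Require Import Defs.
From mathcomp Require Import all_boot all_order all_algebra.
From mathcomp Require Import all_classical all_reals all_analysis.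
From mathcomp Require Import measurable_realfun ring lra.
Import Order.TTheory GRing.Theory Num.Theory.
Import numFieldNormedType.Exports.
Local Open Scope classical_set_scope.
Local Open Scope ring_scope.

Set Implicit Arguments.
Unset Strict Implicit.
Unset Printing Implicit Defensive.

(** * Euclidean inner product *)

(** The bound must be uniform over all hulls, so the rate [lam] is fixed from [n] and
    [E = 2 * expR l] before any hull is given. What depends on the hull (a base point, the first
    level where cells are small enough, the potentials there) enters only a multiplicative constant,
    which the entropy ignores. The Klein model serves because cosh of the distance is (1 - <x, y>) /
    (hgt x * hgt y) and the horoball at b is 1 - <x, b> < kap * hgt x, so that all estimates become
    polynomial. The obstacle is that a cell deep in a horoball can keep all its descendants for as
    many levels as it is deep, so no fixed number of levels shows a loss. The fourth root in the
    potential is chosen to work even for n = 1: going down 4 mu levels multiplies it by 2^-mu times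
    the inverse square root of a rescaled distance to b. That function is integrable on a line, so
    its average is controlled by a single chart coordinate, uniformly in mu. Disjointness gives each
    cell at most one relevant horoball, hence a single weight. *)

Section euclidean.
Variables (R : realType) (n : nat).
Local Notation V := 'rV[R]_n.+1.
Implicit Types (x y z : V) (a : R).

Definition dot x y : R := \sum_i x ord0 i * y ord0 i.

Lemma dotC x y : dot x y = dot y x.
Proof. by apply: eq_bigr => i _; rewrite mulrC. Qed.

Lemma dotDl x y z : dot (x + y) z = dot x z + dot y z.
Proof.
by rewrite /dot -big_split; apply: eq_bigr => i _; rewrite mxE mulrDl.
Qed.

Lemma dotZl a x y : dot (a *: x) y = a * dot x y.
Proof.
by rewrite /dot mulr_sumr; apply: eq_bigr => i _; rewrite mxE mulrA.
Qed.

Lemma dotNl x y : dot (- x) y = - dot x y.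
Proof. by rewrite -scaleN1r dotZl mulN1r. Qed.

Lemma dotBl x y z : dot (x - y) z = dot x z - dot y z.
Proof. by rewrite dotDl dotNl. Qed.

Lemma dotDr x y z : dot z (x + y) = dot z x + dot z y.
Proof. by rewrite !(dotC z) dotDl. Qed.

Lemma dotZr a x y : dot x (a *: y) = a * dot x y.
Proof. by rewrite !(dotC x) dotZl. Qed.

Lemma dotNr x y : dot x (- y) = - dot x y.
Proof. by rewrite !(dotC x) dotNl. Qed.

Lemma dotBr x y z : dot z (x - y) = dot z x - dot z y.
Proof. by rewrite !(dotC z) dotBl. Qed.

Lemma dot0l x : dot 0 x = 0.
Proof. by rewrite -(scale0r x) dotZl mul0r. Qed.

Lemma dot0r x : dot x 0 = 0.
Proof. by rewrite dotC dot0l. Qed.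

Definition dotE := (dotDl, dotDr, dotBl, dotBr, dotNl, dotNr, dotZl, dotZr).

Lemma dotxx_ge0 x : 0 <= dot x x.
Proof. by apply: sumr_ge0 => i _; rewrite -expr2 sqr_ge0. Qed.

Lemma dotxx_eq0 x : dot x x = 0 -> x = 0.
Proof.
move=> x0; apply/rowP => i; rewrite mxE; apply/eqP; rewrite -sqrf_eq0 expr2.
have /psumr_eq0P -> // : \sum_j x ord0 j * x ord0 j = 0 := x0.
by move=> j _; rewrite -expr2 sqr_ge0.
Qed.

Lemma enorm_ge0 x : 0 <= enorm x.
Proof. exact: sqrtr_ge0. Qed.

Lemma sqr_enorm x : enorm x ^+ 2 = dot x x.
Proof.
rewrite sqr_sqrtr; last by rewrite sumr_ge0// => i _; rewrite sqr_ge0.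
by apply: eq_bigr => i _; rewrite expr2.
Qed.

Lemma enorm_le x a : 0 <= a -> (enorm x <= a) = (dot x x <= a ^+ 2).
Proof. by move=> a0; rewrite -sqr_enorm ler_sqr ?nnegrE ?enorm_ge0. Qed.

Lemma enorm_lt x a : 0 <= a -> (enorm x < a) = (dot x x < a ^+ 2).
Proof. by move=> a0; rewrite -sqr_enorm ltr_sqr ?nnegrE ?enorm_ge0. Qed.

Lemma enorm0_eq0 x : enorm x = 0 -> x = 0.
Proof. by move=> x0; apply: dotxx_eq0; rewrite -sqr_enorm x0 expr0n. Qed.

Lemma enorm0 : enorm (0 : V) = 0.
Proof. by apply/eqP; rewrite -sqrf_eq0 sqr_enorm dot0l. Qed.

Lemma enormZ a x : enorm (a *: x) = `|a| * enorm x.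
Proof.
apply/eqP; rewrite -(@eqrXn2 _ 2) ?mulr_ge0 ?enorm_ge0//.
by rewrite exprMn !sqr_enorm !dotE real_normK ?num_real// expr2 mulrA.
Qed.

Lemma enormN x : enorm (- x) = enorm x.
Proof. by rewrite -scaleN1r enormZ normrN1 mul1r. Qed.

Lemma enormB x y : enorm (x - y) = enorm (y - x).
Proof. by rewrite -enormN opprB. Qed.

Lemma cauchy_schwarz x y : dot x y <= enorm x * enorm y.
Proof.
have := dotxx_ge0 (enorm y *: x - enorm x *: y).
rewrite !dotE -!sqr_enorm (dotC y x) => H.
have [/eqP y0|y0] := eqVneq (enorm x * enorm y) 0; last first.
  have p : 0 < enorm x * enorm y by rewrite lt_def y0 mulr_ge0 ?enorm_ge0.
  rewrite -subr_ge0 -(pmulr_rge0 _ p); move: H; set u := enorm x.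
  by set v := enorm y; set d := dot x y; nra.
move: y0; rewrite mulf_eq0 => /orP[]/eqP/enorm0_eq0->.
  by rewrite dot0l mulr_ge0 ?enorm_ge0.
by rewrite dot0r mulr_ge0 ?enorm_ge0.
Qed.

Lemma enormD x y : enorm (x + y) <= enorm x + enorm y.
Proof.
rewrite enorm_le ?addr_ge0 ?enorm_ge0// !dotE -!sqr_enorm (dotC y x).
by have := cauchy_schwarz x y; nra.
Qed.

Lemma enorm_triangle y x z : enorm (x - z) <= enorm (x - y) + enorm (y - z).
Proof. by rewrite (le_trans _ (enormD _ _))// addrA subrK. Qed.

Lemma ler_enormB x y : enorm x - enorm y <= enorm (x - y).
Proof. by rewrite lerBlDr (le_trans _ (enormD _ _))// subrK. Qed.

Lemma coord_le_enorm x i : `|x ord0 i| <= enorm x.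
Proof.
rewrite -[leLHS]sqrtr_sqr ler_wsqrtr// (bigD1 i)//= lerDl.
by rewrite sumr_ge0// => j _; rewrite sqr_ge0.
Qed.

Lemma enorm_le_sum x : enorm x <= \sum_i `|x ord0 i|.
Proof.
rewrite enorm_le ?sumr_ge0// expr2 mulr_suml; apply: ler_sum => i _.
apply: (le_trans (ler_norm _)); rewrite normrM ler_wpM2l//.
by rewrite (bigD1 i)//= lerDl sumr_ge0.
Qed.

Lemma enorm_le_coord x a : (forall i, `|x ord0 i| <= a) ->
  enorm x <= n.+1%:R * a.
Proof.
move=> xa; apply: (le_trans (enorm_le_sum _)).
rewrite (le_trans (ler_sum _ (fun i _ => xa i)))//.
by rewrite sumr_const card_ord mulr_natl.
Qed.

Lemma cvg_dot (T : Type) (F : set_system T) (f g : T -> V) x y : Filter F ->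
  f @ F --> x -> g @ F --> y -> dot (f t) (g t) @[t --> F] --> dot x y.
Proof.
move=> FF fx gy.
apply: (@cvg_big R _ +%R 0 xpredT (@add_continuous R^o) T F _
  (fun i t => f t ord0 i * g t ord0 i) (fun i => x ord0 i * y ord0 i)) => i _.
apply: cvgM.
  apply: (@continuous_cvg _ _ _ F _ f (fun z : V => z ord0 i) x _ fx).
  exact: coord_continuous.
apply: (@continuous_cvg _ _ _ F _ g (fun z : V => z ord0 i) y _ gy).
exact: coord_continuous.
Qed.

End euclidean.

(** * Separating a point from finitely many points of a convex set *)

Section separation.
Variables (R : realType) (n : nat).
Local Notation V := 'rV[R]_n.+1.
Implicit Types (x y z v : V) (a : R) (K : set V) (s : seq V).

Definition aff_convex K := forall x y a, K x -> K y -> 0 <= a <= 1 ->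
  K ((1 - a) *: x + a *: y).

(** Iterated joins make the hull a continuous image of a compact product; the convex set it sits in
    need not be closed. *)
Fixpoint finite_hull x s : set V :=
  if s is y :: s' then
    [set (1 - p.1) *: p.2 + p.1 *: y | p in `[0, 1] `*` finite_hull x s']
  else [set x].

Lemma finite_hull_compact x s : compact (finite_hull x s).
Proof.
elim: s => [|y s IH] /=; first exact: compact_set1.
apply: continuous_compact; last exact: compact_setX (@segment_compact _ _ _) IH.
apply: continuous_subspaceT => p.
apply: cvgD; apply: cvgZ.
- by apply: cvgB; [exact: cvg_cst|exact: cvg_fst].
- exact: cvg_snd.
- exact: cvg_fst.
- exact: cvg_cst.
Qed.

Lemma finite_hull_sub K x s : aff_convex K -> K x -> {in s, forall y, K y} ->
  finite_hull x s `<=` K.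
Proof.
move=> cK Kx; elim: s => [_ _ ->//|y s IH sK /= _ [[a p] [/= a01 hp] <-]].
apply: cK; last by rewrite in_itv in a01.
- by apply: IH hp => z zs; apply: sK; rewrite inE zs orbT.
- by apply: sK; rewrite mem_head.
Qed.

Lemma finite_hull_convex x s : aff_convex (finite_hull x s).
Proof.
elim: s => [|y s IH] /= p q a.
  by move=> -> -> _; rewrite -scalerDl subrK scale1r.
move=> [[b p'] [/= b01 hp] <-] [[c q'] [/= c01 hq] <-] a01.
move: b01 c01; rewrite !in_itv/= => b01 c01.
pose t := (1 - a) * b + a * c.
pose u := (1 - a) * (1 - b); pose w := a * (1 - c).
have tuw : 1 - t = u + w by rewrite /t /u /w; ring.
have u0 : 0 <= u by rewrite /u; nra.
have w0 : 0 <= w by rewrite /w; nra.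
have t01 : 0 <= t <= 1 by apply/andP; split; [rewrite /t; nra|lra].
(* If [u + w = 0] the combination is [y] itself, and any point of the smaller hull serves as
   base. *)
have [uw0|uw0] := eqVneq (u + w) 0.
  have [u00 w00] : u = 0 /\ w = 0 by lra.
  exists (t, p'); first by split => //=; rewrite in_itv.
  rewrite /= tuw uw0 scale0r add0r !scalerDr !scalerA -/u -/w u00 w00 !scale0r.
  by rewrite !add0r -scalerDl.
exists (t, (1 - w / (u + w)) *: p' + (w / (u + w)) *: q').
  split; first by rewrite /= in_itv.
  apply: IH => //; rewrite divr_ge0 ?addr_ge0//= ler_pdivrMr ?mul1r ?lerDr//.
  by rewrite lt_def uw0 addr_ge0.
rewrite /= tuw !scalerDr !scalerA -/u -/w.
have -> : (u + w) * (1 - w / (u + w)) = u by field.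
have -> : (u + w) * (w / (u + w)) = w by field.
by rewrite /t scalerDl addrACA.
Qed.

Lemma finite_hull_mem x s y : y \in x :: s -> finite_hull x s y.
Proof.
elim: s y => [|z s IH] y; first by rewrite inE => /eqP ->.
rewrite in_cons => /orP[/eqP ->|].
  exists (0, x) => /=; last by rewrite subr0 scale1r scale0r addr0.
  by split; [rewrite /= in_itv/= lexx ler01|apply: IH; rewrite mem_head].
rewrite in_cons => /orP[/eqP ->|ys].
  exists (1, x) => /=; last by rewrite subrr scale1r scale0r add0r.
  by split; [rewrite /= in_itv/= lexx ler01|apply: IH; rewrite mem_head].
exists (0, y) => /=; last by rewrite subr0 scale1r scale0r addr0.
by split; [rewrite /= in_itv/= lexx ler01|apply: IH; rewrite inE ys orbT].
Qed.

(** A nearest point [p] to [v] exists in the compact hull, and minimality along the segments issued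
    from [p] makes [p - v] a separating normal, strictly so because [p] differs from [v]. *)
Lemma finite_separation K x s v : aff_convex K -> K x ->
  {in s, forall y, K y} -> ~ K v ->
  exists2 u, enorm u = 1 & {in x :: s, forall y, dot u v < dot u y}.
Proof.
move=> cK Kx Ks nKv.
pose f (y : V) := dot (y - v) (y - v).
have H0 : finite_hull x s !=set0.
  by exists x; apply: finite_hull_mem; rewrite mem_head.
have cf : {within finite_hull x s, continuous f}.
  apply: continuous_subspaceT => y.
  have cB : z - v @[z --> y] --> y - v.
    by apply: (@cvgB _ _ _ (nbhs y) _ id (fun=> v) y v); [exact: cvg_id|exact: cvg_cst].
  exact: (cvg_dot _ cB cB).
have [p] := compact_EVT_min H0 (@finite_hull_compact x s) cf.
rewrite inE => hp pmin; pose w := p - v.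
have w0 : w != 0.
  rewrite subr_eq0; apply/eqP => pv; apply: nKv; rewrite -pv.
  exact: finite_hull_sub hp.
have ew : enorm w != 0 by apply: contra w0 => /eqP/enorm0_eq0 ->.
have ew0 : 0 < enorm w by rewrite lt_def ew enorm_ge0.
exists ((enorm w)^-1 *: w).
  by rewrite enormZ ger0_norm ?invr_ge0 ?enorm_ge0// mulVf.
move=> y /finite_hull_mem hy; rewrite !dotZl ltr_pM2l ?invr_gt0//.
pose c := dot w (y - p).
have ww : 0 < dot w w by rewrite -sqr_enorm exprn_gt0.
suff c0 : 0 <= c.
  rewrite -subr_gt0 -dotBr; apply: (lt_le_trans ww).
  have -> : y - v = (y - p) + w by rewrite /w addrA subrK.
  by rewrite dotDr -/c lerDr.
rewrite leNgt; apply/negP => c0.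
pose d := dot (y - p) (y - p).
have d0 : 0 <= d := dotxx_ge0 _.
have key a : 0 <= a <= 1 -> 0 <= 2 * a * c + a ^+ 2 * d.
  move=> a01; have := pmin _ (mem_set (finite_hull_convex hp hy a01)).
  rewrite /f -/w; have -> : (1 - a) *: p + a *: y - v = w + a *: (y - p).
    by rewrite /w scalerBl scale1r scalerBr addrAC -!addrA; congr (_ + _); rewrite addrCA !addrA addrAC.
  by rewrite dotDl dotZl dotDr dotDr dotZr dotZr (dotC _ w) -/c -/d; nra.
(* Close to the minimiser [- c / d] of the quadratic, but with a denominator that stays positive
   when [d = 0] and a value in [0, 1]. *)
have := key (- c / (d - c)); rewrite divr_ge0 ?ler_pdivrMr/=; [|lra..].
move=> /(_ ltac:(lra)).
have -> : 2 * (- c / (d - c)) * c + (- c / (d - c)) ^+ 2 * d =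
   (c ^+ 2 / (d - c)) * (- 2 + d / (d - c)) by field; lra.
have q : 0 < c ^+ 2 / (d - c) by rewrite divr_gt0 ?exprn_even_gt0//=; lra.
rewrite (pmulr_rge0 _ q) addrC subr_ge0 ler_pdivlMr; lra.
Qed.

End separation.

(** * Heights and distances in the Klein model *)

Section klein.
Variables (R : realType) (n : nat).
Local Notation V := 'rV[R]_n.+1.
Implicit Types (x y z v : V) (a : R) (K : set V) (s : seq V).

(* In the Klein model cosh d(x, y) = (1 - <x, y>) / (hgt x * hgt y). *)
Definition hgt x : R := Num.sqrt (1 - dot x x).

Lemma hgt_ge0 x : 0 <= hgt x.
Proof. exact: sqrtr_ge0. Qed.

Lemma hgt_gt0 x : dot x x < 1 -> 0 < hgt x.
Proof. by move=> x1; rewrite sqrtr_gt0 subr_gt0. Qed.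

Lemma sqr_hgt x : dot x x <= 1 -> hgt x ^+ 2 = 1 - dot x x.
Proof. by move=> x1; rewrite sqr_sqrtr// subr_ge0. Qed.

Lemma hgt_le1 x : hgt x <= 1.
Proof. by rewrite -sqrtr1 ler_wsqrtr// lerBlDr lerDl dotxx_ge0. Qed.

Lemma enorm_lt1 x : (enorm x < 1) = (dot x x < 1).
Proof. by rewrite enorm_lt ?ler01// expr1n. Qed.

Lemma enorm_le1 x : (enorm x <= 1) = (dot x x <= 1).
Proof. by rewrite enorm_le ?ler01// expr1n. Qed.

Lemma one_sub_dot x y : dot x x < 1 -> dot y y <= 1 ->
  hgt x ^+ 2 <= 2 * (1 - dot x y).
Proof.
move=> x1 y1; rewrite sqr_hgt ?ltW//.
have x1' : enorm x < 1 by rewrite enorm_lt1.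
have y1' : enorm y <= 1 by rewrite enorm_le1.
have := cauchy_schwarz x y; rewrite -sqr_enorm.
by have := enorm_ge0 x; have := enorm_ge0 y; nra.
Qed.

(** The hypothesis says that cosh d(x, y) is at most [E]. Since hgt^2 <= 2 (1 - <x, y>) for either
    point, the heights agree up to 2 E; then |x - y|^2 = 2 (1 - <x, y>) - hgt(x)^2 - hgt(y)^2 gives
    the distance. *)
Lemma kclose_bounds x y E : dot x x < 1 -> dot y y < 1 ->
  1 - dot x y <= E * hgt x * hgt y ->
  [/\ hgt y <= 2 * E * hgt x, hgt x <= 2 * E * hgt y &
      enorm (x - y) <= 2 * E * hgt x].
Proof.
move=> x1 y1 H.
have := one_sub_dot x1 (ltW y1); have := one_sub_dot y1 (ltW x1).
rewrite (dotC y).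
have hx := hgt_gt0 x1; have hy := hgt_gt0 y1 => Hy Hx.
have A : hgt y <= 2 * E * hgt x by rewrite -(ler_pM2r hy); nra.
have B : hgt x <= 2 * E * hgt y by rewrite -(ler_pM2r hx); nra.
split => //; rewrite enorm_le; last by apply: le_trans A; exact: hgt_ge0.
rewrite !dotE (dotC y).
have := sqr_hgt (ltW x1); have := sqr_hgt (ltW y1).
have E0 : 0 <= E * hgt x by have := hgt_ge0 y; nra.
by nra.
Qed.

(** A node only guarantees a point of height at most [h], perhaps far smaller. Sliding it towards
    the fixed point [z0] brings its height to the order of [h] at a cost of at most [h] in
    position. *)
Lemma push_in K z0 : aff_convex K -> K z0 -> dot z0 z0 < 1 ->
  exists2 h0, 0 < h0 & forall h z, 0 < h <= h0 -> K z -> dot z z < 1 ->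
    1 - dot z z <= h ^+ 2 ->
    exists q, [/\ K q, h ^+ 2 / 2 <= 1 - dot q q <= 2 * h ^+ 2 &
      enorm (q - z) <= h].
Proof.
move=> cK Kz0 z01; have z01' : enorm z0 < 1 by rewrite enorm_lt1.
pose g := 1 - enorm z0; have g0 : 0 < g by rewrite subr_gt0.
have g1 : g <= 1 by rewrite lerBlDr lerDl enorm_ge0.
exists (g / 4) => [|h z /andP[h0 hg] Kz z1 zh]; first by lra.
pose c := dot z (z - z0).
have hh : h ^+ 2 <= g ^+ 2 / 16 by rewrite expr2; nra.
have ez1 : enorm z < 1 by rewrite enorm_lt1.
have cg : g / 2 <= c.
  rewrite /c dotBr; have := cauchy_schwarz z z0.
  by have := enorm_ge0 z; have := enorm_ge0 z0; rewrite /g in hh g0 g1 *; nra.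
have c0 : 0 < c by lra.
(* Makes the first order term 2 t c of 1 - |z - t (z - z0)|^2 equal to h^2. *)
pose t := h ^+ 2 / (2 * c).
have t0 : 0 <= t by rewrite divr_ge0 ?sqr_ge0//; lra.
have tg : t * g <= h ^+ 2.
  rewrite /t mulrAC ler_pdivrMr; last by lra.
  by rewrite ler_wpM2l ?sqr_ge0//; lra.
have t1 : t <= 1.
  by rewrite /t ler_pdivrMr ?mul1r; [nra|lra].
have D2 : enorm (z - z0) <= 2.
  by have := enorm_triangle 0 z z0; rewrite subr0 sub0r enormN; lra.
have tc : t * c = h ^+ 2 / 2 by rewrite /t; field; lra.
exists ((1 - t) *: z + t *: z0).
have -> : (1 - t) *: z + t *: z0 = z - t *: (z - z0).
  by rewrite scalerBl scale1r scalerBr opprB addrAC addrA.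
split.
- have -> : z - t *: (z - z0) = (1 - t) *: z + t *: z0.
    by rewrite scalerBl scale1r scalerBr opprB addrAC addrA.
  by apply: cK => //; rewrite t0.
- have -> : 1 - dot (z - t *: (z - z0)) (z - t *: (z - z0)) =
      1 - dot z z + 2 * (t * c) - t ^+ 2 * enorm (z - z0) ^+ 2.
    rewrite sqr_enorm /c; move: (z - z0) => w.
    by rewrite dotBl dotZl !dotBr !dotZr (dotC w); ring.
  have : t ^+ 2 * enorm (z - z0) ^+ 2 <= h ^+ 2 / 2.
    have tt : t ^+ 2 * g ^+ 2 <= h ^+ 2 * h ^+ 2.
      have tg0 : 0 <= t * g by rewrite mulr_ge0// ltW.
      by rewrite -exprMn -[leRHS]expr2 ler_sqr ?nnegrE ?sqr_ge0.
    have tt' : t ^+ 2 <= h ^+ 2 / 16.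
      have gg : 0 < g ^+ 2 by rewrite exprn_gt0.
      rewrite -(ler_pM2r gg) (le_trans tt)//.
      by have := ler_wpM2l (sqr_ge0 h) hh; lra.
    have d4 : enorm (z - z0) ^+ 2 <= 4.
      have -> : 4 = 2 ^+ 2 :> R by ring.
      by rewrite ler_sqr ?nnegrE ?enorm_ge0//.
    have := sqr_ge0 t; have := sqr_ge0 (enorm (z - z0)).
    by have := sqr_ge0 h; nra.
  have : 0 <= t ^+ 2 * enorm (z - z0) ^+ 2 by rewrite mulr_ge0 ?sqr_ge0.
  rewrite tc => *; lra.
- have -> : z - t *: (z - z0) - z = - (t *: (z - z0)).
    by rewrite addrAC subrr add0r.
  rewrite enormN enormZ ger0_norm//.
  have : t * enorm (z - z0) <= t * 2 by rewrite ler_wpM2l.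
  suff : t * 2 <= h by lra.
  rewrite -(ler_pM2r g0); have : h * h <= h * (g / 4) by rewrite ler_pM2l.
  by rewrite expr2 in tg; nra.
Qed.

(** Let [u] separate [v] from [z0] and from the points of [s], and let [e] be the normalized part of
    [u] orthogonal to [v]. Since <u, v> < <u, z0> with |z0| well below |v|, the radial part of [u]
    is at most its transverse part divided by |v| - |z0|. Moving by [r] against [e] from the
    direction of [v] therefore loses at least what extra depth can gain, and no deep point of [s]
    lies there. *)
Lemma missed_direction K z0 v s r : aff_convex K -> K z0 -> {in s, forall z, K z} ->
  ~ K v -> 0 < enorm v < 1 -> 0 < r -> 9 * r ^+ 2 <= 1 - dot v v ->
  2 * (1 - dot v v) <= (enorm v - enorm z0) * r -> enorm z0 <= 1 ->
  exists e, [/\ enorm e <= 1, dot e v = 0 & {in s, forall z, enorm z <= 1 ->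
    1 - dot z z <= (1 - dot v v) / 2 ->
    r / 2 < enorm (z - ((enorm v)^-1 *: v - r *: e))}].
Proof.
move=> cK Kz0 Ks nKv /andP[v0 v1] r0 rv rv0 ez0.
have [u u1 su] := finite_separation cK Kz0 Ks nKv.
set vh := (enorm v)^-1 *: v.
have vh1 : dot vh vh = 1.
  by rewrite !dotE -sqr_enorm; field; rewrite gt_eqF.
have vE : v = enorm v *: vh by rewrite scalerA mulfV ?scale1r// gt_eqF.
pose al := dot u vh; pose w := u - al *: vh; pose be := enorm w.
(* If [be = 0] then [e = 0]; this is why only [enorm e <= 1] is claimed. *)
pose e := be^-1 *: w.
have wv : dot w vh = 0 by rewrite dotBl dotZl vh1 mulr1 subrr.
have ev : dot e vh = 0 by rewrite dotZl wv mulr0.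
have weE : w = be *: e.
  have [b0|b0] := eqVneq be 0; last by rewrite scalerA mulfV// scale1r.
  by rewrite b0 scale0r; exact: enorm0_eq0.
have be0 : 0 <= be := enorm_ge0 _.
have ee : 0 < be -> enorm e = 1.
  by move=> b0; rewrite enormZ ger0_norm ?invr_ge0// mulVf ?gt_eqF.
have e1 : enorm e <= 1.
  have [b0|b0] := eqVneq be 0; last by rewrite ee// lt_def b0.
  by rewrite /e b0 invr0 scale0r enorm0 ler01.
have uE z : dot u z = al * dot vh z + be * dot e z.
  have -> : u = al *: vh + be *: e by rewrite -weE addrC subrK.
  by rewrite dotDl !dotZl.
have uv : dot u v = al * enorm v by rewrite [v in LHS]vE dotZr mulrC.
exists e; split => //.
  by rewrite [v]vE dotZr ev mulr0.
move=> z zs z1 zv; rewrite ltNge; apply/negP => zr.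
have suz : dot u v < dot u z by apply: su; rewrite inE zs orbT.
have su0 : dot u v < dot u z0 by apply: su; rewrite mem_head.
  have [u' u1' su'] := finite_separation cK Kz0 Ks nKv.
have D : 0 < 1 - dot v v by rewrite subr_gt0 -enorm_lt1.
have zvh : enorm (z - vh) <= 3 / 2 * r.
  have := enorm_triangle (vh - r *: e) z vh.
  have -> : vh - r *: e - vh = - (r *: e) by rewrite addrAC subrr add0r.
  rewrite enormN enormZ gtr0_norm// => H.
  have : r * enorm e <= r by rewrite ler_piMr// ltW.
  by move: zr; lra.
have zvh2 : dot z z - 2 * dot vh z + 1 <= 9 / 4 * r ^+ 2.
  move: zvh; rewrite enorm_le; last by nra.
  by rewrite dotBl !dotBr vh1 (dotC z vh) exprMn; nra.
have vv : dot v v = enorm v ^+ 2 by rewrite sqr_enorm.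
have z1' : dot z z <= 1 by rewrite -enorm_le1.
have d0 : 0 < dot vh z by have := sqr_ge0 (enorm v); have := dotxx_ge0 z; nra.
have dv2 : enorm v ^+ 2 <= dot vh z ^+ 2.
  by have := sqr_ge0 (1 - dot vh z); nra.
(* [z] is at least as far out as [v] along [vh], so a nonpositive radial part [al] cannot favour
   it. *)
have dv : enorm v <= dot vh z by rewrite -ler_sqr ?nnegrE// ltW.
have d1 : dot vh z <= 1.
  have := cauchy_schwarz vh z.
  have -> : enorm vh = 1.
    by apply/eqP; rewrite -(@eqrXn2 _ 2) ?enorm_ge0// sqr_enorm vh1 expr1n.
  by lra.
have ze : 0 < be -> dot e z <= - r / 2.
  move=> b0; have := cauchy_schwarz e (z - (vh - r *: e)).
  rewrite (ee b0) mul1r !dotBr (dotZr r) ev -sqr_enorm (ee b0) expr1n.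
  by move: zr; lra.
move: suz; rewrite uv uE; apply/negP; rewrite -leNgt.
have be_z : be * dot e z <= - (be * r / 2).
  have [b0|b0] := eqVneq be 0; first by rewrite b0 !mul0r oppr0.
  have bp : 0 < be by rewrite lt_def b0.
  have := ze bp; rewrite -(ler_pM2l bp); lra.
have [al0|al0] := leP al 0.
  have : al * dot vh z <= al * enorm v by nra.
  by have : 0 <= be * r by [rewrite mulr_ge0// ltW]; move: be_z; lra.
move: su0; rewrite uv uE => su0.
have vh0 : dot vh z0 <= enorm z0.
  have := cauchy_schwarz vh z0.
  have -> : enorm vh = 1.
    by apply/eqP; rewrite -(@eqrXn2 _ 2) ?enorm_ge0// sqr_enorm vh1 expr1n.
  by rewrite mul1r.
have ez : dot e z0 <= 1.
  have := cauchy_schwarz e z0; have := enorm_ge0 z0; have := enorm_ge0 e.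
  by nra.
have bal : al * (enorm v - enorm z0) <= be by nra.
have : al * (dot vh z - enorm v) <= al * (1 - dot v v).
  by rewrite ler_pM2l// vv; nra.
have : al * (2 * (1 - dot v v)) <= al * ((enorm v - enorm z0) * r).
  by rewrite ler_wpM2l// ltW.
have : al * (enorm v - enorm z0) * r <= be * r by rewrite ler_wpM2r// ltW.
by move: be_z; lra.
Qed.

End klein.

(** * Cube charts of the sphere and dyadic cells *)

Section chart.
Variables (R : realType) (n : nat) (i0 : 'I_n.+1) (s : R).
Hypothesis s1 : s * s = 1.
Local Notation V := 'rV[R]_n.+1.
Local Notation N := (n.+1%:R : R).
Implicit Types (t c : 'rV[R]_n) (x g b : V) (h d : R).

(* The point with coordinates t on the face x_(i0) = s of the cube. *)
Definition tau t : V :=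
  \row_k (if unlift i0 k is Some j then t ord0 j else s).

Definition theta t : V := (enorm (tau t))^-1 *: tau t.

Lemma tau_face t : tau t ord0 i0 = s.
Proof. by rewrite mxE unlift_none. Qed.

Lemma tau_lift t j : tau t ord0 (lift i0 j) = t ord0 j.
Proof. by rewrite mxE liftK. Qed.

Lemma norm_s : `|s| = 1.
Proof.
by apply/eqP; rewrite -(@eqrXn2 _ 2)// expr1n -normrX expr2 s1 normr1.
Qed.

Lemma dimr_ge1 : 1 <= N.
Proof. by rewrite ler1n. Qed.

Lemma tau_ge1 t : 1 <= enorm (tau t).
Proof. by rewrite -norm_s -(tau_face t) coord_le_enorm. Qed.

Lemma tau_gt0 t : 0 < enorm (tau t).
Proof. exact: lt_le_trans (tau_ge1 t). Qed.

Lemma tau_le t : (forall j, `|t ord0 j| <= 1) -> enorm (tau t) <= N.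
Proof.
move=> t1; rewrite -[leRHS]mulr1; apply: enorm_le_coord => i.
by case: (unliftP i0 i) => [j|] ->; rewrite ?tau_lift// tau_face norm_s.
Qed.

Lemma tauB_le t c d : 0 <= d -> (forall j, `|t ord0 j - c ord0 j| <= d) ->
  enorm (tau t - tau c) <= N * d.
Proof.
move=> d0 tc; apply: enorm_le_coord => i; rewrite !mxE.
by case: (unliftP i0 i) => [j|] _ //; rewrite subrr normr0.
Qed.

Lemma dot_theta t : dot (theta t) (theta t) = 1.
Proof.
by rewrite !dotE -sqr_enorm; field; rewrite gt_eqF ?tau_gt0.
Qed.

Lemma enorm_theta t : enorm (theta t) = 1.
Proof.
by apply/eqP; rewrite -(@eqrXn2 _ 2) ?enorm_ge0// sqr_enorm dot_theta expr1n.
Qed.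

Lemma tauE t : tau t = enorm (tau t) *: theta t.
Proof. by rewrite scalerA mulfV ?scale1r// gt_eqF ?tau_gt0. Qed.

(** Radial projection to the unit sphere does not expand distances between points of norm at least
    1. *)
Lemma thetaB_le t c d : 0 <= d -> (forall j, `|t ord0 j - c ord0 j| <= d) ->
  enorm (theta t - theta c) <= N * d.
Proof.
move=> d0 tc; apply: le_trans (tauB_le d0 tc).
rewrite enorm_le ?enorm_ge0// sqr_enorm (tauE t) (tauE c).
have := cauchy_schwarz (theta t) (theta c); rewrite !enorm_theta mulr1.
move: (dot_theta t) (dot_theta c) (tau_ge1 t) (tau_ge1 c).
move: (enorm (tau t)) (enorm (tau c)) (theta t) (theta c) => a b u v uu vv a1 b1.
rewrite !dotE uu vv (dotC v); set d' := dot _ _ => d1.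
have : 0 <= (1 - d') * (a * b - 1) by rewrite mulr_ge0 ?subr_ge0//; nra.
by have := sqr_ge0 (a - b); nra.
Qed.

Lemma theta_face_ge t : (forall j, `|t ord0 j| <= 1) ->
  N^-1 <= s * theta t ord0 i0.
Proof.
move=> t1; rewrite mxE tau_face mulrCA s1 mulr1 lef_pV2 ?posrE ?tau_gt0//.
exact: tau_le.
Qed.

(* The functional x |-> x_(lift i0 j) - t_j s x_i0 vanishes on the ray through
   theta t; it recovers the chart coordinates from a point of the cone. *)
Lemma cone_theta r t j :
  (r *: theta t) ord0 (lift i0 j) = t ord0 j * (s * (r *: theta t) ord0 i0).
Proof. by rewrite !mxE unlift_none liftK; ring: s1. Qed.

Lemma cone_coord_le r t x j : (forall j, `|t ord0 j| <= 1) ->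
  `|x ord0 (lift i0 j) - t ord0 j * (s * x ord0 i0)| <=
  2 * enorm (r *: theta t - x).
Proof.
move=> t1; have -> : x ord0 (lift i0 j) - t ord0 j * (s * x ord0 i0) =
    (x - r *: theta t) ord0 (lift i0 j) -
    t ord0 j * (s * (x - r *: theta t) ord0 i0).
  rewrite [in RHS]mxE [X in _ = _ + X - _]mxE cone_theta.
  rewrite [X in _ = _ - _ * (_ * X)]mxE [X in _ = _ - _ * (_ * (_ + X))]mxE.
  by ring.
rewrite enormB; move: (x - _) => y.
rewrite (le_trans (ler_normB _ _))// mulr2n mulrDl mul1r lerD//.
  exact: coord_le_enorm.
rewrite !normrM norm_s mul1r -[leRHS]mul1r ler_pM//.
exact: coord_le_enorm.
Qed.

(** Near [theta c] the face coordinate [s * g ord0 i0] stays above 3 / (4 N), so dividing by it to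
    recover chart coordinates costs only a factor of order [N]. *)
Lemma cone_of_near c g h : (forall j, `|c ord0 j| <= 1) -> 0 < h <= 1 ->
  enorm (g - theta c) <= h / (4 * N) ->
  exists t r, [/\ 0 < r, g = r *: tau t & forall j, `|t ord0 j - c ord0 j| <= h].
Proof.
move=> c1 /andP[h0 h1]; have N1 := dimr_ge1; have N0 : 0 < N by lra.
have [iN iNE] : exists iN, N^-1 = iN by exists N^-1.
have iN0 : 0 < iN by rewrite -iNE invr_gt0.
rewrite invfM iNE => gc; pose r := s * g ord0 i0.
have hi : h * (4^-1 * iN) <= 4^-1 * iN by rewrite ler_piMl//; lra.
have r34 : 3 / 4 * iN <= r.
  have := theta_face_ge c1; rewrite iNE.
  have : `|s * (g - theta c) ord0 i0| <= enorm (g - theta c).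
    by rewrite normrM norm_s mul1r coord_le_enorm.
  rewrite ler_norml [X in s * X]mxE [X in s * (_ + X)]mxE mulrDr mulrN -/r.
  by move=> /andP[+ _]; lra.
have r0 : 0 < r by lra.
exists (\row_j (g ord0 (lift i0 j) / r)), r; split => //.
  apply/rowP => k; rewrite mxE; case: (unliftP i0 k) => [j|] ->.
    by rewrite tau_lift mxE mulrC divfK// gt_eqF.
  by rewrite tau_face /r; ring: s1.
move=> j; rewrite mxE.
have -> : g ord0 (lift i0 j) / r - c ord0 j =
    (g ord0 (lift i0 j) - c ord0 j * r) / r by field; rewrite gt_eqF.
rewrite normrM normfV (gtr0_norm r0) ler_pdivrMr//.
have := @cone_coord_le 1 c g j c1; rewrite scale1r enormB -/r => H.
apply: (le_trans H).
have : h * (3 / 4 * iN) <= h * r by rewrite ler_pM2l.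
have : 0 < h * iN by rewrite mulr_gt0.
by move: gc; lra.
Qed.

(* When b is far from the cone over the face, any bounded be j will do. *)
Lemma boundary_coord b : exists be, forall t r j, (forall j, `|t ord0 j| <= 1) ->
  2^-1 <= r -> `|t ord0 j - be j| <= 8 * N * enorm (r *: theta t - b).
Proof.
have N1 := dimr_ge1; have N0 : 0 < N by lra.
have [b1|b1] := leP ((4 * N)^-1) `|b ord0 i0|.
  exists (fun j => b ord0 (lift i0 j) / (s * b ord0 i0)) => t r j t1 _.
  have bi : 0 < `|b ord0 i0| by rewrite (lt_le_trans _ b1)// invr_gt0; lra.
  have bs : s * b ord0 i0 != 0.
    by rewrite -normr_eq0 normrM norm_s mul1r gt_eqF.
  rewrite -(ler_pM2r bi) -[X in _ * X <= _]mul1r -[X in _ * (X * _) <= _]norm_s.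
  rewrite -!normrM.
  rewrite mulrBl divfK// distrC (le_trans (cone_coord_le r b j t1))//.
  have : 1 <= 4 * N * `|b ord0 i0|.
    by rewrite -ler_pdivrMl ?mulr1//; lra.
  move/(ler_wpM2l (enorm_ge0 (r *: theta t - b))). lra.
exists (fun=> 0) => t r j t1 r1; rewrite subr0 (le_trans (t1 j))//.
have [iN iNE] : exists iN, N^-1 = iN by exists N^-1.
have iN0 : 0 < iN by rewrite -iNE invr_gt0.
have iNN : N * iN = 1 by rewrite -iNE mulfV// gt_eqF.
rewrite invfM iNE in b1.
have : iN / 4 <= enorm (r *: theta t - b).
  apply: le_trans (coord_le_enorm _ i0).
  have := theta_face_ge t1; rewrite iNE => th.
  rewrite mxE [X in _ <= `|X + _|]mxE [X in _ <= `|_ + X|]mxE.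
  rewrite -[leRHS]mul1r -[X in _ <= X * _]norm_s.
  rewrite -normrM (le_trans _ (ler_norm _))// mulrBr mulrCA.
  have : s * b ord0 i0 <= `|b ord0 i0|.
    by rewrite -[leRHS]mul1r -[X in _ <= X * _]norm_s -normrM ler_norm.
  by nra.
move: (enorm _) => w; rewrite -(ler_pM2l N0); lra.
Qed.

End chart.

(** * Dyadic subdivision of a cell *)

Section tree.
Variables (R : realType) (n : nat).
Local Notation T := 'rV[R]_n.
Local Notation cell := (T * R)%type.
Implicit Types (t : T) (Q : cell) (e : {ffun 'I_n -> bool}).

(* A cell is given by its centre and half its side. *)
Definition in_cell Q t : Prop := forall j, `|t ord0 j - Q.1 ord0 j| <= Q.2.

Definition child Q e : cell :=
  (Q.1 + (Q.2 / 2) *: (\row_j (if e j then 1 else -1)), Q.2 / 2).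

Fixpoint leaves m Q : seq cell :=
  if m is m'.+1 then flatten [seq leaves m' (child Q e) | e <- index_enum _]
  else [:: Q].

Lemma sum_leavesS (W : nmodType) (f : cell -> W) m Q :
  \sum_(P <- leaves m.+1 Q) f P =
  \sum_(e : {ffun 'I_n -> bool}) \sum_(P <- leaves m (child Q e)) f P.
Proof. by rewrite /= big_flatten big_map. Qed.

Lemma sum_leavesD (W : nmodType) (f : cell -> W) m1 m2 Q :
  \sum_(P <- leaves (m1 + m2) Q) f P =
  \sum_(P <- leaves m1 Q) \sum_(P' <- leaves m2 P) f P'.
Proof.
elim: m1 Q => [|m1 IH] Q; first by rewrite big_seq1.
by rewrite addSn !sum_leavesS; apply: eq_bigr => e _; rewrite IH.
Qed.

Lemma size_leaves m Q : size (leaves m Q) = ((2 ^ n) ^ m)%N.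
Proof.
elim: m Q => // m IH Q; rewrite -sum1_size sum_leavesS.
rewrite (eq_bigr (fun=> ((2 ^ n) ^ m)%N)) => [|e _]; last by rewrite sum1_size IH.
by rewrite sum_nat_const card_ffun card_bool card_ord expnS.
Qed.

Lemma sumr_leaves_const m Q (a : R) :
  \sum_(P <- leaves m Q) a = (2 ^+ n) ^+ m * a.
Proof.
by rewrite big_const_seq count_predT size_leaves iter_addr_0 -(mulr_natl a) !natrX.
Qed.

Lemma mem_leavesS m Q P : P \in leaves m.+1 Q ->
  exists e, P \in leaves m (child Q e).
Proof. by move=> /flattenP[_ /mapP[e _ ->] He]; exists e. Qed.

Lemma in_child Q e t : in_cell (child Q e) t -> in_cell Q t.
Proof.
move=> H j; have := H j; rewrite !mxE /=; case: (e j); rewrite !ler_norml; lra.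
Qed.

Lemma leaves_size m Q P : P \in leaves m Q -> P.2 = Q.2 / 2 ^+ m.
Proof.
elim: m Q => [|m IH] Q; first by rewrite inE => /eqP ->; rewrite expr0 divr1.
move=> /mem_leavesS[e /IH ->] /=; rewrite exprS; field.
by rewrite gt_eqF// exprn_gt0.
Qed.

Lemma leaves_sub m Q P t : P \in leaves m Q -> in_cell P t -> in_cell Q t.
Proof.
elim: m Q => [|m IH] Q; first by rewrite inE => /eqP ->.
by move=> /mem_leavesS[e /IH H] /H; exact: in_child.
Qed.

Lemma leaves_center m Q P : 0 <= Q.2 -> P \in leaves m Q -> in_cell Q P.1.
Proof.
move=> Q0 QP; apply: (leaves_sub QP) => j; rewrite subrr normr0.
by rewrite (leaves_size QP) divr_ge0// exprn_ge0.
Qed.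

Lemma leaves_cover m Q t : in_cell Q t -> exists2 P, P \in leaves m Q & in_cell P t.
Proof.
elim: m Q => [|m IH] Q tQ; first by exists Q => //; rewrite inE.
have [|P PQ Pt] := IH (child Q [ffun j => Q.1 ord0 j <= t ord0 j]).
  move=> j; have := tQ j; rewrite !mxE ffunE /=.
  by have [H|H] := leP (Q.1 ord0 j) (t ord0 j); rewrite !ler_norml; lra.
exists P => //; apply/flattenP; eexists; last exact: PQ.
by apply/mapP; eexists; last reflexivity; rewrite mem_index_enum.
Qed.

Lemma mem_leavesD m1 m2 Q P P' : P \in leaves m1 Q -> P' \in leaves m2 P ->
  P' \in leaves (m1 + m2) Q.
Proof.
elim: m1 Q => [|m1 IH] Q; first by rewrite inE => /eqP ->.
move=> /flattenP[_ /mapP[e eI ->] He] HP; apply/flattenP.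
by exists (leaves (m1 + m2) (child Q e)); [apply: map_f|exact: IH].
Qed.

Lemma sum_ffun_coord (f : bool -> R) (j : 'I_n) :
  \sum_(e : {ffun 'I_n -> bool}) f (e j) = 2 ^+ n / 2 * (f true + f false).
Proof.
pose F i b := if i == j then f b else 1.
have E (e : {ffun 'I_n -> bool}) : f (e j) = \prod_i F i (e i).
  rewrite (bigD1 j)//= big1 ?mulr1 /F ?eqxx// => i /negbTE -> //.
rewrite (eq_bigr _ (fun e _ => E e)) -bigA_distr_bigA (bigD1 j)//= big_bool.
rewrite /F eqxx mulrC; congr (_ * _).
have -> : 2 ^+ n = \prod_(i < n) 2 :> R by rewrite prodr_const card_ord.
rewrite [in RHS](bigD1 j)//= mulrC mulKf//.
by apply: eq_bigr => i /negbTE ij; rewrite big_bool ij.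
Qed.

(** The difference quotients over the two halves of an interval average to the one over the whole
    interval; the other n - 1 coordinates only multiply the number of leaves. *)
Lemma telescope_leaves (F : R -> R) (j : 'I_n) m Q : Q.2 != 0 ->
  \sum_(P <- leaves m Q)
     (F (P.1 ord0 j + P.2) - F (P.1 ord0 j - P.2)) / P.2 =
  (2 ^+ n) ^+ m * ((F (Q.1 ord0 j + Q.2) - F (Q.1 ord0 j - Q.2)) / Q.2).
Proof.
elim: m Q => [|m IH] Q Q0; first by rewrite big_seq1 mul1r.
have Q20 : Q.2 / 2 != 0 by rewrite mulf_neq0// invr_neq0.
rewrite sum_leavesS (eq_bigr _ (fun e _ => IH (child Q e) Q20)) -mulr_sumr.
rewrite exprSr -mulrA; congr (_ * _).
pose x := Q.1 ord0 j; pose h := Q.2 / 2.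
pose f (b : bool) := let y := x + h * (if b then 1 else -1) in
  (F (y + h) - F (y - h)) / h.
rewrite (eq_bigr (fun e : {ffun _} => f (e j))); last first.
  by move=> e _; rewrite /f !mxE.
rewrite sum_ffun_coord /f mulr1 mulrN1 !addrK subrK.
have -> : x + h + h = Q.1 ord0 j + Q.2 by rewrite /x /h; field.
have -> : x - h - h = Q.1 ord0 j - Q.2 by rewrite /x /h; field.
by rewrite /h; field.
Qed.

End tree.

(** * The horoball potential *)

Section signed_sqrt.
Variable R : realType.
Implicit Types x y u v h : R.

(* Half an antiderivative of |x|^(-1/2): its increments over the cells of a
   subdivision telescope. *)
Definition ssqrt x : R := if 0 <= x then Num.sqrt x else - Num.sqrt (- x).

Lemma ssqrtN x : ssqrt (- x) = - ssqrt x.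
Proof.
rewrite /ssqrt oppr_ge0; have [x0|x0|->] := ltgtP x 0.
- by rewrite opprK.
- by rewrite opprK.
- by rewrite oppr0 sqrtr0 oppr0.
Qed.

Lemma sqrtrD_le x y : 0 <= x -> 0 <= y ->
  Num.sqrt (x + y) <= Num.sqrt x + Num.sqrt y.
Proof.
move=> x0 y0; rewrite -ler_sqr ?nnegrE ?addr_ge0 ?sqrtr_ge0//.
rewrite sqr_sqrtr ?addr_ge0// sqrrD !sqr_sqrtr//.
have : 0 <= Num.sqrt x * Num.sqrt y by rewrite mulr_ge0 ?sqrtr_ge0.
by rewrite -mulr_natl; lra.
Qed.

Lemma ssqrt_hoelder u v : u <= v -> ssqrt v - ssqrt u <= 2 * Num.sqrt (v - u).
Proof.
have H (a b : R) : 0 <= a -> a <= b -> Num.sqrt b - Num.sqrt a <= Num.sqrt (b - a).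
  move=> a0 ab; have b0 : 0 <= b - a by rewrite subr_ge0.
  by have := sqrtrD_le a0 b0; rewrite addrC subrK; lra.
move=> uv; have s0 := sqrtr_ge0 (v - u); rewrite /ssqrt.
have [u0|u0] := leP 0 u; have [v0|v0] := leP 0 v.
- by have := H _ _ u0 uv; lra.
- by lra.
- have : Num.sqrt v <= Num.sqrt (v - u) by rewrite ler_wsqrtr//; lra.
  have : Num.sqrt (- u) <= Num.sqrt (v - u) by rewrite ler_wsqrtr//; lra.
  by lra.
- have := H (- v) (- u); rewrite opprK [- u + v]addrC.
  by move=> /(_ ltac:(lra) ltac:(lra)); lra.
Qed.

(** Links the telescoping quotient to the potential: h + |y| stands for the size of a cell plus its
    distance to the singularity, which keeps the left side finite even for the cell that contains
    the singularity. *)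
Lemma ssqrt_diff_ge y h : 0 < h ->
  (Num.sqrt (h + `|y|))^-1 <= (ssqrt (y + h) - ssqrt (y - h)) / h.
Proof.
move=> h0; wlog y0 : y / 0 <= y.
  move=> H; have [|y0] := leP 0 y; first exact: H.
  have := H (- y) ltac:(lra); rewrite normrN => /le_trans; apply.
  rewrite (_ : - y + h = - (y - h)); last by ring.
  by rewrite (_ : - y - h = - (y + h)) ?ssqrtN; [rewrite opprK addrC|ring].
rewrite ger0_norm// addrC ler_pdivlMr//.
have yh : 0 < y + h by lra.
have q0 : 0 < Num.sqrt (y + h) by rewrite sqrtr_gt0.
rewrite mulrC ler_pdivrMr//.
have qq : Num.sqrt (y + h) * Num.sqrt (y + h) = y + h.
  by rewrite -expr2 sqr_sqrtr// ltW.
rewrite /ssqrt (ltW yh); have [yh0|yh0] := leP 0 (y - h).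
  set a := Num.sqrt (y - h); set c := Num.sqrt (y + h) in q0 qq *.
  have aa : a * a = y - h by rewrite -expr2 sqr_sqrtr.
  have a0 : 0 <= a by exact: sqrtr_ge0.
  have ac : a <= c by rewrite ler_wsqrtr//; lra.
  by nra.
rewrite opprK mulrDl qq; have : 0 <= Num.sqrt (- (y - h)) * Num.sqrt (y + h).
  by rewrite mulr_ge0// sqrtr_ge0.
lra.
Qed.

End signed_sqrt.

Section potential.
Variables (R : realType) (n : nat) (i0 : 'I_n.+1) (s : R).
Hypothesis s1 : s * s = 1.
Local Notation V := 'rV[R]_n.+1.
Local Notation T := 'rV[R]_n.
Local Notation cell := (T * R)%type.
Local Notation N := (n.+1%:R : R).
Local Notation theta := (theta i0 s).
Implicit Types (Q P : cell) (b : V) (kap : R).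

(** The point of height [Q.2] on the ray through the centre of the cell. *)
Definition apex Q : V := Num.sqrt (1 - Q.2 ^+ 2) *: theta Q.1.

(* Klein model form of the horoball of tangency point b; (1 - <x, b>) / hgt x is
   the exponential of the Busemann function of b. *)
Definition horo b kap (x : V) : Prop := 1 - dot x b < kap * hgt x.

(* Up to a constant factor, the fourth root of the exponential of the depth of
   apex Q in the horoball of tangency point b. *)
Definition pot b kap Q : R :=
  Num.sqrt (Num.sqrt (kap * Q.2) / (Q.2 + enorm (apex Q - b))).

Lemma dot_apex Q : 0 <= Q.2 <= 1 -> dot (apex Q) (apex Q) = 1 - Q.2 ^+ 2.
Proof.
move=> Q01; rewrite dotZl dotZr dot_theta// mulr1 -expr2 sqr_sqrtr//.
by rewrite subr_ge0 expr_le1//; lra.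
Qed.

Lemma hgt_apex Q : 0 <= Q.2 <= 1 -> hgt (apex Q) = Q.2.
Proof.
move=> Q01; rewrite /hgt dot_apex// opprB addrC subrK sqrtr_sqr ger0_norm//.
by case/andP: Q01.
Qed.

Lemma apex_theta Q : 0 <= Q.2 <= 1 -> enorm (apex Q - theta Q.1) <= Q.2 ^+ 2.
Proof.
move=> Q01; rewrite -[X in _ - X]scale1r -scalerBl enormZ enorm_theta// mulr1.
have q0 : 0 <= 1 - Q.2 ^+ 2 by rewrite subr_ge0 expr_le1//; lra.
have := sqrtr_ge0 (1 - Q.2 ^+ 2); have := sqr_sqrtr q0.
set r := Num.sqrt _ => rr r0.
have r1 : r <= 1 by have := sqr_ge0 Q.2; nra.
by rewrite ler0_norm ?subr_le0// opprB; nra.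
Qed.

(** For a unit vector b, 2 (1 - <x, b>) = |x - b|^2 + hgt(x)^2. Potential at least 1 thus certifies
    that the apex is in the horoball, and disjointness then determines b. *)
Lemma pot_ge1_horo b kap Q : 0 < Q.2 <= 1 -> 0 < kap -> dot b b = 1 ->
  1 <= pot b kap Q -> horo b kap (apex Q).
Proof.
move=> /andP[Q0 Q1] k0 bb; have Q01 : 0 <= Q.2 <= 1 by rewrite ltW.
rewrite /pot -{1}sqrtr1 /horo hgt_apex//.
have a0 := enorm_ge0 (apex Q - b); have kQ : 0 < kap * Q.2 by rewrite mulr_gt0.
rewrite ler_sqrt; last by rewrite divr_ge0 ?sqrtr_ge0// addr_ge0// ltW.
rewrite ler_pdivlMr ?mul1r; last by lra.
move=> H; have : (Q.2 + enorm (apex Q - b)) ^+ 2 <= kap * Q.2.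
  by rewrite -[leRHS](sqr_sqrtr (ltW kQ)) ler_sqr ?nnegrE ?sqrtr_ge0 ?addr_ge0// ltW.
have := sqr_enorm (apex Q - b); rewrite dotBl !dotBr bb dot_apex// (dotC b).
have := exprn_gt0 2 Q0; have : 0 <= Q.2 * enorm (apex Q - b).
  by rewrite mulr_ge0// ltW.
by rewrite sqrrD -mulr_natl; lra.
Qed.

Lemma leaves_size01 m Q P : 0 < Q.2 <= 1 -> P \in leaves m Q ->
  [/\ 0 < P.2, P.2 <= 1 & P.2 <= Q.2].
Proof.
move=> /andP[Q0 Q1] /leaves_size ->.
have m0 : 0 < 2 ^+ m :> R by rewrite exprn_gt0.
have m1 : 1 <= 2 ^+ m :> R by rewrite exprn_ege1// ler1n.
split; first by rewrite divr_gt0.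
  by rewrite ler_pdivrMr//; lra.
by rewrite ler_pdivrMr// ler_peMr// ltW.
Qed.

Lemma apex_leaf m Q P : 0 < Q.2 <= 1 -> P \in leaves m Q ->
  enorm (apex P - apex Q) <= 3 * N * Q.2.
Proof.
move=> Q01 PQ; have /andP[Q0 Q1] := Q01.
have [P0 P1 PQ2] := leaves_size01 Q01 PQ.
have hP : enorm (apex P - theta P.1) <= P.2 ^+ 2 by apply: apex_theta; rewrite ltW.
have hQ : enorm (apex Q - theta Q.1) <= Q.2 ^+ 2 by apply: apex_theta; rewrite ltW.
have hPQ := thetaB_le i0 s1 (ltW Q0) (leaves_center (ltW Q0) PQ).
have := enorm_triangle (theta P.1) (apex P) (apex Q).
have := enorm_triangle (theta Q.1) (theta P.1) (apex Q).
rewrite (enormB (theta Q.1) (apex Q)).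
have N1 : 1 <= N by rewrite ler1n.
have : Q.2 <= N * Q.2 by rewrite ler_peMl// ltW.
have : P.2 ^+ 2 <= Q.2 by nra.
have : Q.2 ^+ 2 <= Q.2 by nra.
lra.
Qed.

(** Levels are counted in fours so that the two square roots leave an integral power of 2. *)
Lemma sqrt_pow4 (a : R) mu : 0 <= a ->
  Num.sqrt (Num.sqrt (a / 2 ^+ (4 * mu))) = Num.sqrt (Num.sqrt a) / 2 ^+ mu.
Proof.
move=> a0; rewrite mulnC exprM (_ : 4 = 2 * 2)%N// exprM.
have p0 : 0 <= 2 ^+ mu :> R by rewrite exprn_ge0.
rewrite sqrtrM// sqrtrV ?exprn_ge0// sqrtr_sqr ger0_norm ?exprn_ge0//.
by rewrite sqrtrM ?sqrtr_ge0// sqrtrV ?exprn_ge0// sqrtr_sqr ger0_norm.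
Qed.

(** Separates the decay common to all leaves from the gain of those that come close to [b]. *)
Lemma pot_leaf b kap mu Q P : 0 < Q.2 <= 1 -> 0 < kap ->
  P \in leaves (4 * mu) Q ->
  pot b kap P = pot b kap Q / 2 ^+ mu *
    Num.sqrt ((Q.2 + enorm (apex Q - b)) / (P.2 + enorm (apex P - b))).
Proof.
move=> Q01 k0 PQ; have /andP[Q0 _] := Q01; have [P0 _ _] := leaves_size01 Q01 PQ.
have kQ : 0 <= kap * Q.2 by rewrite mulr_ge0// ltW.
have uQ : 0 < Q.2 + enorm (apex Q - b) by rewrite ltr_wpDr ?enorm_ge0.
have uP : 0 < P.2 + enorm (apex P - b) by rewrite ltr_wpDr ?enorm_ge0.
have s0 : 0 <= Num.sqrt (kap * Q.2) by exact: sqrtr_ge0.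
rewrite /pot [in LHS]sqrtrM ?sqrtr_ge0// [X in kap * X](leaves_size PQ).
rewrite [X in Num.sqrt (Num.sqrt X)]mulrA sqrt_pow4//.
rewrite [in X in _ = X / _ * _]sqrtrM// [in X in _ = _ * X]sqrtrM ?ltW//.
rewrite !sqrtrV ?ltW//.
field.
by rewrite !gt_eqF ?sqrtr_gt0// exprn_gt0.
Qed.

Lemma pot_ge0 b kap Q : 0 <= pot b kap Q.
Proof. exact: sqrtr_ge0. Qed.

Lemma sqrt4N_le (a : R) : 0 <= a -> Num.sqrt (4 * N * a) <= 2 * N * Num.sqrt a.
Proof.
have N1 : 1 <= N by rewrite ler1n.
move=> a0; rewrite -ler_sqr ?nnegrE ?mulr_ge0 ?sqrtr_ge0//.
rewrite sqr_sqrtr ?mulr_ge0// exprMn sqr_sqrtr// ler_wpM2r//.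
by have := N1; move: (N) => x; nra.
Qed.

End potential.

Section potential_leaves.
Variables (R : realType) (n : nat) (i0 : 'I_n.+1) (s : R).
Hypothesis s1 : s * s = 1.
Local Notation V := 'rV[R]_n.+1.
Local Notation T := 'rV[R]_n.
Local Notation cell := (T * R)%type.
Local Notation N := (n.+1%:R : R).
Local Notation theta := (theta i0 s).
Local Notation apex := (apex i0 s).
Local Notation pot := (pot i0 s).
Implicit Types (Q P : cell) (b : V) (kap : R).

(** The factor found here is the later threshold [Y0]: above it every leaf keeps potential at least
    1, hence has its apex in the same horoball. *)
Lemma pot_leaf_ge b kap mu Q P : 0 < Q.2 <= 1 -> 0 < kap ->
  P \in leaves (4 * mu) Q -> pot b kap Q <= 2 * N * 2 ^+ mu * pot b kap P.
Proof.
move=> Q01 k0 PQ; rewrite (pot_leaf i0 s b Q01 k0 PQ).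
have /andP[Q0 _] := Q01; have [P0 _ PQ2] := leaves_size01 Q01 PQ.
have uQ : 0 < Q.2 + enorm (apex Q - b) by rewrite ltr_wpDr ?enorm_ge0.
have uP : 0 < P.2 + enorm (apex P - b) by rewrite ltr_wpDr ?enorm_ge0.
have N1 : 1 <= N by rewrite ler1n.
have H : P.2 + enorm (apex P - b) <= 4 * N * (Q.2 + enorm (apex Q - b)).
  have := apex_leaf i0 s1 Q01 PQ; have := enorm_triangle (apex Q) (apex P) b.
  have a0 := enorm_ge0 (apex Q - b).
  have := ler_peMl (ltW Q0) N1; have := ler_peMl a0 N1.
  have : 0 <= N * enorm (apex Q - b) by rewrite mulr_ge0.
  lra.
set u := Q.2 + _ in H uQ *; set w := P.2 + _ in H uP *.
have : 1 <= 2 * N * Num.sqrt (u / w).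
  have uw0 : 0 <= u / w by rewrite divr_ge0// ltW.
  apply: (le_trans _ (sqrt4N_le n uw0)).
  by rewrite -[leLHS]sqrtr1 ler_wsqrtr// mulrA ler_pdivlMr// mul1r. 
have -> : 2 * N * 2 ^+ mu * (pot b kap Q / 2 ^+ mu * Num.sqrt (u / w)) =
  pot b kap Q * (2 * N * Num.sqrt (u / w)) by field; rewrite gt_eqF// exprn_gt0.
by move=> h; rewrite ler_peMr// pot_ge0.
Qed.

Lemma pot_leaf_le b kap mu Q P : 0 < Q.2 <= 1 -> 0 < kap ->
  P \in leaves (4 * mu) Q -> pot b kap P <= 2 * N * 2 ^+ mu * pot b kap Q.
Proof.
move=> Q01 k0 PQ; rewrite (pot_leaf i0 s b Q01 k0 PQ).
have /andP[Q0 _] := Q01; have [P0 _ PQ2] := leaves_size01 Q01 PQ.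
have uQ : 0 < Q.2 + enorm (apex Q - b) by rewrite ltr_wpDr ?enorm_ge0.
have uP : 0 < P.2 + enorm (apex P - b) by rewrite ltr_wpDr ?enorm_ge0.
have N1 : 1 <= N by rewrite ler1n.
have p1 : 1 <= 2 ^+ mu :> R by rewrite exprn_ege1// ler1n.
have p16 : (2 ^+ (4 * mu) : R) = (2 ^+ mu * 2 ^+ mu) ^+ 2.
  by rewrite -exprD -exprM addnn -mul2n mulnAC.
have PE : Q.2 = P.2 * 2 ^+ (4 * mu).
  by rewrite (leaves_size PQ) divfK// gt_eqF// exprn_gt0.
have H : Q.2 + enorm (apex Q - b) <=
    4 * N * ((2 ^+ mu * 2 ^+ mu) ^+ 2 * (P.2 + enorm (apex P - b))).
  have := apex_leaf i0 s1 Q01 PQ; have := enorm_triangle (apex P) (apex Q) b.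
  rewrite (enormB (apex Q) (apex P)) -p16.
  have a0 := enorm_ge0 (apex P - b).
  have q1 : 1 <= 2 ^+ (4 * mu) :> R by rewrite exprn_ege1// ler1n.
  have : enorm (apex P - b) <= 2 ^+ (4 * mu) * enorm (apex P - b).
    by rewrite ler_peMl.
  have e2 : 0 <= 2 ^+ (4 * mu) * enorm (apex P - b) by rewrite mulr_ge0// exprn_ge0.
  have := ler_peMl (ltW Q0) N1; have := ler_peMl e2 N1.
  rewrite PE; lra.
set u := Q.2 + _ in H uQ *; set w := P.2 + _ in H uP *.
have : Num.sqrt (u / w) <= 2 * N * (2 ^+ mu * 2 ^+ mu).
  have -> : 2 ^+ mu * 2 ^+ mu = Num.sqrt ((2 ^+ mu * 2 ^+ mu) ^+ 2) :> R.
    by rewrite sqrtr_sqr ger0_norm// mulr_ge0// exprn_ge0.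
  apply: (le_trans _ (sqrt4N_le n _)); last exact: sqr_ge0.
  by move: H; rewrite (mulrA (4 * N)) => H; rewrite ler_wsqrtr// ler_pdivrMr.
have p0 := pot_ge0 i0 s b kap Q => h.
have : pot b kap Q / 2 ^+ mu * Num.sqrt (u / w) <=
   pot b kap Q / 2 ^+ mu * (2 * N * (2 ^+ mu * 2 ^+ mu)).
  by rewrite ler_wpM2l// divr_ge0// exprn_ge0.
have -> : pot b kap Q / 2 ^+ mu * (2 * N * (2 ^+ mu * 2 ^+ mu)) =
  2 * N * 2 ^+ mu * pot b kap Q by field; rewrite gt_eqF// exprn_gt0.
by [].
Qed.

(** In [pot_leaf] only the square root of the ratio of distances opposes the factor 2^-mu. One chart
    coordinate bounds it by a difference quotient of [ssqrt], whose sum over the leaves telescopes,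
    so its average is bounded independently of [mu]. The constant is 66 = 2 * (1 + 8 * 4). *)
Lemma pot_average b kap mu Q : (0 < n)%N -> (0 < mu)%N -> 0 < Q.2 <= 1 -> 0 < kap ->
  (forall t, in_cell Q t -> forall j, `|t ord0 j| <= 1) ->
  \sum_(P <- leaves (4 * mu) Q) pot b kap P <=
  (2 ^+ n) ^+ (4 * mu) * (66 * N ^+ 2 / 2 ^+ mu * pot b kap Q).
Proof.
move=> n0 mu0 Q01 k0 Qt; have /andP[Q0 Q1] := Q01.
have N1 : 1 <= N by rewrite ler1n.
pose j : 'I_n := Ordinal n0.
have [be hbe] := boundary_coord i0 s1 b.
pose D P := (ssqrt (P.1 ord0 j - be j + P.2) - ssqrt (P.1 ord0 j - be j - P.2)) / P.2.
pose sQ := Num.sqrt Q.2.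
have sQ0 : 0 < sQ by rewrite sqrtr_gt0.
have step P : P \in leaves (4 * mu) Q ->
    pot b kap P <= pot b kap Q / 2 ^+ mu * (2 * N) * (1 + 8 * N * sQ * D P).
  move=> PQ; rewrite (pot_leaf i0 s b Q01 k0 PQ) -[leRHS]mulrA ler_wpM2l//.
    by rewrite divr_ge0 ?pot_ge0// exprn_ge0.
  have [P0 P1 PQ2] := leaves_size01 Q01 PQ.
  have uP : 0 < P.2 + enorm (apex P - b) by rewrite ltr_wpDr ?enorm_ge0.
  have H : Q.2 + enorm (apex Q - b) <=
      4 * N * (P.2 + enorm (apex P - b) + Q.2).
    have := apex_leaf i0 s1 Q01 PQ; have := enorm_triangle (apex P) (apex Q) b.
    rewrite (enormB (apex Q) (apex P)).
    have a0 := enorm_ge0 (apex P - b).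
    have := ler_peMl (ltW Q0) N1; have := ler_peMl a0 N1.
    have : 0 <= N * enorm (apex P - b) by rewrite mulr_ge0.
    have : 0 <= N * P.2 by rewrite mulr_ge0// ltW.
    lra.
  (* [hbe] asks for a radius of at least 1/2; [mu > 0] makes the leaf small enough for its apex to
     have one. *)
  have p12 : 2^-1 <= Num.sqrt (1 - P.2 ^+ 2).
    have : P.2 <= 1 / 2.
      rewrite (leaves_size PQ) ler_pdivrMr ?exprn_gt0//.
      have : 2 <= 2 ^+ (4 * mu) :> R.
        by rewrite -[leLHS]expr1 ler_weXn2l ?ler1n// muln_gt0.
      by nra.
    move=> P12; rewrite -[leLHS]ger0_norm ?invr_ge0// -sqrtr_sqr ler_wsqrtr//.
    by nra.
  have Pt : forall j, `|P.1 ord0 j| <= 1.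
    by apply: Qt; apply: leaves_center PQ; rewrite ltW.
  have := hbe _ _ j Pt p12; rewrite -/(apex P) => hP.
  set w := _ + _ in uP H *.
  have hw : P.2 + `|P.1 ord0 j - be j| <= 8 * N * w.
    have := ler_peMl (ltW P0) N1; rewrite /w; move: hP.
    have : 0 <= N * P.2 by rewrite mulr_ge0// ltW.
    lra.
  have qw0 : 0 <= Q.2 / w by rewrite divr_ge0 ?ltW.
  have s4 := @sqrt4N_le R n (1 + Q.2 / w) (addr_ge0 ler01 qw0).
  apply: (@le_trans _ _ (Num.sqrt (4 * N * (1 + Q.2 / w)))).
    rewrite ler_wsqrtr// ler_pdivrMr//.
    by have -> : 4 * N * (1 + Q.2 / w) * w = 4 * N * (w + Q.2) by field; rewrite gt_eqF.
  apply: (le_trans s4); rewrite ler_wpM2l ?mulr_ge0//.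
  apply: (le_trans (sqrtrD_le _ _)) => //.
  rewrite sqrtr1 lerD2l.
  have hD := ssqrt_diff_ge (P.1 ord0 j - be j) P0; rewrite -/(D P) in hD.
  set z := P.2 + _ in hw hD.
  have z0 : 0 < z by rewrite ltr_wpDr.
  have sz0 : 0 < Num.sqrt z by rewrite sqrtr_gt0.
  apply: (@le_trans _ _ (8 * N * sQ * (Num.sqrt z)^-1)); last first.
    by rewrite ler_wpM2l// mulr_ge0 ?(ltW sQ0)// mulr_ge0.
  rewrite sqrtrM ?(ltW Q0)// -/sQ [8 * N * sQ]mulrC -mulrA ler_pM2l//.
  rewrite sqrtrV ?(ltW uP)// ler_pdivlMr// ler_pdivrMl ?sqrtr_gt0//.
  rewrite -ler_sqr ?nnegrE ?mulr_ge0 ?sqrtr_ge0//.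
  rewrite exprMn !sqr_sqrtr ?(ltW z0) ?(ltW uP)//.
  apply: (le_trans hw); rewrite mulrC ler_pM2l//.
  by move: N1; move: (N) => x; nra.
rewrite big_seq (le_trans (ler_sum _ (fun P PQ => step P PQ)))//.
rewrite -big_seq -mulr_sumr big_split /= sumr_leaves_const mulr1 -mulr_sumr.
have -> : \sum_(P <- leaves (4 * mu) Q) D P = (2 ^+ n) ^+ (4 * mu) * D Q.
  have := telescope_leaves (fun x => ssqrt (x - be j)) j (4 * mu) (lt0r_neq0 Q0).
  rewrite /D => E; transitivity (\sum_(P <- leaves (4 * mu) Q)
     (ssqrt (P.1 ord0 j + P.2 - be j) - ssqrt (P.1 ord0 j - P.2 - be j)) / P.2).
    by apply: eq_bigr => P _; congr ((ssqrt _ - ssqrt _) / _); ring.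
  by rewrite E; congr (_ * ((ssqrt _ - ssqrt _) / _)); ring.
(* After telescoping, only the quotient over the whole of [Q] is left, and the Hoelder bound of
   exponent 1/2 controls it. *)
have DQ : sQ * D Q <= 4.
  rewrite /D mulrA ler_pdivrMr//.
  have := @ssqrt_hoelder _ (Q.1 ord0 j - be j - Q.2) (Q.1 ord0 j - be j + Q.2).
  move=> /(_ ltac:(lra)).
  rewrite (_ : _ + Q.2 - (_ - Q.2) = 2 * Q.2); last by ring.
  rewrite sqrtrM// -/sQ => h.
  have s2 : Num.sqrt 2 <= 2 :> R.
    by rewrite -ler_sqr ?nnegrE ?sqrtr_ge0// sqr_sqrtr//; lra.
  have sq : sQ * sQ = Q.2 by rewrite -expr2 sqr_sqrtr// ltW.
  have -> : 4 * Q.2 = sQ * (2 * (2 * sQ)) by rewrite -[X in 4 * X]sq; ring.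
  rewrite ler_pM2l// (le_trans h)// ler_pM2l// ler_pM2r//.
set K := (2 ^+ n) ^+ _.
have K0 : 0 <= K by rewrite !exprn_ge0.
have M0 : 0 <= pot b kap Q / 2 ^+ mu by rewrite divr_ge0 ?pot_ge0// exprn_ge0.
have -> : K * (66 * N ^+ 2 / 2 ^+ mu * pot b kap Q) =
  pot b kap Q / 2 ^+ mu * (2 * N) * (K * (33 * N)) by ring.
rewrite ler_wpM2l ?(mulr_ge0 M0)//.
have -> : K + 8 * N * sQ * (K * D Q) = K * (1 + 8 * N * (sQ * D Q)) by ring.
rewrite ler_wpM2l//; have : 8 * N * (sQ * D Q) <= 8 * N * 4.
  by rewrite ler_wpM2l// mulr_ge0.
by move: N1; lra.
Qed.

End potential_leaves.

(** * Leaving a horoball along a segment *)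

Section horoball_exit.
Variables (R : realType) (n : nat).
Local Notation V := 'rV[R]_n.+1.
Implicit Types (x y b : V) (a kap : R).

Lemma one_sub_segment x y a :
  let q := (1 - a) *: x + a *: y in
  1 - dot q q = (1 - a) * (1 - dot x x) + a * (1 - dot y y) +
    a * (1 - a) * dot (x - y) (x - y).
Proof. by rewrite /= !dotE (dotC y x); ring. Qed.

Lemma segment_lt1 x y a : dot x x < 1 -> dot y y < 1 -> 0 <= a <= 1 ->
  dot ((1 - a) *: x + a *: y) ((1 - a) *: x + a *: y) < 1.
Proof.
move=> x1 y1 /andP[a0 a1]; rewrite -subr_gt0 one_sub_segment.
have : 0 <= a * (1 - a) * dot (x - y) (x - y).
  by rewrite !mulr_ge0 ?dotxx_ge0// subr_ge0.
have {}x1 : 0 < 1 - dot x x by rewrite subr_gt0.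
have {}y1 : 0 < 1 - dot y y by rewrite subr_gt0.
have := mulr_ge0 a0 (ltW y1); have : 0 <= (1 - a) * (1 - dot x x).
  by rewrite mulr_ge0 ?(ltW x1)// subr_ge0.
have [ah|ah] := leP a 2^-1.
  by have : 2^-1 * (1 - dot x x) <= (1 - a) * (1 - dot x x); [rewrite ler_pM2r//|]; lra.
by have : 2^-1 * (1 - dot y y) <= a * (1 - dot y y); [rewrite ler_pM2r// ltW|]; lra.
Qed.

(** Comes down to hgt x * hgt y <= 1 - <x, y>, that is, to cosh d(x, y) >= 1. Its use: horoballs are
    Euclidean convex in the Klein model. *)
Lemma hgt_concave x y a : dot x x < 1 -> dot y y < 1 -> 0 <= a <= 1 ->
  (1 - a) * hgt x + a * hgt y <= hgt ((1 - a) *: x + a *: y).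
Proof.
move=> x1 y1 a01; have q1 := segment_lt1 x1 y1 a01; have /andP[a0 a1] := a01.
have hx0 := hgt_ge0 x; have hy0 := hgt_ge0 y.
rewrite -ler_sqr ?nnegrE ?hgt_ge0//; last first.
  by rewrite addr_ge0 ?mulr_ge0// subr_ge0.
have hx := sqr_hgt (ltW x1); have hy := sqr_hgt (ltW y1).
rewrite (sqr_hgt (ltW q1)) one_sub_segment.
have key : hgt x * hgt y <= 1 - dot x y.
  have cs := cauchy_schwarz x y.
  have ex : enorm x < 1 by rewrite enorm_lt1.
  have ey : enorm y < 1 by rewrite enorm_lt1.
  have ex0 := enorm_ge0 x; have ey0 := enorm_ge0 y.
  apply: (@le_trans _ _ (1 - enorm x * enorm y)); last by lra.
  rewrite -ler_sqr ?nnegrE ?mulr_ge0//; last by nra.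
  rewrite exprMn hx hy -!sqr_enorm; have := sqr_ge0 (enorm x - enorm y).
  by rewrite !expr2; lra.
have : a * (1 - a) * (hgt x * hgt y) <= a * (1 - a) * (1 - dot x y).
  by rewrite ler_wpM2l// mulr_ge0// subr_ge0.
rewrite !dotE (dotC y x); move: hx hy; rewrite !expr2 => hx hy.
have -> : ((1 - a) * hgt x + a * hgt y) * ((1 - a) * hgt x + a * hgt y) =
  (1 - a) * (1 - a) * (hgt x * hgt x) + a * a * (hgt y * hgt y) +
  2 * (a * (1 - a) * (hgt x * hgt y)) by ring.
rewrite hx hy; lra.
Qed.

(** Stop where the concave function defining the horoball of [b] vanishes. Another horoball
    containing that point would, being open, contain points just before it; concavity puts these in
    the horoball of [b], against disjointness. *)
Lemma horo_exit (Phi : set V) (kap : V -> R) x y b :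
  (forall b b', Phi b -> Phi b' -> forall z, dot z z < 1 ->
     horo b (kap b) z -> horo b' (kap b') z -> b = b') ->
  dot x x < 1 -> dot y y < 1 -> 0 < kap b ->
  Phi b -> horo b (kap b) x -> ~ horo b (kap b) y ->
  exists2 a, 0 <= a <= 1 & forall b', Phi b' ->
    ~ horo b' (kap b') ((1 - a) *: x + a *: y).
Proof.
move=> disj x1 y1 k0 Pb bx nby.
pose q a := (1 - a) *: x + a *: y.
pose f b' a := kap b' * hgt (q a) - (1 - dot (q a) b').
have cq : continuous q.
  move=> a; apply: (@cvgD _ _ _ (nbhs a) _ (fun a => (1 - a) *: x) (fun a => a *: y)).
    apply: (@cvgZr_tmp _ _ _ (nbhs a) _ (fun a => 1 - a)).
    by apply: cvgB; [exact: cvg_cst|exact: cvg_id].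
  by apply: (@cvgZr_tmp _ _ _ (nbhs a) _ id); exact: cvg_id.
have cf b' : continuous (f b').
  move=> a.
  have c1 : 1 - dot (q t) (q t) @[t --> a] --> 1 - dot (q a) (q a).
    by apply: cvgB; [exact: cvg_cst|exact: (cvg_dot _ (cq a) (cq a))].
  have c2 : hgt (q t) @[t --> a] --> hgt (q a).
    by apply: (continuous_cvg _ _ c1); exact: sqrt_continuous.
  have c3 : dot (q t) b' @[t --> a] --> dot (q a) b'.
    by apply: cvg_dot; [exact: cq|exact: cvg_cst].
  apply: cvgB; first by apply: cvgM; [exact: cvg_cst|exact: c2].
  by apply: cvgB; [exact: cvg_cst|exact: c3].
have horoE b' a : horo b' (kap b') (q a) <-> 0 < f b' a.
  by rewrite /f subr_gt0.
have q0 : q 0 = x by rewrite /q subr0 scale1r scale0r addr0.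
have q1 : q 1 = y by rewrite /q subrr scale1r scale0r add0r.
have f0 : 0 < f b 0 by apply/horoE; rewrite q0.
have f1 : f b 1 <= 0 by rewrite leNgt; apply/negP => /horoE; rewrite q1.
have [|c c01 fc] := @IVT R (f b) 0 1 0 ler01 (continuous_subspaceT (cf b)).
  by rewrite ge_min f1 orbT le_max (ltW f0).
rewrite in_itv/= in c01; exists c => // b' Pb' /horoE gc.
have c0 : 0 < c.
  rewrite lt_def; case/andP: c01 => -> _; rewrite andbT; apply/eqP => cE.
  by move: f0; rewrite -[X in f b X]cE fc ltxx.
have [a [a0 ac ga]] : exists a, [/\ 0 < a, a < c & 0 < f b' a].
  have G : \forall a \near c^'-, 0 < f b' a.
    have : f b' a @[a --> c^'-] --> f b' c.
      by apply: cvg_at_left_filter; exact: cf.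
    by move/cvgr_gt => /(_ _ gc).
  have [a [[? ?] ?]] : exists a, (0 < a /\ a < c) /\ 0 < f b' a.
    near (c^'-) => a; exists a; split; first split.
    - by near: a; apply: nbhs_left_gt.
    - by near: a; apply: nbhs_left_lt.
    - by near: a.
  by exists a.
have a01 : 0 <= a <= 1 by case/andP: c01 => *; apply/andP; split; lra.
have fa : 0 < f b a.
  have t01 : 0 <= a / c <= 1.
    by rewrite divr_ge0 ?ler_pdivrMr ?mul1r ?(ltW ac) ?(ltW a0) ?(ltW c0).
  have qc1 : dot (q c) (q c) < 1 by apply: segment_lt1.
  have := hgt_concave x1 qc1 t01.
  have -> : (1 - a / c) *: x + (a / c) *: q c = q a.
    rewrite /q scalerDr !scalerA addrA -scalerDl divfK ?gt_eqF//.
    by congr (_ *: _ + _); field; rewrite gt_eqF.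
  have -> : f b a = kap b * (hgt (q a) - ((1 - a / c) * hgt x + a / c * hgt (q c)))
     + ((1 - a / c) * f b 0 + a / c * f b c).
    rewrite /f q0 /q !dotE; field; rewrite gt_eqF//.
  rewrite fc mulr0 addr0 => hc.
  have : 0 < (1 - a / c) * f b 0.
    by rewrite mulr_gt0// subr_gt0 ltr_pdivrMr// mul1r.
  by apply: ltr_wpDl; rewrite mulr_ge0 ?(ltW k0)// subr_ge0.
have bb' := disj b b' Pb Pb' (q a) (segment_lt1 x1 y1 a01).
move: gc; rewrite -bb'; [|exact/horoE|exact/horoE].
by rewrite fc ltxx.
Unshelve. all: by end_near. Qed.

End horoball_exit.

(** * Metric estimates for points near a cell *)

Section estimates.
Variables (R : realType) (n : nat).
Local Notation V := 'rV[R]_n.+1.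
Implicit Types (b x y c p q : V).

Lemma segment_near p q c (h w a : R) : dot p p < 1 -> dot q q < 1 ->
  0 <= a <= 1 -> 0 < h <= w ->
  h ^+ 2 / 2 <= 1 - dot p p <= 2 * h ^+ 2 ->
  h ^+ 2 / 2 <= 1 - dot q q <= 2 * h ^+ 2 ->
  enorm (p - c) <= w -> enorm (q - c) <= 2 * w ->
  let y := (1 - a) *: p + a *: q in
  [/\ h ^+ 2 / 2 <= 1 - dot y y, hgt y <= 5 * w & enorm (y - c) <= 2 * w].
Proof.
move=> p1 q1 a01 /andP[h0 hw] /andP[pl pu] /andP[ql qu] pc qc y.
have /andP[a0 a1] := a01; have b0 : 0 <= 1 - a by rewrite subr_ge0.
have w0 : 0 <= w by apply: le_trans hw; exact: ltW.
have pq : enorm (p - q) <= 3 * w.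
  have := enorm_triangle c p q; rewrite (enormB c q) => pq.
  by rewrite (le_trans pq)// (_ : 3 = 1 + 2)// mulrDl mul1r lerD.
have pq' : dot (p - q) (p - q) <= (3 * w) ^+ 2.
  by rewrite -enorm_le// mulr_ge0.
have D0 := dotxx_ge0 (p - q).
have aa0 : 0 <= a * (1 - a) by rewrite mulr_ge0.
have aD : a * (1 - a) * dot (p - q) (p - q) <= dot (p - q) (p - q).
  by rewrite ler_piMl// mulr_ile1// lerBlDr lerDl.
have aD0 := mulr_ge0 aa0 D0.
have yE := one_sub_segment p q a; rewrite -/y /= in yE.
have bp := ler_wpM2l b0 pl; have aq := ler_wpM2l a0 ql.
have bp' := ler_wpM2l b0 pu; have aq' := ler_wpM2l a0 qu.
have hw2 : h ^+ 2 <= w ^+ 2 by rewrite ler_sqr ?nnegrE// ltW.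
have w20 := sqr_ge0 w.
split.
- rewrite yE; move: aD0 bp aq; clear; lra.
- rewrite -ler_sqr ?nnegrE ?hgt_ge0 ?mulr_ge0//.
  rewrite sqr_hgt ?(ltW (segment_lt1 _ _ _))// yE.
  by move: pq' aD bp' aq' hw2 w20; rewrite !exprMn; clear; lra.
- have -> : y - c = (1 - a) *: (p - c) + a *: (q - c).
    by rewrite /y !scalerBr addrACA -opprD -scalerDl subrK scale1r.
  apply: (le_trans (enormD _ _)); rewrite !enormZ !ger0_norm//.
  have := ler_wpM2l b0 pc; have := ler_wpM2l a0 qc; have := mulr_ge0 b0 w0.
  by clear; lra.
Qed.

(** A point of height at most 2 h in the horoball has |q - b|^2 < 4 kap h. With [h * W] the size of
    a cell, the hypothesis on [kap] is a bound on its potential, and a large [W] makes the horoball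
    too small at height [h] to reach as far as [q]. *)
Lemma not_horo_far b q (kap h W u C Y : R) : dot q q < 1 -> 0 < h ->
  1 - dot q q <= 2 * h ^+ 2 -> 0 < kap -> dot b b = 1 -> 0 < W -> 0 <= u ->
  0 <= Y -> kap * (h * W) <= Y * u ^+ 2 -> u <= C * enorm (q - b) ->
  4 * (Y * C ^+ 2) <= W -> ~ horo b kap q.
Proof.
move=> q1 h0 qu k0 bb W0 u0 Y0 kY uC YW; rewrite /horo => hq.
have hg2 : hgt q <= 2 * h.
  rewrite -ler_sqr ?nnegrE ?hgt_ge0 ?mulr_ge0 ?(ltW h0)// sqr_hgt ?(ltW q1)//.
  by rewrite exprMn; move: qu (sqr_ge0 h); clear; lra.
have Dk : enorm (q - b) ^+ 2 < 4 * (kap * h).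
  have -> : enorm (q - b) ^+ 2 = dot q q - 2 * dot q b + 1.
    by rewrite sqr_enorm !dotE bb (dotC b); ring.
  have : kap * hgt q <= kap * (2 * h) by rewrite ler_pM2l.
  by move: q1 hq; clear; lra.
have uu : u ^+ 2 <= (C * enorm (q - b)) ^+ 2.
  by rewrite ler_sqr ?nnegrE// (le_trans u0).
have H : 4 * (kap * (h * W)) <= enorm (q - b) ^+ 2 * W.
  apply: (@le_trans _ _ (4 * (Y * (C * enorm (q - b)) ^+ 2))).
    by rewrite ler_pM2l// (le_trans kY)// ler_wpM2l.
  have -> : 4 * (Y * (C * enorm (q - b)) ^+ 2) =
    enorm (q - b) ^+ 2 * (4 * (Y * C ^+ 2)) by ring.
  by rewrite ler_wpM2l// sqr_ge0.
have : enorm (q - b) ^+ 2 * W < 4 * (kap * h) * W by rewrite ltr_pM2r.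
by move: H; rewrite !mulrA; clear; lra.
Qed.

Lemma far_side b p q x y (k r N : R) : 0 < N ->
  enorm (p - x) <= k -> enorm (q - y) <= k -> r <= N * enorm (x - y) ->
  4 * (N * k) <= r ->
  r <= 4 * N * enorm (p - b) \/ r <= 4 * N * enorm (q - b).
Proof.
move=> N0 px qy rN kr.
have tri : enorm (x - y) <= 2 * k + (enorm (p - b) + enorm (q - b)).
  have t1 := enorm_triangle p x y; have t2 := enorm_triangle b p y.
  have t3 := enorm_triangle q b y.
  rewrite (enormB x p) in t1; rewrite (enormB b q) in t3.
  by move: px qy t1 t2 t3; clear; lra.
have H := le_trans rN (ler_wpM2l (ltW N0) tri).
have [pq|/ltW pq] := leP (enorm (q - b)) (enorm (p - b)); [left|right];
  move: (ler_wpM2l (ltW N0) pq) kr H; clear; lra.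
Qed.

End estimates.

(** * Nodes, and points of the hull outside every horoball *)

Section nodes.
Variables (R : realType) (n : nat) (i0 : 'I_n.+1) (s : R).
Hypothesis s1 : s * s = 1.
Local Notation V := 'rV[R]_n.+1.
Local Notation T := 'rV[R]_n.
Local Notation cell := (T * R)%type.
Local Notation N := (n.+1%:R : R).
Local Notation theta := (theta i0 s).
Local Notation apex := (apex i0 s).
Local Notation pot := (pot i0 s).
Variables (K Phi : set V) (kap : V -> R) (z0 : V).
Hypothesis convK : aff_convex K.
Hypothesis K1 : forall x, K x -> dot x x < 1.
Hypothesis Kz0 : K z0.
Implicit Types (Q P : cell) (b x : V) (t : T).

Definition node Q : Prop := exists t r z,
  [/\ in_cell Q t, 0 < r, z = r *: tau i0 s t, K z & 1 - dot z z <= Q.2 ^+ 2].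

Definition outside x : Prop := forall b, Phi b -> ~ horo b (kap b) x.

Lemma node_leaf m Q P : 0 < Q.2 <= 1 -> P \in leaves m Q -> node P -> node Q.
Proof.
move=> Q01 PQ [t [r [z [Pt r0 zE Kz zP]]]]; exists t, r, z; split => //.
  exact: leaves_sub PQ Pt.
have [P0 _ PQ2] := leaves_size01 Q01 PQ.
have /andP[Q0 _] := Q01; apply: (le_trans zP).
by rewrite ler_sqr ?nnegrE ?(ltW P0) ?(ltW Q0).
Qed.

Lemma node_theta Q t t1 r z : 0 < Q.2 <= 1 -> in_cell Q t -> in_cell Q t1 ->
  0 < r -> z = r *: tau i0 s t -> dot z z < 1 -> 1 - dot z z <= Q.2 ^+ 2 ->
  enorm (z - theta t1) <= 3 * N * Q.2.
Proof.
move=> /andP[Q0 Q1] Qt Qt1 r0 zE z1 zQ.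
have N1 : 1 <= N by rewrite ler1n.
pose w := r * enorm (tau i0 s t).
have zw : z = w *: theta t by rewrite zE (tauE i0 s1) scalerA /w.
have w0 : 0 < w by rewrite mulr_gt0 ?tau_gt0.
have zz : dot z z = w ^+ 2 by rewrite zw dotZl dotZr dot_theta// mulr1.
have zt : enorm (z - theta t) <= Q.2.
  rewrite zw -[X in _ - X]scale1r -scalerBl enormZ enorm_theta// mulr1.
  rewrite zz in z1 zQ; have w1 : w < 1 by nra.
  by rewrite ler0_norm ?subr_le0 ?(ltW w1)// opprB; nra.
have tt : enorm (theta t - theta t1) <= N * (2 * Q.2).
  apply: thetaB_le => //; first by rewrite mulr_ge0// ltW.
  by move=> j; have := Qt j; have := Qt1 j; rewrite !ler_norml; lra.
have := enorm_triangle (theta t) z (theta t1).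
by have := ler_peMl (ltW Q0) N1; lra.
Qed.

Lemma node_point : exists2 h0, 0 < h0 & forall Q t, 0 < Q.2 <= 1 -> Q.2 <= h0 ->
  node Q -> in_cell Q t ->
  exists q, [/\ K q, Q.2 ^+ 2 / 2 <= 1 - dot q q <= 2 * Q.2 ^+ 2 &
    enorm (q - theta t) <= 4 * N * Q.2].
Proof.
have [h0 h00 H] := push_in convK Kz0 (K1 Kz0).
exists h0 => // Q t Q01 Qh [t1 [r [z [Qt1 r0 zE Kz zQ]]]] Qt.
have N1 : 1 <= N by rewrite ler1n.
have /andP[Q0 Q1] := Q01.
have [|q [Kq hq qz]] := H Q.2 z _ Kz (K1 Kz) zQ; first by rewrite Q0.
exists q; split => //.
have := node_theta Q01 Qt1 Qt r0 zE (K1 Kz) zQ.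
have := enorm_triangle z q (theta t).
by have := ler_peMl (ltW Q0) N1; lra.
Qed.

Lemma theta_gap t t' j : (forall j, `|t ord0 j| <= 1) ->
  (forall j, `|t' ord0 j| <= 1) ->
  `|t' ord0 j - t ord0 j| <= 2 * N * enorm (theta t - theta t').
Proof.
move=> t1 t1'; have := cone_coord_le i0 s1 1 (theta t') j t1.
have := cone_theta i0 s1 1 t' j; rewrite !scale1r => ->.
rewrite -mulrBl normrM => H.
have N0 : 0 < N by rewrite ltr0n.
have F := theta_face_ge i0 s1 t1'.
have : N^-1 <= `|s * theta t' ord0 i0| by apply: (le_trans F); exact: ler_norm.
move/(ler_wpM2l (normr_ge0 (t' ord0 j - t ord0 j))) => h.
have := le_trans h H.
by rewrite ler_pdivrMr// mulrAC.
Qed.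

Hypothesis kap0 : forall b, Phi b -> 0 < kap b /\ dot b b = 1.
Hypothesis disj : forall b b', Phi b -> Phi b' -> forall z, dot z z < 1 ->
  horo b (kap b) z -> horo b' (kap b') z -> b = b'.

Ltac clear_lra := clear -s1 convK K1 Kz0 kap0 disj; lra.

Lemma pot_le_bound b (k Y0 : R) Q : 0 < Q.2 -> 0 < k -> 0 <= Y0 ->
  pot b k Q <= Y0 -> k * Q.2 <= Y0 ^+ 4 * (Q.2 + enorm (apex Q - b)) ^+ 2.
Proof.
move=> Q0 k0 Y00; rewrite /pot; set u := Q.2 + _.
have u0 : 0 < u by rewrite ltr_wpDr ?enorm_ge0.
have kq0 : 0 <= k * Q.2 by rewrite mulr_ge0 ?ltW.
rewrite -ler_sqr ?nnegrE ?sqrtr_ge0// sqr_sqrtr ?divr_ge0 ?sqrtr_ge0 ?(ltW u0)//.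
rewrite ler_pdivrMr// -ler_sqr ?nnegrE ?sqrtr_ge0 ?mulr_ge0 ?sqr_ge0 ?(ltW u0)//.
by rewrite sqr_sqrtr// exprMn -exprM.
Qed.

(** Two scales are in play: points of [K] are available at the fine scale [Q.2 / 2 ^+ j1], while the
    segment used to leave a horoball has its ends near directions about [Q.2 / A] apart. The bound
    on the potential of [Q] ensures that a fine point that far from [b] is outside the horoball of
    [b]. *)
Lemma exists_outside (Y0 A : R) (j1 : nat) Q (h0 : R) : (0 < n)%N ->
  (forall P t, 0 < P.2 <= 1 -> P.2 <= h0 -> node P -> in_cell P t ->
    exists q, [/\ K q, P.2 ^+ 2 / 2 <= 1 - dot q q <= 2 * P.2 ^+ 2 &
    enorm (q - theta t) <= 4 * N * P.2]) ->
  1 <= Y0 -> 0 < Q.2 <= 1 -> Q.2 <= h0 ->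
  (forall t, in_cell Q t -> forall j, `|t ord0 j| <= 1) ->
  (forall P, P \in leaves j1 Q -> node P) ->
  (forall b, Phi b -> pot b (kap b) Q <= Y0) ->
  N <= A -> 16 * N ^+ 2 * A <= 2 ^+ j1 ->
  4 * (Y0 ^+ 4 * (17 * N * A) ^+ 2) <= 2 ^+ j1 ->
  exists q, [/\ K q, outside q,
    (Q.2 / 2 ^+ j1) ^+ 2 / 2 <= 1 - dot q q,
    hgt q <= 5 * (N * (Q.2 / A)) &
    enorm (q - theta Q.1) <= 2 * (N * (Q.2 / A))].
Proof.
move=> n0 Hq Y1 Q01 Qh Qt lnode potQ NA J1 J2.
have /andP[Q0 Q1] := Q01; have N1 : 1 <= N by rewrite ler1n.
have N0 : 0 < N by apply: lt_le_trans N1.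
pose j : 'I_n := Ordinal n0.
have W0 : 0 < 2 ^+ j1 :> R by rewrite exprn_gt0.
have A1 : 1 <= A by apply: le_trans NA.
have A0 : 0 < A by apply: lt_le_trans A1.
have [h hE] : exists h, h = Q.2 / 2 ^+ j1 by exists (Q.2 / 2 ^+ j1).
have [rh rhE] : exists rh, rh = Q.2 / A by exists (Q.2 / A).
rewrite -hE -rhE.
have rh0 : 0 < rh by rewrite rhE divr_gt0.
have h0' : 0 < h by rewrite hE divr_gt0.
have Nrh1 : rh <= N * rh by rewrite ler_peMl// ltW.
have hrh : 16 * (N * (N * h)) <= rh.
  rewrite hE rhE ler_pdivlMr//.
  have -> : 16 * (N * (N * (Q.2 / 2 ^+ j1))) * A = 16 * N ^+ 2 * A * Q.2 / 2 ^+ j1.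
    by field; rewrite gt_eqF.
  by rewrite ler_pdivrMr// mulrC ler_pM2l.
have Nh0 : 0 < N * h by rewrite mulr_gt0.
have Nh : h <= N * h by rewrite ler_peMl// ltW.
have Nhrh : 16 * (N * h) <= rh.
  by apply: le_trans hrh; rewrite ler_pM2l// ler_peMl// ltW.
have rhA : rh * A = Q.2 by rewrite rhE divfK// gt_eqF.
have NrhQ : N * rh <= Q.2 by rewrite -rhA mulrC ler_pM2l.
have hQ : h * 2 ^+ j1 = Q.2 by rewrite hE divfK// gt_eqF.
have cQ : in_cell Q Q.1 by move=> k; rewrite subrr normr0 ltW.
have pt t : in_cell Q t -> exists q, [/\ K q,
    h ^+ 2 / 2 <= 1 - dot q q <= 2 * h ^+ 2 & enorm (q - theta t) <= 4 * (N * h)].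
  move=> tQ; have [P PQ Pt] := leaves_cover j1 tQ.
  have [P0 P1 PQ2] := leaves_size01 Q01 PQ.
  have [||q [Kq]] := Hq P t _ _ (lnode _ PQ) Pt; rewrite ?P0//.
    exact: le_trans Qh.
  by rewrite (leaves_size PQ) -hE -mulrA => ? ?; exists q.
pose shift (e : R) : T := Q.1 + \row_k (if k == j then e else 0).
have shiftE e k : shift e ord0 k - Q.1 ord0 k = if k == j then e else 0.
  by rewrite !mxE addrAC subrr add0r.
have sh e : `|e| = rh -> forall k, `|shift e ord0 k - Q.1 ord0 k| <= rh.
  move=> er k; rewrite shiftE; case: ifP => _; first by rewrite er.
  by rewrite normr0 ltW.
have shQ e : `|e| = rh -> in_cell Q (shift e).
  by move=> /sh er k; rewrite (le_trans (er k))// (le_trans Nrh1).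
have sth e : `|e| = rh -> enorm (theta (shift e) - theta Q.1) <= N * rh.
  by move=> /sh er; apply: thetaB_le => //; exact: ltW.
have er1 : `|rh| = rh by rewrite gtr0_norm.
have er2 : `|- rh| = rh by rewrite normrN gtr0_norm.
have [q1 [Kq1 q1l q1t]] := pt _ cQ.
have hw : 0 < h <= N * rh.
  by rewrite h0'/=; move: Nh Nhrh Nrh1 Nh0; clear_lra.
have q1c : enorm (q1 - theta Q.1) <= N * rh.
  by move: q1t Nhrh Nrh1 Nh0; clear_lra.
have q2c e q2 : `|e| = rh -> enorm (q2 - theta (shift e)) <= 4 * (N * h) ->
    enorm (q2 - theta Q.1) <= 2 * (N * rh).
  move=> /sth er; have := enorm_triangle (theta (shift e)) q2 (theta Q.1).
  by move: er Nhrh Nrh1 Nh0; clear_lra.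
have [out1|] := pselect (outside q1).
  exists q1; have := K1 Kq1 => q11.
  (* The degenerate segment from [q1] to itself already carries the estimates. *)
  have [] := segment_near q11 q11 (a := 0) _ hw q1l q1l q1c.
  - by rewrite lexx ler01.
  - by move: q1c (enorm_ge0 (q1 - theta Q.1)); clear_lra.
  by rewrite subr0 scale1r scale0r addr0 => *; split.
move=> /existsNP[b /not_implyP[Pb /contrapT q1b]].
have [kb bb] := kap0 Pb.
(* Of two opposite shifts of the centre, at least one gives a point far from [b], wherever [b]
   is. *)
have [e [q2 [er Kq2 q2l q2t q2b]]] : exists e q2, [/\ `|e| = rh, K q2,
    h ^+ 2 / 2 <= 1 - dot q2 q2 <= 2 * h ^+ 2,
    enorm (q2 - theta (shift e)) <= 4 * (N * h) & rh <= 4 * N * enorm (q2 - b)].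
  have [p [Kp pl ppt]] := pt _ (shQ _ er1).
  have [m [Km ml mpt]] := pt _ (shQ _ er2).
  have gap : rh <= N * enorm (theta (shift rh) - theta (shift (- rh))).
    have := theta_gap j (Qt _ (shQ _ er1)) (Qt _ (shQ _ er2)).
    have -> : shift (- rh) ord0 j - shift rh ord0 j = - (2 * rh).
      by rewrite !mxE eqxx; ring.
    by rewrite normrN gtr0_norm ?mulr_gt0// -mulrA ler_pM2l.
  have kr : 4 * (N * (4 * (N * h))) <= rh by move: hrh; clear_lra.
  have [pb|mb] := far_side b N0 ppt mpt gap kr.
    by exists rh, p; split.
  by exists (- rh), m; split.
have D0 := enorm_ge0 (q2 - b).
have u0 : 0 <= Q.2 + enorm (apex Q - b) by rewrite addr_ge0 ?enorm_ge0// ltW.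
have uD : Q.2 + enorm (apex Q - b) <= 17 * N * A * enorm (q2 - b).
  have aQ : enorm (apex Q - theta Q.1) <= Q.2 ^+ 2.
    by apply: apex_theta => //; rewrite (ltW Q0).
  have t1 := enorm_triangle (theta Q.1) (apex Q) b.
  have t2 := enorm_triangle q2 (theta Q.1) b.
  have t3 := q2c _ _ er q2t.
  rewrite (enormB _ q2) in t2.
  have QQ : Q.2 ^+ 2 <= Q.2 by rewrite expr2 ler_piMr// ltW.
  have AD : enorm (q2 - b) <= N * A * enorm (q2 - b).
    by rewrite ler_peMl// mulr_ege1.
  have : rh * A <= 4 * N * enorm (q2 - b) * A by rewrite ler_pM2r.
  by rewrite rhA; move: aQ t1 t2 t3 QQ AD NrhQ; clear_lra.
have Y00 : 0 <= Y0 by apply: le_trans Y1.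
have nq2 : ~ horo b (kap b) q2.
  have /andP[_ q2u] := q2l.
  apply: (not_horo_far (K1 Kq2) h0' q2u kb bb W0 u0 _ _ uD J2).
    by rewrite exprn_ge0.
  by rewrite hQ; apply: pot_le_bound => //; exact: potQ.
have [a a01 out] := horo_exit disj (K1 Kq1) (K1 Kq2) kb Pb q1b nq2.
have [? ? ?] := segment_near (K1 Kq1) (K1 Kq2) a01 hw q1l q2l q1c (q2c _ _ er q2t).
by exists ((1 - a) *: q1 + a *: q2); split => //; exact: convK.
Qed.

End nodes.

(** * A missing descendant at bounded depth *)

Section missing_estimates.
Variables (R : realType) (n : nat).
Local Notation V := 'rV[R]_n.+1.
Implicit Types (v c q g e : V).

(** The heights of [q] and [v] agree up to 2 E. So [v] is not too close to the sphere, which makes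
    the hole it causes visible a bounded number of levels further down, and its direction stays near
    that of the cell. *)
Lemma near_complement q v c (E d h : R) : dot q q < 1 -> dot v v < 1 ->
  1 <= E -> 0 < d -> 10 * (E * d) <= 2^-1 -> 0 < h ->
  1 - dot q v <= E * hgt q * hgt v -> hgt q <= 5 * d -> enorm (q - c) <= 2 * d ->
  h ^+ 2 / 2 <= 1 - dot q q ->
  [/\ 0 < enorm v, 1 - dot v v <= (10 * (E * d)) ^+ 2,
      (h / E) ^+ 2 / 8 <= 1 - dot v v &
      enorm ((enorm v)^-1 *: v - c) <= 22 * (E * d)].
Proof.
move=> q1 v1 E1 d0 Ed h0 qv hq qc qh.
have E0 : 0 < E by apply: lt_le_trans E1.
have [vq qv2 qvd] := kclose_bounds q1 v1 qv.
have hv0 := hgt_gt0 v1; have hv2 := sqr_hgt (ltW v1); have hq2 := sqr_hgt (ltW q1).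
have hv : hgt v <= 10 * (E * d).
  apply: (le_trans vq); have : E * hgt q <= E * (5 * d) by rewrite ler_pM2l.
  by clear; lra.
have hqv : enorm (q - v) <= 10 * (E * d).
  apply: (le_trans qvd); have : E * hgt q <= E * (5 * d) by rewrite ler_pM2l.
  by clear; lra.
have ev2 := sqr_enorm v; have ev0 := enorm_ge0 v.
have hv1 : hgt v <= 2^-1 by apply: le_trans Ed.
have evp : 0 < enorm v.
  rewrite lt_def ev0 andbT; apply/eqP => /enorm0_eq0 v0.
  have vv0 : dot v v = 0 by rewrite v0 dot0l.
  by move: hv2 hv1 hv0; rewrite vv0; clear; nra.
have ev1 : enorm v < 1 by rewrite enorm_lt1.
split => //.
- by rewrite -hv2 ler_sqr ?nnegrE ?hgt_ge0// (le_trans _ hv)// hgt_ge0.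
- have : (h / E) ^+ 2 <= 8 * (1 - dot v v).
    have -> : (h / E) ^+ 2 = h ^+ 2 / E ^+ 2 by rewrite exprMn exprVn.
    rewrite ler_pdivrMr ?exprn_gt0// -hv2.
    have : hgt q ^+ 2 <= (2 * E * hgt v) ^+ 2.
      by rewrite ler_sqr ?nnegrE ?hgt_ge0// (le_trans (hgt_ge0 q)).
    move: qh; rewrite -hq2; clear; rewrite !exprMn. lra.
  by clear; lra.
- have vv : enorm ((enorm v)^-1 *: v - v) <= hgt v.
    have -> : (enorm v)^-1 *: v - v = ((enorm v)^-1 - 1) *: v.
      by rewrite scalerBl scale1r.
    rewrite enormZ ger0_norm; last by rewrite subr_ge0 invf_ge1// ltW.
    rewrite mulrBl mul1r mulVf ?gt_eqF//.
    have : hgt v ^+ 2 <= hgt v by rewrite expr2 ler_piMr ?hgt_le1 ?hgt_ge0.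
    rewrite hv2 -ev2; have : enorm v ^+ 2 <= enorm v.
      by rewrite expr2 ler_piMr// ltW.
    by clear; lra.
  have dE : d <= E * d by rewrite ler_peMl// ltW.
  have := enorm_triangle v ((enorm v)^-1 *: v) c.
  have := enorm_triangle q v c; rewrite (enormB v q).
  by move: vv hv hqv dE qc; clear; lra.
Qed.

(** Here [a] is the norm of the base point: a cell small against [1 - a] makes the lever arm |v| - a
    long enough for [missed_direction]. *)
Lemma hole_size v (a E Q h W : R) : 1 <= E -> 0 < Q <= 1 -> 1 <= W -> h = Q / W ->
  1 - dot v v <= Q ^+ 2 / 64 -> a <= 1 -> Q * (2 * E * W) <= 1 - a -> dot v v < 1 ->
  2 * (1 - dot v v) <= (enorm v - a) * (h / (9 * E)).
Proof.
move=> E1 /andP[Q0 Q1] W1 hE vQ a1 Qa v1.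
have E0 : 0 < E by apply: lt_le_trans E1.
have W0 : 0 < W by apply: lt_le_trans W1.
have ev : 1 - Q ^+ 2 / 64 <= enorm v.
  have : enorm v ^+ 2 <= enorm v.
    by rewrite expr2 ler_piMr ?enorm_ge0// ltW// enorm_lt1.
  by rewrite sqr_enorm; move: vQ; clear; lra.
have QEW : Q * 2 <= Q * (2 * E * W).
  rewrite ler_pM2l// -mulrA ler_peMr// mulr_ege1//.
have QQ : Q ^+ 2 <= Q by rewrite expr2 ler_piMr// ltW.
have va : Q * E * W <= enorm v - a.
  by move: ev Qa QQ QEW Q0; clear; lra.
have h0 : 0 <= h / (9 * E) by rewrite hE !divr_ge0 ?mulr_ge0 ?ltW.
apply: le_trans (ler_wpM2r h0 va).
have -> : Q * E * W * (h / (9 * E)) = Q ^+ 2 / 9.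
  by rewrite hE; field; rewrite !gt_eqF.
by move: vQ (sqr_ge0 Q); clear; lra.
Qed.

End missing_estimates.

Section missing.
Variables (R : realType) (n : nat) (i0 : 'I_n.+1) (s : R).
Hypothesis s1 : s * s = 1.
Local Notation V := 'rV[R]_n.+1.
Local Notation T := 'rV[R]_n.
Local Notation cell := (T * R)%type.
Local Notation N := (n.+1%:R : R).
Local Notation theta := (theta i0 s).
Local Notation pot := (pot i0 s).
Variables (K Phi : set V) (kap : V -> R) (z0 : V).
Local Notation node := (node i0 s K).
Hypothesis convK : aff_convex K.
Hypothesis K1 : forall x, K x -> dot x x < 1.
Hypothesis Kz0 : K z0.
Hypothesis kap0 : forall b, Phi b -> 0 < kap b /\ dot b b = 1.
Hypothesis disj : forall b b', Phi b -> Phi b' -> forall z, dot z z < 1 ->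
  horo b (kap b) z -> horo b' (kap b') z -> b = b'.
Variable E : R.
Hypothesis E1 : 1 <= E.
Hypothesis tight : forall x, K x -> outside Phi kap x ->
  exists v, [/\ dot v v < 1, ~ K v & 1 - dot x v <= E * hgt x * hgt v].
Implicit Types (Q P : cell).

Ltac clear_lra := clear -s1 K1 Kz0 convK kap0 disj E1 tight; lra.

(** The vector v/|v| - rho e has norm within rho^2 of 1, so a point of small height in the cone over
    the same small cell must be close to it. *)
Lemma node_near_direction (rho : R) P t t' e v z r r' :
  0 < P.2 <= 1 -> in_cell P t -> in_cell P t' -> 0 < r' ->
  z = r' *: tau i0 s t' -> K z -> 1 - dot z z <= P.2 ^+ 2 ->
  0 < r -> 0 < enorm v ->
  (enorm v)^-1 *: v - rho *: e = r *: tau i0 s t -> dot e v = 0 -> enorm e <= 1 ->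
  0 <= rho <= 4^-1 -> 12 * N * P.2 <= rho ->
  enorm (z - ((enorm v)^-1 *: v - rho *: e)) <= rho / 2.
Proof.
move=> P01 Pt Pt' r'0 zE Kz zP r0 v0 gE ev e1 /andP[rho0 rho1] NP.
have := node_theta s1 P01 Pt' Pt r'0 zE (K1 Kz) zP => zt.
set g := _ - rho *: e in gE *.
pose w := r * enorm (tau i0 s t).
have gw : g = w *: theta t by rewrite gE (tauE i0 s1) scalerA /w.
have w0 : 0 < w by rewrite mulr_gt0// tau_gt0.
have gg : dot g g = 1 + rho ^+ 2 * enorm e ^+ 2.
  rewrite /g dotBl !dotBr !dotZl !dotZr (dotC v e) ev -!sqr_enorm.
  by field; rewrite gt_eqF.
have ww : dot g g = w ^+ 2.
  by rewrite gw dotZl dotZr dot_theta// mulr1.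
have ee : enorm e ^+ 2 <= 1 by rewrite expr_le1// enorm_ge0.
have rr : rho ^+ 2 * enorm e ^+ 2 <= rho ^+ 2 by rewrite ler_piMr// sqr_ge0.
have rr0 : 0 <= rho ^+ 2 * enorm e ^+ 2 by rewrite mulr_ge0// sqr_ge0.
have r4 : rho ^+ 2 <= rho / 4 by rewrite expr2 ler_wpM2l.
have w1 : 1 <= w.
  rewrite -(@ler_pXn2r _ 2) ?nnegrE ?(ltW w0)// expr1n -ww gg.
  by move: rr0; clear_lra.
have wl : w <= w ^+ 2 by rewrite expr2 ler_peMl// ltW.
have tg : enorm (theta t - g) <= rho / 4.
  rewrite gw -[X in X - _]scale1r -scalerBl enormZ enorm_theta// mulr1.
  rewrite ler0_norm ?subr_le0// opprB.
  move: wl rr r4; rewrite -ww gg; clear_lra.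
have := enorm_triangle (theta t) z g.
by move: tg zt NP; clear_lra.
Qed.

(** If all leaves were nodes, one point of [K] could be chosen in the cone of each. For this finite
    list [missed_direction] gives a direction over [Q] that no chosen point approaches, yet some
    leaf covers that direction. *)
Lemma missing_leaf (Y0 A : R) (j1 j2 : nat) Q (h0 : R) : (0 < n)%N ->
  (forall P t, 0 < P.2 <= 1 -> P.2 <= h0 -> node P -> in_cell P t ->
    exists q, [/\ K q, P.2 ^+ 2 / 2 <= 1 - dot q q <= 2 * P.2 ^+ 2 &
    enorm (q - theta t) <= 4 * N * P.2]) ->
  1 <= Y0 -> 0 < Q.2 <= 1 -> Q.2 <= h0 ->
  (forall t, in_cell Q t -> forall j, `|t ord0 j| <= 1) ->
  (forall b, Phi b -> pot b (kap b) Q <= Y0) ->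
  92 * (E * N ^+ 2) <= A -> 16 * N ^+ 2 * A <= 2 ^+ j1 ->
  4 * (Y0 ^+ 4 * (17 * N * A) ^+ 2) <= 2 ^+ j1 ->
  108 * (E * N) <= 2 ^+ j2 ->
  Q.2 * (2 * E * 2 ^+ j1) <= 1 - enorm z0 ->
  exists2 P, P \in leaves (j1 + j2) Q & ~ node P.
Proof.
move=> n0 Hq Y1 Q01 Qh Qt potQ EA J1 J2 J3 Qz0.
apply: contrapT => none.
have allnode P : P \in leaves (j1 + j2) Q -> node P.
  by move=> PQ; apply: contrapT => nP; apply: none; exists P.
have /andP[Q0 Q1] := Q01; have N1 : 1 <= N by rewrite ler1n.
have N0 : 0 < N by apply: lt_le_trans N1.
have E0 : 0 < E by apply: lt_le_trans E1.
have W0 : 0 < 2 ^+ j1 :> R by rewrite exprn_gt0.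
have W1 : 1 <= 2 ^+ j1 :> R by rewrite exprn_ege1// ler1n.
have U0 : 0 < 2 ^+ j2 :> R by rewrite exprn_gt0.
have EN1 : 1 <= E * N by rewrite mulr_ege1.
have EN0 : 0 < E * N by apply: lt_le_trans EN1.
have ENN : E * N ^+ 2 = N * (E * N) by ring.
have NENN : N <= E * N ^+ 2 by rewrite ENN ler_peMr// ltW.
have ENNN : E * N <= E * N ^+ 2 by rewrite ENN ler_peMl// ltW.
have NA : N <= A.
  by move: NENN EA N0; clear_lra.
have A0 : 0 < A by apply: lt_le_trans NA.
have lnode P : P \in leaves j1 Q -> node P.
  move=> PQ; have P01 : 0 < P.2 <= 1 by have [-> ->] := leaves_size01 Q01 PQ.
  have [P' P'P _] : exists2 P', P' \in leaves j2 P & in_cell P' P.1.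
    apply: leaves_cover => k; rewrite subrr normr0.
    by case/andP: P01 => /ltW.
  by apply: (node_leaf P01 P'P); apply: allnode; exact: mem_leavesD PQ P'P.
have [q [Kq qout ql qu qc]] := exists_outside s1 convK K1 kap0 disj n0 Hq Y1
  Q01 Qh Qt lnode potQ NA J1 J2.
have [v [v1 nKv qv]] := tight Kq qout.
have [h hE] : exists h, h = Q.2 / 2 ^+ j1 by exists (Q.2 / 2 ^+ j1).
have [d dE] : exists d, d = N * (Q.2 / A) by exists (N * (Q.2 / A)).
rewrite -hE in ql; rewrite -dE in qu qc.
have h0' : 0 < h by rewrite hE divr_gt0.
have d0 : 0 < d by rewrite dE mulr_gt0// divr_gt0.
have hd : h <= d.
  rewrite hE dE ler_pdivrMr//.
  have -> : N * (Q.2 / A) * 2 ^+ j1 = Q.2 * (N * 2 ^+ j1) / A.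
    by field; rewrite gt_eqF.
  rewrite ler_pdivlMr// ler_pM2l//.
  have : A <= N * (16 * N ^+ 2 * A).
    rewrite mulrA ler_peMl ?(ltW A0)// mulr_ege1// mulr_ege1 ?exprn_ege1//.
    by rewrite ler1n.
  have : N * (16 * N ^+ 2 * A) <= N * 2 ^+ j1 by rewrite ler_pM2l.
  exact: (fun a b => le_trans b a).
(* 92 = 4 * (22 + 1): 22 for the direction of [v], 1 for the displacement by [rho], 4 from the
   radius asked by [cone_of_near]. *)
have Ed : 92 * (E * d) <= Q.2 / N.
  rewrite dE ler_pdivlMr//.
  have -> : 92 * (E * (N * (Q.2 / A))) * N = Q.2 * (92 * (E * N ^+ 2)) / A.
    by field; rewrite gt_eqF.
  by rewrite ler_pdivrMr// ler_pM2l.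
have QN : Q.2 / N <= Q.2 by rewrite ler_pdivrMr// ler_peMr// ltW.
have Ed' := le_trans Ed QN.
have Ed0 : 0 < E * d by rewrite mulr_gt0.
have dEd : d <= E * d by rewrite ler_peMl// ltW.
have Ed1 : 10 * (E * d) <= 2^-1.
  by move: Ed' Q1 Ed0; clear_lra.
have [ev0 vu vl vc] := near_complement (K1 Kq) v1 E1 d0 Ed1 h0' qv qu qc ql.
(* The size of the hole; then 9 rho^2 = (h / E)^2 / 9, below the lower bound (h / E)^2 / 8 of 1 -
   |v|^2. *)
pose rho := h / (9 * E).
have rho0 : 0 < rho by rewrite divr_gt0// mulr_gt0.
have rhoh : rho <= h / 9.
  by rewrite /rho ler_pM2l// lef_pV2 ?posrE ?mulr_gt0// ler_peMr.
have rho9 : 9 * rho ^+ 2 <= 1 - dot v v.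
  apply: le_trans vl; rewrite /rho invfM [h * _]mulrCA.
  have -> : 9 * (9^-1 * (h / E)) ^+ 2 = (h / E) ^+ 2 / 9 by field; rewrite gt_eqF.
  have := sqr_ge0 (h / E).
  by clear_lra.
have vQ : 1 - dot v v <= Q.2 ^+ 2 / 64.
  apply: (le_trans vu); have -> : Q.2 ^+ 2 / 64 = (Q.2 / 8) ^+ 2 by field.
  have Ed8 : 10 * (E * d) <= Q.2 / 8.
    by move: Ed' Ed0; clear_lra.
  have Ed10 : 0 <= 10 * (E * d) by rewrite mulr_ge0// ltW.
  by rewrite ler_sqr ?nnegrE// (le_trans Ed10).
have z01 : enorm z0 < 1 by rewrite enorm_lt1; exact: K1.
have hs := hole_size E1 Q01 W1 hE vQ (ltW z01) Qz0 v1; rewrite -/rho in hs.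
have [F HF] : exists F : cell -> V, forall P, P \in leaves (j1 + j2) Q ->
    exists t r, [/\ in_cell P t, 0 < r, F P = r *: tau i0 s t, K (F P) &
      1 - dot (F P) (F P) <= P.2 ^+ 2].
  have /choice[F HF] : forall P, exists z, P \in leaves (j1 + j2) Q ->
      exists t r, [/\ in_cell P t, 0 < r, z = r *: tau i0 s t, K z &
      1 - dot z z <= P.2 ^+ 2].
    move=> P; have [PQ|PQ] := boolP (P \in leaves (j1 + j2) Q); last by exists 0.
    by have [t [r [z H]]] := allnode _ PQ; exists z => _; exists t, r.
  by exists F.
have [e [e1 ev far]] := @missed_direction _ _ K z0 v [seq F P | P <- leaves (j1 + j2) Q] rho
  convK Kz0 ltac:(by move=> z /mapP[P PQ ->]; have [t [r []]] := HF _ PQ) nKv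
  ltac:(by rewrite ev0 enorm_lt1) rho0 rho9 hs (ltW z01).
set g := (enorm v)^-1 *: v - rho *: e in far.
have gc : enorm (g - theta Q.1) <= Q.2 / (4 * N).
  have -> : g - theta Q.1 = ((enorm v)^-1 *: v - theta Q.1) - rho *: e.
    by rewrite /g addrAC.
  apply: (le_trans (enormD _ _)); rewrite enormN enormZ gtr0_norm//.
  have : rho * enorm e <= rho by rewrite ler_piMr// ltW.
  rewrite invfM mulrCA.
  move: vc rhoh hd dEd Ed h0'; move: (Q.2 / N) => w.
  by clear_lra.
have cQ : in_cell Q Q.1 by move=> k; rewrite subrr normr0 ltW.
have [t [r [r0 gE tQ]]] := cone_of_near s1 (Qt _ cQ) Q01 gc.
have [P PQ Pt] := leaves_cover (j1 + j2) tQ.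
have [t' [r' [Pt' r'0 zE Kz zP]]] := HF _ PQ.
have P01 : 0 < P.2 <= 1 by have [-> ->] := leaves_size01 Q01 PQ.
have P2 : P.2 = h / 2 ^+ j2.
  by rewrite (leaves_size PQ) hE exprD invfM mulrA.
(* 108 = 12 * 9, so this is the requirement 12 N P.2 <= rho of [node_near_direction]. *)
have P2h : 108 * (E * N) * P.2 <= h.
  by rewrite P2 mulrA ler_pdivrMr// mulrC ler_pM2l.
have h1 : h <= 1.
  by rewrite hE ler_pdivrMr// mul1r (le_trans Q1).
have /andP[P0 _] := P01.
have near : enorm (F P - g) <= rho / 2.
  apply: (node_near_direction P01 Pt Pt' r'0 zE Kz zP r0 ev0 gE ev e1).
    by rewrite (ltW rho0)/=; move: rhoh h1; clear_lra.
  rewrite /rho ler_pdivlMr ?mulr_gt0//.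
  by move: P2h; clear_lra.
have FPl : F P \in [seq F P | P <- leaves (j1 + j2) Q] by apply: map_f.
have PE : P.2 <= (h / E) / 8.
  rewrite -mulrA -invfM ler_pdivlMr ?mulr_gt0//.
  apply: le_trans P2h; rewrite mulrC ler_wpM2r ?(ltW P0)//.
  have : E <= E * N by rewrite ler_peMr// ltW.
  by move: EN0; clear_lra.
have := far _ FPl; rewrite ltNge near => /(_ _ _)/negP; apply => //.
  by rewrite ltW// enorm_lt1; exact: K1.
apply: (le_trans zP).
have : P.2 ^+ 2 <= ((h / E) / 8) ^+ 2.
  by rewrite ler_sqr ?nnegrE ?(ltW P0)// (le_trans (ltW P0)).
rewrite [((h / E) / 8) ^+ 2]exprMn exprVn; move: vl (sqr_ge0 (h / E)).
by clear_lra.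
Qed.

End missing.

(** * Counting nodes *)

Section auxiliary.
Variable R : realType.

Lemma pow2_ge (x : R) : exists a : nat, x <= 2 ^+ a.
Proof.
exists (Num.bound `|x|); rewrite (le_trans (ler_norm x))//.
apply: ltW; apply: (lt_trans (archi_boundP (normr_ge0 x))).
by rewrite -natrX ltr_nat ltn_expl.
Qed.

Lemma bernoulli_le (t : R) m : 0 <= t <= 1 -> 1 - m%:R * t <= (1 - t) ^+ m.
Proof.
move=> /andP[t0 t1]; elim: m => [|m IH]; first by rewrite mul0r subr0 expr0.
have b0 : 0 <= 1 - t by rewrite subr_ge0.
rewrite exprS; apply: le_trans (ler_wpM2l b0 IH).
have : 0 <= m%:R * t * t by rewrite !mulr_ge0.
by rewrite -[m.+1%:R]natr1; lra.
Qed.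

Lemma sum_missing (T : eqType) (l : seq T) (f : T -> R) (c : R) P :
  0 <= c -> P \in l -> f P <= 0 -> {in l, forall Q, f Q <= c} ->
  \sum_(Q <- l) f Q <= ((size l)%:R - 1) * c.
Proof.
move=> c0 Pl fP fc; rewrite (big_rem P Pl)/= -[leRHS]add0r lerD//.
rewrite big_seq (@le_trans _ _ (\sum_(Q <- rem P l | Q \in rem P l) c))//.
  by apply: ler_sum => Q /mem_rem; exact: fc.
rewrite -big_seq big_const_seq count_predT iter_addr_0 -(mulr_natl c) size_rem//.
by rewrite -subn1 natrB// lt0n size_eq0; apply: contraTneq Pl => ->.
Qed.

(** One rate must serve jumps of two different lengths: [B * (1 - t)] with [t] small enough for the
    Bernoulli inequality at both; [t <= 1/4] keeps the rate above 1. *)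
Lemma exists_rate (B r1 r2 : R) (m1 m2 : nat) : 2 <= B -> r1 < 1 -> r2 < 1 ->
  exists2 lam, 1 < lam < B & B ^+ m1 * r1 <= lam ^+ m1 /\ B ^+ m2 * r2 <= lam ^+ m2.
Proof.
move=> B2 r11 r21; have B0 : 0 < B by lra.
pose g (m : nat) r : R := (1 - r) / m.+1%:R.
have g0 m r : r < 1 -> 0 < g m r by move=> r1'; rewrite divr_gt0// subr_gt0.
have gE m r t : 0 <= t <= 1 -> t <= g m r -> r <= (1 - t) ^+ m.
  move=> t01 tg; apply: le_trans (bernoulli_le m t01).
  have : m.+1%:R * t <= 1 - r by rewrite mulrC -ler_pdivlMr.
  by have /andP[t0 _] := t01; rewrite -natr1 mulrDl mul1r; lra.
pose t := Num.min (4^-1) (Num.min (g m1 r1) (g m2 r2)).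
have t0 : 0 < t by rewrite !lt_min !g0// invr_gt0 ltr0n.
have t4 : t <= 4^-1 by rewrite ge_min lexx.
have t01 : 0 <= t <= 1 by apply/andP; split; lra.
exists (B * (1 - t)).
  by apply/andP; split; nra.
by rewrite !exprMn !ler_pM2l ?exprn_gt0// !gE// !ge_min lexx ?orbT.
Qed.

End auxiliary.

(** * The weighted induction *)

Section core.
Variables (R : realType) (n : nat) (i0 : 'I_n.+1) (s : R).
Hypothesis s1 : s * s = 1.
Local Notation V := 'rV[R]_n.+1.
Local Notation T := 'rV[R]_n.
Local Notation cell := (T * R)%type.
Local Notation N := (n.+1%:R : R).
Local Notation apex := (apex i0 s).
Local Notation pot := (pot i0 s).
Variables (K Phi : set V) (kap : V -> R).
Local Notation node := (node i0 s K).
Hypothesis kap0 : forall b, Phi b -> 0 < kap b /\ dot b b = 1.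
Hypothesis disj : forall b b', Phi b -> Phi b' -> forall z, dot z z < 1 ->
  horo b (kap b) z -> horo b' (kap b') z -> b = b'.
Implicit Types (Q P : cell).

Definition ncount m Q : R := \sum_(P <- leaves m Q) (`[< node P >])%:R.

Lemma ncountD m1 m2 Q :
  ncount (m1 + m2) Q = \sum_(P <- leaves m1 Q) ncount m2 P.
Proof. exact: sum_leavesD. Qed.

Lemma ncount_le m Q : ncount m Q <= (2 ^+ n) ^+ m.
Proof.
rewrite -[leRHS]mulr1 -(sumr_leaves_const _ Q); apply: ler_sum => P _.
by case: asboolP => _; rewrite ?ler01.
Qed.

Lemma ncount_eq0 m Q : 0 < Q.2 <= 1 -> ~ node Q -> ncount m Q = 0.
Proof.
move=> Q01 nQ; rewrite /ncount big_seq big1// => P PQ.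
by case: asboolP => // /(node_leaf Q01 PQ).
Qed.

Definition admissible (h : R) Q := [/\ 0 < Q.2 <= 1, Q.2 <= h &
  forall t, in_cell Q t -> forall j, `|t ord0 j| <= 1].

Lemma admissible_leaf h m Q P : admissible h Q -> P \in leaves m Q -> admissible h P.
Proof.
move=> [Q01 Qh Qt] PQ; have [P0 P1 PQ2] := leaves_size01 Q01 PQ; split.
- by rewrite P0.
- exact: le_trans Qh.
- by move=> t /(leaves_sub PQ); exact: Qt.
Qed.

Variables (mu1 mu2 : nat) (eps lam h Y0 : R).
Local Notation B := (2 ^+ n : R).
Local Notation A := (B ^+ (4 * mu1 + 4 * mu2)).
Local Notation C2 := (2 * N * 2 ^+ mu2 * Y0).
Hypotheses (n0 : (0 < n)%N) (mu10 : (0 < mu1)%N) (mu20 : (0 < mu2)%N).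
Hypothesis muN : 132 * N ^+ 2 <= 2 ^+ mu1.
Hypothesis Y0E : Y0 = 2 * N * 2 ^+ mu1.
Hypotheses (eps0 : 0 < eps) (lam1 : 1 <= lam).
Hypothesis lam_deep : B ^+ (4 * mu1) * ((1 + eps * Y0 / 2) / (1 + eps * Y0)) <=
  lam ^+ (4 * mu1).
Hypothesis lam_shallow : (B ^+ (4 * mu2) - 1) * (1 + eps * C2) <= lam ^+ (4 * mu2).
Hypothesis missing : forall Q, admissible h Q ->
  (forall b, Phi b -> pot b (kap b) Q <= Y0) ->
  exists2 P, P \in leaves (4 * mu2) Q & ~ node P.

Ltac clear_lra :=
  clear -s1 kap0 disj n0 mu10 mu20 muN Y0E eps0 lam1 lam_deep lam_shallow missing; lra.

(** [W] plays the weight 1 + eps * potential without naming a horoball: disjointness leaves at most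
    one that contains the apex, and [W = 1] is allowed if there is none. Strong induction jumps
    [4 * mu1] levels in the deep case and [4 * mu2] in the shallow one; [A] pays for the case where
    too few levels remain to jump. *)
Lemma ncount_bound m Q W : admissible h Q -> 1 <= W ->
  (forall b, Phi b -> horo b (kap b) (apex Q) -> 1 + eps * pot b (kap b) Q <= W) ->
  ncount m Q <= A * lam ^+ m * W.
Proof.
have B1 : 1 <= B by rewrite exprn_ege1// ler1n.
have A0 : 0 <= A by rewrite !exprn_ge0.
have Y01 : 1 <= Y0.
  by rewrite Y0E !mulr_ege1// ?exprn_ege1// ler1n.
have lam0 : 0 < lam by apply: lt_le_trans lam1.
have [k] := ubnP m; elim: k m Q W => // k IH m Q W /ltnSE mk aQ W1 HW.
have [Q01 Qh Qt] := aQ.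
have lm0 j : 0 <= lam ^+ j by rewrite exprn_ge0// ltW.
have lm1 j : 1 <= lam ^+ j by rewrite exprn_ege1.
have [mm|mm] := leqP m (4 * mu1 + 4 * mu2).
  apply: (le_trans (ncount_le m Q)).
  apply: (@le_trans _ _ (A * 1)); first by rewrite mulr1 ler_weXn2l.
  by rewrite -mulrA ler_wpM2l// mulr_ege1.
have [[b [Pb deep]]|shallow] :=
    pselect (exists b, Phi b /\ Y0 <= pot b (kap b) Q).
  have [kb bb] := kap0 Pb.
  have Hb : horo b (kap b) (apex Q).
    by apply: (pot_ge1_horo s1) => //; exact: le_trans deep.
  have W_ge := HW b Pb Hb.
  have m1m : (4 * mu1 <= m)%N by apply: leq_trans (ltnW mm); rewrite leq_addr.
  rewrite -(subnKC m1m) ncountD; set m' := (m - _)%N.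
  have m'k : (m' < k)%N.
    by apply: leq_trans mk; rewrite ltn_subrL muln_gt0 mu10 (leq_trans _ m1m)// muln_gt0.
  have step P : P \in leaves (4 * mu1) Q ->
      ncount m' P <= A * lam ^+ m' * (1 + eps * pot b (kap b) P).
    move=> PQ; have aP := admissible_leaf aQ PQ; have [P01 _ _] := aP.
    apply: IH => //.
      by rewrite lerDl mulr_ge0 ?pot_ge0// ltW.
    move=> b' Pb' Hb'.
    (* [Y0] is exactly the loss allowed by [pot_leaf_ge]. The apex of [P] is thus still in the
       horoball of [b], and [b'] must be [b]. *)
    have potP : 1 <= pot b (kap b) P.
      have := le_trans deep (pot_leaf_ge i0 s1 b Q01 kb PQ); rewrite Y0E.
      rewrite -[X in X <= _]mulr1 ler_pM2l// !mulr_gt0// ?exprn_gt0//.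
    have PH : horo b (kap b) (apex P) by exact: (pot_ge1_horo s1).
    have /andP[P0 P1] := P01.
    have -> // := disj Pb' Pb _ Hb' PH.
    by rewrite dot_apex ?(ltW P0)// ltrBlDr ltrDl exprn_gt0.
  rewrite big_seq (le_trans (ler_sum _ (fun P PQ => step P PQ)))//.
  rewrite -big_seq -mulr_sumr big_split/= sumr_leaves_const mulr1 -mulr_sumr.
  have := pot_average i0 s1 b n0 mu10 Q01 kb Qt.
  set S := \sum_(P <- _) _; set M := B ^+ (4 * mu1) => HS.
  have M0 : 0 <= M by rewrite !exprn_ge0.
  have p0 := pot_ge0 i0 s b (kap b) Q.
  have HS' : S <= M * (pot b (kap b) Q / 2).
    apply: (le_trans HS); rewrite ler_wpM2l// -[leRHS]mulrC ler_wpM2r//.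
    rewrite ler_pdivrMr ?exprn_gt0//; move: muN.
    move: (2 ^+ mu1) (N ^+ 2) => w z; clear_lra.
  have -> : A * lam ^+ (4 * mu1 + m') * W = A * lam ^+ m' * (lam ^+ (4 * mu1) * W).
    by rewrite (exprD lam) -!mulrA; congr (_ * _); rewrite mulrCA.
  rewrite ler_wpM2l ?mulr_ge0//.
  set p := pot b (kap b) Q in deep W_ge p0 HS' *.
  have eY : 0 <= eps * Y0 by rewrite mulr_ge0 ?(ltW eps0)// (le_trans _ Y01).
  have d1 : 0 < 1 + eps * Y0 by lra.
  apply: (@le_trans _ _ (M * (1 + eps * p / 2))).
    have := ler_wpM2l (ltW eps0) HS'; clear_lra.
  apply: (@le_trans _ _ (lam ^+ (4 * mu1) * (1 + eps * p))); last by rewrite ler_wpM2l.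
  have e1p : 0 <= 1 + eps * p by rewrite addr_ge0// mulr_ge0// ltW.
  (* The ratio (1 + x / 2) / (1 + x) decreases in x, so its value at [eps * Y0] bounds the one at
     [eps * p]. *)
  apply: le_trans (ler_wpM2r e1p lam_deep); rewrite -[leRHS]mulrA ler_wpM2l//.
  rewrite [leRHS]mulrAC ler_pdivlMr//.
  have : eps * Y0 <= eps * p by rewrite ler_pM2l.
  clear_lra.
have {}shallow b : Phi b -> pot b (kap b) Q <= Y0.
  move=> Pb; rewrite leNgt; apply/negP => H; apply: shallow; exists b.
  by rewrite ltW.
have [P0 P0Q nP0] := missing aQ shallow.
have m2m : (4 * mu2 <= m)%N by apply: leq_trans (ltnW mm); rewrite leq_addl.
rewrite -(subnKC m2m) ncountD; set m' := (m - _)%N.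
have m'k : (m' < k)%N.
  by apply: leq_trans mk; rewrite ltn_subrL muln_gt0 mu20 (leq_trans _ m2m)// muln_gt0.
have C20 : 0 <= C2 by rewrite !mulr_ge0 ?exprn_ge0// (le_trans _ Y01).
have eC : 0 <= eps * C2 by rewrite mulr_ge0// ltW.
(* The surviving leaves may have larger potential than [Q], but at most [C2]; [eps] is so small that
   the missing leaf outweighs this. *)
pose c := A * lam ^+ m' * (1 + eps * C2).
have c0 : 0 <= c by rewrite !mulr_ge0// addr_ge0.
have step : {in leaves (4 * mu2) Q, forall P, ncount m' P <= c}.
  move=> P PQ; have aP := admissible_leaf aQ PQ.
  apply: IH => //; first by rewrite lerDl.
  move=> b Pb _; rewrite lerD2l ler_pM2l//.
  have [kb _] := kap0 Pb.
  apply: (le_trans (pot_leaf_le i0 s1 b Q01 kb PQ)).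
  by rewrite ler_wpM2l ?shallow// !mulr_ge0// exprn_ge0.
have nP00 : ncount m' P0 <= 0.
  by have [P001 _ _] := admissible_leaf aQ P0Q; rewrite ncount_eq0.
apply: (le_trans (sum_missing c0 P0Q nP00 step)).
rewrite size_leaves !natrX /c (exprD lam).
have -> : (B ^+ (4 * mu2) - 1) * (A * lam ^+ m' * (1 + eps * C2)) =
  A * lam ^+ m' * ((B ^+ (4 * mu2) - 1) * (1 + eps * C2)) by rewrite mulrCA mulrA.
have -> : A * (lam ^+ (4 * mu2) * lam ^+ m') * W =
  A * lam ^+ m' * (lam ^+ (4 * mu2) * W).
  by rewrite -!mulrA; congr (_ * _); rewrite mulrCA.
rewrite ler_wpM2l ?mulr_ge0//; apply: (le_trans lam_shallow).
by rewrite ler_peMr.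
Qed.

(** The induction applies from level [k0] on. The potentials there have no uniform bound, but the
    cells are finitely many and their weights are collected in [C]. *)
Lemma ncount_root : 0 < h -> exists C, forall k,
  ncount k (0, 1) <= C * lam ^+ k.
Proof.
move=> h0; have lam0 : 0 < lam by apply: lt_le_trans lam1.
have [k0 hk0] := pow2_ge h^-1.
have p0 : 0 < 2 ^+ k0 :> R by rewrite exprn_gt0.
pose Q0 : cell := (0, 1).
have Q01 : 0 < Q0.2 <= 1 by rewrite ltr01 lexx.
have aP P : P \in leaves k0 Q0 -> admissible h P.
  move=> PQ; have [P0 P1 _] := leaves_size01 Q01 PQ; split; first by rewrite P0.
    rewrite (leaves_size PQ) div1r -[leRHS]invrK lef_pV2 ?posrE ?invr_gt0//.
  by move=> t /(leaves_sub PQ) + j => /(_ j); rewrite mxE subr0.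
have /choice[W HW] : forall P, exists W, P \in leaves k0 Q0 -> 1 <= W /\
    forall b, Phi b -> horo b (kap b) (apex P) -> 1 + eps * pot b (kap b) P <= W.
  move=> P; have [[b [Pb Hb]]|nb] := pselect (exists b, Phi b /\ horo b (kap b) (apex P)).
    exists (1 + eps * pot b (kap b) P) => PQ; split.
      by rewrite lerDl mulr_ge0 ?pot_ge0// ltW.
    have [P0 P1 _] := leaves_size01 Q01 PQ.
    move=> b' Pb' Hb'; have -> // := disj Pb' Pb _ Hb' Hb.
    by rewrite dot_apex ?(ltW P0)// ltrBlDr ltrDl exprn_gt0.
  by exists 1 => _; split => // b Pb Hb; exfalso; apply: nb; exists b.
have lk1 j : 1 <= lam ^+ j by rewrite exprn_ege1.
have W0 : 0 <= \sum_(P <- leaves k0 Q0) A * W P.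
  rewrite big_seq sumr_ge0// => P /HW[W1 _].
  by rewrite mulr_ge0 ?exprn_ge0// (le_trans _ W1).
have B1 : 1 <= B by rewrite exprn_ege1// ler1n.
exists (B ^+ k0 + \sum_(P <- leaves k0 Q0) A * W P) => k.
have [kk|kk] := leqP k k0.
  apply: (le_trans (ncount_le _ _)).
  apply: (@le_trans _ _ (B ^+ k0 + \sum_(P <- leaves k0 Q0) A * W P)).
    by rewrite (@le_trans _ _ (B ^+ k0)) ?ler_weXn2l// lerDl.
  by rewrite ler_peMr// addr_ge0// !exprn_ge0.
rewrite -(subnKC (ltnW kk)) ncountD; set k' := (k - k0)%N.
apply: (@le_trans _ _ ((\sum_(P <- leaves k0 Q0) A * W P) * lam ^+ (k0 + k'))).
  rewrite mulr_suml big_seq [leRHS]big_seq; apply: ler_sum => P PQ.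
  have [W1 HWP] := HW _ PQ.
  apply: (le_trans (ncount_bound k' (aP _ PQ) W1 HWP)).
  rewrite [leRHS]mulrAC ler_wpM2r ?(le_trans _ W1)//.
  by rewrite ler_wpM2l ?exprn_ge0// ler_weXn2l// leq_addl.
by rewrite ler_wpM2r ?exprn_ge0 ?(ltW lam0)// lerDr !exprn_ge0.
Qed.

End core.

Theorem core_count (R : realType) (n : nat) (E : R) : (0 < n)%N -> 1 <= E ->
  exists2 lam : R, 1 < lam < 2 ^+ n &
  forall (i0 : 'I_n.+1) (s : R), s * s = 1 ->
  forall (K Phi : set 'rV[R]_n.+1) (kap : 'rV[R]_n.+1 -> R) z0,
  aff_convex K -> (forall x, K x -> dot x x < 1) -> K z0 ->
  (forall b, Phi b -> 0 < kap b /\ dot b b = 1) ->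
  (forall b b', Phi b -> Phi b' -> forall z, dot z z < 1 ->
     horo b (kap b) z -> horo b' (kap b') z -> b = b') ->
  (forall x, K x -> outside Phi kap x ->
    exists v, [/\ dot v v < 1, ~ K v & 1 - dot x v <= E * hgt x * hgt v]) ->
  exists C, forall k, ncount i0 s K k (0, 1) <= C * lam ^+ k.
Proof.
move=> n0 E1; pose N : R := n.+1%:R.
have N1 : 1 <= N by rewrite ler1n.
have [a0 Ha0] := pow2_ge (132 * N ^+ 2).
pose mu1 := a0.+1.
(* 132 = 2 * 66, so that [pot_average] halves the potential. *)
have muN : 132 * N ^+ 2 <= 2 ^+ mu1.
  by rewrite (le_trans Ha0)// ler_weXn2l// ler1n.
pose Y0 : R := 2 * N * 2 ^+ mu1.
have Y01 : 1 <= Y0 by rewrite !mulr_ege1// ?exprn_ege1// ler1n.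
pose A := 92 * (E * N ^+ 2).
have [a1 Ha1] := pow2_ge (16 * N ^+ 2 * A).
have [a2 Ha2] := pow2_ge (4 * (Y0 ^+ 4 * (17 * N * A) ^+ 2)).
have [a3 Ha3] := pow2_ge (108 * (E * N)).
(* Multiples of 4, since the potential is compared only across [4 * mu2] levels. *)
pose j1 := (4 * (a1 + a2))%N; pose j2 := (4 * a3.+1)%N.
pose mu2 := (a1 + a2 + a3.+1)%N.
have mu2E : (4 * mu2 = j1 + j2)%N by rewrite -mulnDr.
have p2 (x : R) a b : x <= 2 ^+ a -> (a <= b)%N -> x <= 2 ^+ b.
  by move=> /le_trans xa ab; apply: xa; rewrite ler_weXn2l// ler1n.
have J1 : 16 * N ^+ 2 * A <= 2 ^+ j1.
  by apply: (p2 _ _ _ Ha1); rewrite /j1 mulnDr (leq_trans _ (leq_addr _ _))// leq_pmull.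
have J2 : 4 * (Y0 ^+ 4 * (17 * N * A) ^+ 2) <= 2 ^+ j1.
  by apply: (p2 _ _ _ Ha2); rewrite /j1 mulnDr (leq_trans _ (leq_addl _ _))// leq_pmull.
have J3 : 108 * (E * N) <= 2 ^+ j2.
  by apply: (p2 _ _ _ Ha3); rewrite /j2 (leq_trans (leqnSn _))// leq_pmull.
pose B : R := 2 ^+ n.
have B2 : 2 <= B by rewrite -[leLHS]expr1 ler_weXn2l// ler1n.
pose M := B ^+ (4 * mu2); pose C2 := 2 * N * 2 ^+ mu2 * Y0.
have M1 : 1 <= M by rewrite exprn_ege1//; lra.
have C20 : 0 < C2 by rewrite !mulr_gt0 ?exprn_gt0//; lra.
(* With this choice the shallow factor is (M - 1) (1 + 1 / (2 M)) < M - 1/2, still a definite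
   proportion below [M]. *)
pose eps := (2 * M * C2)^-1.
have eps0 : 0 < eps by rewrite invr_gt0 !mulr_gt0//; lra.
have eC : eps * C2 = (2 * M)^-1.
  by rewrite /eps; field; rewrite !gt_eqF//; lra.
have eY : 0 < eps * Y0 by rewrite mulr_gt0//; lra.
have r1 : (1 + eps * Y0 / 2) / (1 + eps * Y0) < 1.
  by rewrite ltr_pdivrMr; lra.
have r2 : 1 - (2 * M)^-1 < 1 by rewrite ltrBlDr ltrDl invr_gt0; lra.
have [lam lamB [L1 L2]] := exists_rate (4 * mu1) (4 * mu2) B2 r1 r2.
exists lam => // i0 s s1 K Phi kap z0 cK K1 Kz0 kap0 disj tight.
have lam1 : 1 <= lam by case/andP: lamB => /ltW.
have L2' : (M - 1) * (1 + eps * C2) <= lam ^+ (4 * mu2).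
  apply: le_trans L2; rewrite eC -/M.
  have -> : M * (1 - (2 * M)^-1) = M - 2^-1 by field; lra.
  have i2 : (2 * M)^-1 * (2 * M) = 1 by rewrite mulVf// gt_eqF//; lra.
  have : 0 < (2 * M)^-1 by rewrite invr_gt0; lra.
  by move: i2; move: (_^-1) => w; clear; lra.
have [h0 h00 Hq] := node_point i0 s1 cK K1 Kz0.
have W0 : 0 < 2 * E * 2 ^+ j1 by rewrite !mulr_gt0 ?exprn_gt0//; lra.
have z01 : 0 < 1 - enorm z0 by rewrite subr_gt0 enorm_lt1; exact: K1.
(* The size of admissible cells depends on the hull; [lam] was chosen before it. *)
pose h := Num.min h0 ((1 - enorm z0) / (2 * E * 2 ^+ j1)).
apply: (@ncount_root _ _ i0 s s1 K Phi kap kap0 disj mu1 mu2 eps lam h Y0) => //.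
- by rewrite /mu2 addnS.
- move=> Q [Q01 Qh Qt] potQ; rewrite mu2E.
  move: Qh; rewrite le_min => /andP[Qh0 Qz].
  apply: (missing_leaf s1 cK K1 Kz0 kap0 disj E1 tight n0 Hq Y01 Q01 Qh0 Qt
    potQ _ J1 J2 J3) => //.
  by rewrite -ler_pdivlMr.
- by rewrite lt_min h00 divr_gt0.
Qed.

(** * From the ball to the Klein model *)

Section klein_model.
Variables (R : realType) (n : nat).
Local Notation V := 'rV[R]_n.+1.
Implicit Types (x y z v w p q : V) (H : set V).

Definition klein x : V := (2 / (1 + dot x x)) *: x.
Definition unklein x : V := (1 + hgt x)^-1 *: x.

(** The hyperbolic cosine of [hdist], in which the estimates are carried out. *)
Definition hcosh x y : R :=
  1 + 2 * enorm (x - y) ^+ 2 / ((1 - enorm x ^+ 2) * (1 - enorm y ^+ 2)).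

Lemma hdistE x y : hdist x y = arcosh (hcosh x y).
Proof. by []. Qed.

Lemma one_add_dot_gt0 x : 0 < 1 + dot x x.
Proof. by rewrite ltr_wpDr ?dotxx_ge0. Qed.

Lemma one_sub_klein x : 1 - dot (klein x) (klein x) =
  ((1 - dot x x) / (1 + dot x x)) ^+ 2.
Proof.
by rewrite /klein !dotE; field; rewrite gt_eqF ?one_add_dot_gt0.
Qed.

Lemma hgt_klein x : dot x x < 1 -> hgt (klein x) = (1 - dot x x) / (1 + dot x x).
Proof.
move=> x1; rewrite /hgt one_sub_klein sqrtr_sqr ger0_norm//.
by rewrite divr_ge0 ?(ltW (one_add_dot_gt0 x))// subr_ge0 ltW.
Qed.

Lemma klein_lt1 x : dot x x < 1 -> dot (klein x) (klein x) < 1.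
Proof.
move=> x1; rewrite -subr_gt0 one_sub_klein exprn_gt0// divr_gt0 ?subr_gt0//.
exact: one_add_dot_gt0.
Qed.

Lemma one_sub_dot_klein x y : dot x x < 1 -> dot y y < 1 ->
  1 - dot (klein x) (klein y) = hcosh x y * hgt (klein x) * hgt (klein y).
Proof.
move=> x1 y1; rewrite !hgt_klein// /hcosh !sqr_enorm /klein !dotE (dotC y x).
field; rewrite !gt_eqF ?one_add_dot_gt0// subr_gt0//.
Qed.

Lemma dot_unklein x : dot x x < 1 -> 1 + dot (unklein x) (unklein x) = 2 / (1 + hgt x).
Proof.
move=> x1; have h2 := sqr_hgt (ltW x1); have h0 := hgt_gt0 x1.
rewrite !dotE (_ : dot x x = 1 - hgt x ^+ 2); last by rewrite h2; ring.
by field; lra.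
Qed.

Lemma unklein_lt1 x : dot x x < 1 -> dot (unklein x) (unklein x) < 1.
Proof.
move=> x1; have := dot_unklein x1; have h0 := hgt_gt0 x1.
have : 2 / (1 + hgt x) < 2 by rewrite ltr_pdivrMr; lra.
by move=> + E; rewrite -E; lra.
Qed.

Lemma unkleinK x : dot x x < 1 -> klein (unklein x) = x.
Proof.
move=> x1; rewrite /klein dot_unklein// /unklein scalerA.
have h0 := hgt_gt0 x1.
rewrite (_ : 2 / (2 / (1 + hgt x)) / (1 + hgt x) = 1) ?scale1r//.
by field; lra.
Qed.

Lemma kleinK x : dot x x < 1 -> unklein (klein x) = x.
Proof.
move=> x1; rewrite /unklein hgt_klein// /klein scalerA.
have h0 := one_add_dot_gt0 x.
rewrite (_ : (1 + (1 - dot x x) / (1 + dot x x))^-1 * (2 / (1 + dot x x)) = 1).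
  exact: scale1r.
field; lra.
Qed.

Lemma uballE x : uball x = (dot x x < 1).
Proof. by rewrite /uball /= enorm_lt1. Qed.

Lemma hcosh_ge1 x y : dot x x < 1 -> dot y y < 1 -> 1 <= hcosh x y.
Proof.
move=> x1 y1; rewrite /hcosh lerDl !sqr_enorm divr_ge0 ?mulr_ge0 ?dotxx_ge0//.
  by rewrite subr_ge0 ltW.
by rewrite subr_ge0 ltW.
Qed.

(** From ln T <= arcosh T; the crude [expR l] in place of cosh l suffices. *)
Lemma hcosh_le x y (l : R) : dot x x < 1 -> dot y y < 1 -> hdist x y <= l ->
  hcosh x y <= expR l.
Proof.
move=> x1 y1; have T1 := hcosh_ge1 x1 y1.
rewrite hdistE /arcosh -ler_expR lnK; last first.
  by rewrite posrE ltr_wpDr ?sqrtr_ge0//; lra.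
by apply: le_trans; rewrite lerDl sqrtr_ge0.
Qed.

Lemma arcosh_cosh (r : R) : arcosh ((expR r + expR (- r)) / 2) = `|r|.
Proof.
wlog r0 : r / 0 <= r.
  move=> W; have [|r0] := leP 0 r; first exact: W.
  by rewrite -normrN -W ?oppr_ge0 ?(ltW r0)// opprK addrC.
have e0 := expR_gt0 r; have eV : expR r * expR (- r) = 1.
  by rewrite -expRD subrr expR0.
have e1 : expR (- r) <= expR r by rewrite ler_expR; lra.
rewrite /arcosh (_ : _ ^+ 2 - 1 = ((expR r - expR (- r)) / 2) ^+ 2).
  rewrite sqrtr_sqr ger0_norm; last by rewrite divr_ge0// subr_ge0.
  by rewrite (_ : _ + _ = expR r) ?expRK ?ger0_norm//; field.
by rewrite -[X in _ - X]eV; field.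
Qed.

Lemma sphere_exit x v : dot x x < 1 -> v != 0 ->
  exists2 a, 0 < a & dot (x + a *: v) (x + a *: v) = 1.
Proof.
move=> x1 v0; pose f (a : R) := dot (x + a *: v) (x + a *: v).
have ev : 0 < enorm v.
  by rewrite lt_def enorm_ge0 andbT; apply: contra v0 => /eqP/enorm0_eq0 ->.
have cf : continuous f.
  move=> a; have c : x + t *: v @[t --> a] --> x + a *: v.
    apply: cvgD; first exact: cvg_cst.
    by apply: (@cvgZr_tmp _ _ _ (nbhs a) _ id); exact: cvg_id.
  exact: (cvg_dot _ c c).
have f0 : f 0 < 1 by rewrite /f scale0r addr0.
have f1 : 1 <= f (2 / enorm v).
  rewrite /f -sqr_enorm -[leLHS](expr1n _ 2) ler_sqr ?nnegrE ?enorm_ge0//.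
  have := ler_enormB ((2 / enorm v) *: v) (- x).
  rewrite opprK addrC enormN enormZ ger0_norm ?divr_ge0 ?(ltW ev)//.
  rewrite divfK ?gt_eqF// [_ *: v + x]addrC.
  have : enorm x < 1 by rewrite enorm_lt1.
  by move=> + /(le_trans _) => ? ->//; lra.
have b0 : 0 <= 2 / enorm v by rewrite divr_ge0// ltW.
have [|a] := @IVT R f 0 (2 / enorm v) 1 b0 (continuous_subspaceT cf).
  by rewrite ge_min (ltW f0) le_max f1 orbT.
rewrite in_itv/= => /andP[a0 _] fa; exists a => //.
rewrite lt_def a0 andbT; apply/eqP => aE.
by move: f0; rewrite -[X in f X]aE fa ltxx.
Qed.

Definition chord p q (a : R) : V := (1 - a) *: p + a *: q.

Lemma one_sub_chord p q a b : dot p p = 1 -> dot q q = 1 ->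
  1 - dot (chord p q a) (chord p q b) =
  (a * (1 - b) + b * (1 - a)) * (1 - dot p q).
Proof. by move=> pp qq; rewrite /chord !dotE pp qq (dotC q p); ring. Qed.

(** The fraction of a chord reached at signed hyperbolic distance [t] from its midpoint. *)
Definition logistic (t : R) : R := expR t ^+ 2 / (1 + expR t ^+ 2).

Lemma logistic_den (t : R) : 0 < 1 + expR t ^+ 2.
Proof. by rewrite ltr_wpDr// sqr_ge0. Qed.

Lemma chord_lt1 p q t : dot p p = 1 -> dot q q = 1 -> dot p q < 1 ->
  dot (chord p q (logistic t)) (chord p q (logistic t)) < 1.
Proof.
move=> pp qq pq; rewrite -subr_gt0 one_sub_chord// mulr_gt0 ?subr_gt0//.
have d := logistic_den t; have e := expR_gt0 t.
rewrite (_ : _ + _ = 2 * expR t ^+ 2 / (1 + expR t ^+ 2) ^+ 2).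
  by rewrite divr_gt0 ?mulr_gt0 ?exprn_gt0.
by rewrite /logistic; field; rewrite gt_eqF.
Qed.

Lemma hgt_chord p q t : dot p p = 1 -> dot q q = 1 -> dot p q < 1 ->
  hgt (chord p q (logistic t)) =
  Num.sqrt (2 * (1 - dot p q)) * (expR t / (1 + expR t ^+ 2)).
Proof.
move=> pp qq pq; have d := logistic_den t; have e := expR_gt0 t.
rewrite /hgt one_sub_chord//.
have -> : (logistic t * (1 - logistic t) + logistic t * (1 - logistic t)) *
    (1 - dot p q) = 2 * (1 - dot p q) * (expR t / (1 + expR t ^+ 2)) ^+ 2.
  by rewrite /logistic; field; rewrite gt_eqF.
rewrite sqrtrM ?sqrtr_sqr ?ger0_norm ?divr_ge0 ?(ltW e) ?(ltW d)//.
by rewrite mulr_ge0// subr_ge0 ltW.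
Qed.

(** In the cosh formula the factor 1 - <p, q> cancels between [one_sub_chord] and [hgt_chord], which
    leaves cosh (u - t). *)
Lemma chord_geodesic p q : dot p p = 1 -> dot q q = 1 -> dot p q < 1 ->
  hgeodesic setT (fun t => unklein (chord p q (logistic t))).
Proof.
move=> pp qq pq; split => [t _|u t _ _].
  by rewrite uballE unklein_lt1// chord_lt1.
have u1 := chord_lt1 u pp qq pq; have t1 := chord_lt1 t pp qq pq.
have uu := unklein_lt1 u1; have tt := unklein_lt1 t1.
have := one_sub_dot_klein uu tt; rewrite !unkleinK// one_sub_chord// !hgt_chord//.
have c0 : 0 < 2 * (1 - dot p q) by rewrite mulr_gt0// subr_gt0.
have s2 : Num.sqrt (2 * (1 - dot p q)) ^+ 2 = 2 * (1 - dot p q).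
  by rewrite sqr_sqrtr// ltW.
set T := hcosh _ _ => E; rewrite hdistE -/T -arcosh_cosh; congr arcosh.
have eu := expR_gt0 u; have et := expR_gt0 t.
have du := logistic_den u; have dt := logistic_den t.
rewrite expRD opprB expRD !expRN.
have {}E : (expR u ^+ 2 + expR t ^+ 2) * (2 * (1 - dot p q)) =
    T * (2 * (1 - dot p q)) * (2 * (expR u * expR t)).
  rewrite -[in RHS]s2; transitivity (2 * (1 + expR u ^+ 2) * (1 + expR t ^+ 2) *
    (((logistic u * (1 - logistic t) + logistic t * (1 - logistic u)) *
       (1 - dot p q)))).
    by rewrite /logistic; field; rewrite !gt_eqF.
  by rewrite E; field; rewrite !gt_eqF.
have k0 : 2 * (1 - dot p q) != 0 by rewrite gt_eqF.
have {}E : expR u ^+ 2 + expR t ^+ 2 = T * (2 * (expR u * expR t)).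
  by apply: (mulIf k0); rewrite E; ring.
have -> : (expR u / expR t + expR t / expR u) / 2 =
  (expR u ^+ 2 + expR t ^+ 2) / (2 * (expR u * expR t)) by field; rewrite !gt_eqF.
by rewrite E mulfK// !mulf_neq0// ?gt_eqF.
Qed.

Lemma logistic_surj (a : R) : 0 < a < 1 -> logistic (ln (a / (1 - a)) / 2) = a.
Proof.
move=> /andP[a0 a1]; rewrite /logistic -expRM_natl.
rewrite (_ : 2%:R * (ln (a / (1 - a)) / 2) = ln (a / (1 - a))); last by field.
rewrite lnK; last by rewrite posrE divr_gt0// subr_gt0.
by field; lra.
Qed.

Lemma logit_le (a b : R) : 0 < a -> a <= b -> b < 1 ->
  ln (a / (1 - a)) / 2 <= ln (b / (1 - b)) / 2.
Proof.
move=> a0 ab b1; have a1 : 0 < 1 - a by lra.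
have b0 : 0 < b by lra.
have {}b1 : 0 < 1 - b by lra.
rewrite ler_pM2r// ler_ln ?posrE ?divr_gt0//.
by rewrite ler_pdivrMr// mulrAC ler_pdivlMr//; lra.
Qed.

Definition kleinset H : set V := [set x | dot x x < 1 /\ H (unklein x)].

(** Hyperbolic convexity is expressed by parametrized geodesics, so the segment is prolonged to a
    chord with ends on the sphere; x, the given point and y then sit at increasing parameters of one
    geodesic. *)
Lemma kleinset_convex H : hconvex H -> aff_convex (kleinset H).
Proof.
move=> [_ cH] x y a [x1 Hx] [y1 Hy] a01.
have xy1 := segment_lt1 x1 y1 a01; split => //.
have [->|xy] := eqVneq x y; first by rewrite -scalerDl subrK scale1r.
have [v vE] : exists v, v = y - x by exists (y - x).
have v0 : v != 0 by rewrite vE subr_eq0 eq_sym.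
have [b b0 qq] := sphere_exit y1 v0.
have Nv0 : - v != 0 by rewrite oppr_eq0.
have [c c0 pp] := sphere_exit x1 Nv0.
have [q qE] : exists q, q = y + b *: v by exists (y + b *: v).
have [p pE] : exists p, p = x + c *: - v by exists (x + c *: - v).
rewrite -qE in qq; rewrite -pE in pp.
have s0 : 0 < 1 + b + c by lra.
have qp : q - p = (1 + b + c) *: v.
  by rewrite qE pE vE; apply/rowP => i; rewrite !mxE; ring.
have pq : dot p q < 1.
  have : 0 < dot (q - p) (q - p).
    rewrite qp !dotE mulr_gt0// mulr_gt0//.
    rewrite lt_def dotxx_ge0 andbT; apply: contra v0 => /eqP/dotxx_eq0 ->//.
  by rewrite !dotE qq pp (dotC q p); lra.
have chE d : chord p q ((c + d) / (1 + b + c)) = x + d *: v.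
  have -> : chord p q ((c + d) / (1 + b + c)) =
      p + ((c + d) / (1 + b + c)) *: (q - p).
    by rewrite /chord scalerBl scale1r scalerBr -addrA [- _ + _]addrC.
  rewrite qp scalerA divfK ?gt_eqF// pE scalerN scalerDl addrA.
  by rewrite subrK.
have /andP[a0 a1] := a01.
pose m d := (c + d) / (1 + b + c).
have m01 d : 0 <= d <= 1 -> 0 < m d < 1.
  by move=> d01; rewrite divr_gt0//= ?ltr_pdivrMr ?mul1r//; lra.
have mle d d' : d <= d' -> m d <= m d'.
  by move=> dd; rewrite ler_pM2r ?invr_gt0// lerD2l.
pose t d := ln (m d / (1 - m d)) / 2.
have tle d d' : 0 <= d <= 1 -> 0 <= d' <= 1 -> d <= d' -> t d <= t d'.
  move=> /m01/andP[? ?] /m01/andP[? ?] dd.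
  by apply: logit_le => //; exact: mle.
have gE d : 0 <= d <= 1 -> unklein (chord p q (logistic (t d))) = unklein (x + d *: v).
  by move=> d01; rewrite logistic_surj ?chE//; exact: m01.
have [g1 g2] := chord_geodesic pp qq pq.
have z01 : 0 <= (0 : R) <= 1 by rewrite lexx ler01.
have o01 : 0 <= (1 : R) <= 1 by rewrite ler01 lexx.
have := cH (fun u => unklein (chord p q (logistic u))) (t 0) (t 1).
rewrite !gE// scale0r addr0 scale1r => /(_ (tle _ _ z01 o01 ler01)) W.
have -> : (1 - a) *: x + a *: y = x + a *: v.
  by rewrite vE scalerBl scale1r scalerBr addrAC addrA.
rewrite -gE//; apply: W => //.
- by split => [u _|u u' _ _]; [exact: g1|exact: g2].
- by rewrite vE addrC subrK.
- by rewrite !tle.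
Qed.

End klein_model.

(** * Horoballs and tightness in Klein coordinates *)

Section transfer.
Variables (R : realType) (n : nat).
Local Notation V := 'rV[R]_n.+1.
Implicit Types (x y z v w p b : V) (H L : set V).

(** Inclusion in the ball and tangency at [p] force the centre to be (1 - r) p with r < 1; expanding
    |x - c| < r then gives the Klein form with kap = r / (1 - r). *)
Lemma horoball_klein p (D : set V) : horoball p D ->
  dot p p = 1 /\ exists2 kap : R, 0 < kap &
    forall x, dot x x < 1 -> D x <-> horo p kap (klein x).
Proof.
move=> [c [r [r0 DE Du tang]]].
have [pr ps] : enorm (p - c) = r /\ enorm p = 1.
  by have [] : ([set w | enorm (w - c) = r] `&` usphere (n:=n)) p by rewrite tang.
have c0 := enorm_ge0 c; have pp : dot p p = 1 by rewrite -sqr_enorm ps expr1n.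
have cr : enorm c <= 1 - r.
  rewrite leNgt; apply/negP => cr.
  have [u u1 uc] : exists2 u : V, enorm u = 1 & c = enorm c *: u.
    have [cz|cz] := eqVneq (enorm c) 0.
      by exists p; rewrite ?cz ?scale0r//; exact: enorm0_eq0.
    exists ((enorm c)^-1 *: c).
      by rewrite enormZ ger0_norm ?invr_ge0// mulVf.
    by rewrite scalerA mulfV// scale1r.
  (* The maximum covers |c| > 1, where the centre itself is outside the ball. *)
  pose m := Num.max (1 - enorm c) 0.
  have m0 : 0 <= m by rewrite le_max lexx orbT.
  have mr : m < r by rewrite gt_max r0 andbT; lra.
  have m1 : 1 - enorm c <= m by rewrite le_max lexx.
  have : uball (c + m *: u).
    by apply: Du; rewrite DE /= addrAC subrr add0r enormZ u1 mulr1 ger0_norm.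
  rewrite /uball/= {1}uc -scalerDl enormZ u1 mulr1 ger0_norm; last by rewrite addr_ge0.
  by lra.
have c1 : 1 - r <= enorm c by have := ler_enormB p c; rewrite pr ps; lra.
have cE : enorm c = 1 - r by apply/eqP; rewrite eq_le cr c1.
have cc : dot c c = (1 - r) ^+ 2 by rewrite -sqr_enorm cE.
have pc : dot p c = 1 - r.
  have := sqr_enorm (p - c); rewrite pr !dotE pp cc (dotC c p).
  by rewrite !expr2; lra.
have cpE : c = (1 - r) *: p.
  apply/eqP; rewrite -subr_eq0; apply/eqP; apply: dotxx_eq0.
  by rewrite !dotE cc pp (dotC c p) pc; ring.
have r1 : r < 1.
  rewrite lt_neqAle; apply/andP; split; last by lra.
  (* For r = 1 the bounding sphere would be the whole unit sphere, which contains [- p] too. *)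
  apply/eqP => rE; have : ([set w | enorm (w - c) = r] `&` usphere (n:=n)) (- p).
    by split; rewrite /usphere/= ?cpE ?rE ?subrr ?scale0r ?subr0 enormN.
  rewrite tang /= => pN; have : dot (- p) p = dot p p by rewrite pN.
  by rewrite dotNl pp; lra.
split => //; exists (r / (1 - r)); first by rewrite divr_gt0// subr_gt0.
move=> x x1; rewrite DE /horo /= enorm_lt ?(ltW r0)// hgt_klein// /klein dotZl.
have s0 := one_add_dot_gt0 x.
have s0' : 1 + dot x x != 0 by rewrite gt_eqF.
have r1' : 0 < 1 - r by rewrite subr_gt0.
have k1 : 1 - 2 / (1 + dot x x) * dot x p =
    (1 + dot x x - 2 * dot x p) / (1 + dot x x) by field.
have k2 : r / (1 - r) * ((1 - dot x x) / (1 + dot x x)) =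
   r * (1 - dot x x) / (1 - r) / (1 + dot x x) by field; rewrite s0' gt_eqF.
rewrite k1 k2 ltr_pM2r ?invr_gt0// ltr_pdivlMr//.
by rewrite cpE !dotE pp (dotC p x) !expr2; split; lra.
Qed.

Lemma cvg_hcosh_fraction (T : Type) (F : set_system T) (f g : T -> R) z w :
  Filter F -> dot z z < 1 -> dot w w < 1 ->
  f t @[t --> F] --> dot w w -> g t @[t --> F] --> dot (z - w) (z - w) ->
  1 + 2 * g t / ((1 - dot z z) * (1 - f t)) @[t --> F] -->
  1 + 2 * dot (z - w) (z - w) / ((1 - dot z z) * (1 - dot w w)).
Proof.
move=> FF z1 w1 fw gw.
apply: cvgD; first exact: cvg_cst.
apply: cvgM; first by apply: cvgM; [exact: cvg_cst|exact: gw].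
apply: cvgV; first by rewrite mulf_neq0// subr_eq0 gt_eqF.
apply: cvgM; first exact: cvg_cst.
by apply: cvgB; [exact: cvg_cst|exact: fw].
Qed.

(** Since [w] is not interior to [H], points outside [H] accumulate at it; the factor 2 leaves room
    to pass to one of them by continuity of [hcosh]. *)
Lemma near_complement_hball H z w (l : R) : dot z z < 1 ->
  hboundary H w -> hdist z w <= l ->
  exists v, [/\ dot v v < 1, ~ H v & hcosh z v <= 2 * expR l].
Proof.
move=> z1 [[_ nHw] w1] zw; rewrite uballE in w1.
apply: contrapT => none; apply: nHw; rewrite /interior /=.
have cw : v @[v --> w] --> w by exact: cvg_id.
have cz : z - v @[v --> w] --> z - w.
  by apply: (@cvgB _ _ _ (nbhs w) _ (fun=> z) id z w); [exact: cvg_cst|exact: cw].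
have Fw := nbhs_filter w.
have cvw := cvg_dot Fw cw cw; have czw := cvg_dot Fw cz cz.
have hE v : hcosh z v =
    1 + 2 * dot (z - v) (z - v) / ((1 - dot z z) * (1 - dot v v)).
  by rewrite /hcosh !sqr_enorm.
have ch := cvg_hcosh_fraction Fw z1 w1 cvw czw.
have lt2 : hcosh z w < 2 * expR l.
  have := hcosh_le z1 w1 zw; have := expR_gt0 l; lra.
have N1 : \forall v \near w, dot v v < 1 by move/cvgr_lt: cvw; apply.
rewrite hE in lt2.
have N2 : \forall v \near w, 1 + 2 * dot (z - v) (z - v) /
    ((1 - dot z z) * (1 - dot v v)) < 2 * expR l by move/cvgr_lt: ch; apply.
near=> v; apply: contrapT => nHv; apply: none; exists v; split => //.
  by near: v.
by rewrite hE; apply: ltW; near: v.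
Unshelve. all: by end_near. Qed.

Lemma convex_hull_hconvex L : hconvex (convex_hull L).
Proof.
have gu : geodesics_between L `<=` uball (n:=n).
  by move=> z [c [x [y [[cu _] _ _ _ [t _ <-]]]]]; exact: cu.
have uc : hconvex (uball (R:=R) (n:=n)).
  split => // c a b ab [cu _] _ _ t tab; apply: cu.
  by rewrite /= in_itv.
split.
  by move=> z hz; exact: (hz (@uball R n) (conj uc gu)).
move=> c a b ab cg ca cb t tab A [Ac Ag].
have [_ cA] := Ac.
by apply: (cA c a b ab cg) => //; [apply: ca|apply: cb].
Qed.

Lemma tight_klein L (l : R) : weakly_tight l L ->
  exists (Phi : set V) (kap : V -> R),
  [/\ forall b, Phi b -> 0 < kap b /\ dot b b = 1,
    forall b b', Phi b -> Phi b' -> forall z, dot z z < 1 ->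
      horo b (kap b) z -> horo b' (kap b') z -> b = b' &
    forall x, kleinset (convex_hull L) x -> outside Phi kap x ->
      exists v, [/\ dot v v < 1, ~ kleinset (convex_hull L) v &
        1 - dot x v <= 2 * expR l * hgt x * hgt v]].
Proof.
move=> [Phi [D [horoD trivD near]]].
have /choice[kap Hkap] : forall b, exists kap, Phi b -> 0 < kap /\
    forall x, dot x x < 1 -> D b x <-> horo b kap (klein x).
  move=> b; have [Pb|nPb] := pselect (Phi b); last by exists 0.
  by have [_ [kap k0 kD]] := horoball_klein (horoD _ Pb); exists kap.
have DK b x : Phi b -> dot x x < 1 -> horo b (kap b) x -> D b (unklein x).
  move=> /Hkap[_ kD] x1 hx; apply/kD; first exact: unklein_lt1.
  by rewrite unkleinK.
exists Phi, kap; split.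
- by move=> b Pb; have [? _] := Hkap b Pb; have [? _] := horoball_klein (horoD _ Pb).
- move=> b b' Pb Pb' z z1 bz b'z; apply: (trivD b b' Pb Pb').
  by exists (unklein z); split; apply: DK.
move=> x [x1 Hx] out; have ux1 := unklein_lt1 x1.
have [|w wb zw] := near _ Hx.
  move=> [b Pb]; have [_ kD] := Hkap b Pb.
  by move/(kD _ ux1); rewrite unkleinK//; exact: out.
have [v [v1 nHv Hv]] := near_complement_hball ux1 wb zw.
have kv1 := klein_lt1 v1.
exists (klein v); split => //.
  by move=> [_]; rewrite kleinK.
have := one_sub_dot_klein ux1 v1; rewrite unkleinK// => ->.
by rewrite ler_wpM2r ?hgt_ge0// ler_wpM2r ?hgt_ge0.
Qed.

End transfer.

(** * Volume *)

Section integral_monotone.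
Local Open Scope ereal_scope.
Context {d : measure_display} {T : measurableType d} {R : realType}.
Variable mu : {measure set T -> \bar R}.

(* No measurability: the integral of a nonnegative function is a supremum
   over the simple functions below it. *)
Lemma le_integral_nonneg (f g : T -> \bar R) : (forall x, 0 <= f x) ->
  (forall x, f x <= g x) -> \int[mu]_x f x <= \int[mu]_x g x.
Proof.
move=> f0 fg; have g0 x : 0 <= g x by exact: le_trans (fg x).
rewrite !ge0_integralTE//; apply: ereal_sup_le => _ [h /= hf <-].
by exists h => // x; exact: le_trans (fg x).
Qed.

End integral_monotone.

Section box.
Variable R : realType.
Local Notation RT := (measurableTypeR R).

Definition box k (c : nat -> R) (r : R) : set (k.-tuple RT) :=
  [set t | forall i : 'I_k, `|tnth t i - c i| <= r].

Lemma measurable_box k c r : measurable (@box k c r).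
Proof.
have -> : @box k c r = \bigcap_(i in [set: 'I_k])
    ((fun t : k.-tuple RT => tnth t i) @^-1` `[c i - r, c i + r]).
  apply/seteqP; split => t /= H i; [move=> _; have := H i|have := H i I];
    by rewrite /= in_itv/= ler_distl.
apply: fin_bigcap_measurable => // i _.
rewrite -[X in measurable X]setTI.
by apply: (@measurable_tnth _ RT k i) => //; exact: measurable_itv.
Qed.

Lemma lebesgue_box k c (r : R) : 0 <= r ->
  lebesgue_tuple R k (@box k c r) = ((2 * r) ^+ k)%:E.
Proof.
move=> r0; elim: k c => [|k IH] c.
  rewrite /= diracE mem_set ?expr0//= => i; by case: i.
have pre : @tcons R k @^-1` @box k.+1 c r =
    `[c 0%N - r, c 0%N + r]%classic `*` @box k (fun i => c i.+1) r.
  apply/seteqP; split => -[x t] /= H.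
    split; first by have := H ord0; rewrite /= in_itv/= ler_distl.
    by move=> i; have := H (lift ord0 i); rewrite /= (tnth_nth x)/= -tnth_nth.
  case: H; rewrite /= in_itv/= -ler_distl => H1 H2 i.
  case: (unliftP ord0 i) => [j|] -> //.
  by have := H2 j; rewrite [in X in _ -> X](tnth_nth x)/= -tnth_nth.
have len : lebesgue_measure (`[c 0%N - r, c 0%N + r]%classic : set R) = (2 * r)%:E.
  rewrite lebesgue_measure_itv/= lte_fin.
  have [H|H] := ltP (c 0%N - r) (c 0%N + r).
    by rewrite -EFinD; congr _%:E; lra.
  by rewrite (_ : r = 0) ?mulr0//; lra.
rewrite /= /lebesgue_step /pushforward pre product_measure1E//; last first.
  exact: measurable_box.
by rewrite IH exprS EFinM; congr (_ * _)%E.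
Qed.

End box.

Section volume.
Variables (R : realType) (n : nat).
Local Notation V := 'rV[R]_n.+1.
Local Notation RT := (measurableTypeR R).
Implicit Types (A : set V) (x : V).

(** On [A] inside a box of half-side [b.2] the density is at most (M / b.2)^(n+1), so each box
    contributes at most (2 M)^(n+1) whatever its size. Pointwise comparison with a sum of indicators
    of boxes spares any measurability of [A]. *)
Lemma hvol_cover A (l : seq (V * R)) (M : R) : 0 <= M ->
  A `<=` @uball R n -> {in l, forall b, 0 < b.2} ->
  (forall x, A x -> exists2 b, b \in l &
     (forall i, `|x ord0 i - b.1 ord0 i| <= b.2) /\
     2 / (1 - enorm x ^+ 2) <= M / b.2) ->
  (hvol A <= ((size l)%:R * (2 * M) ^+ n.+1)%:E)%E.
Proof.
move=> M0 Au l0 cover.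
pose S : set (n.+1.-tuple RT) := [set t | A (\row_i tnth t i)].
pose mu := lebesgue_tuple R n.+1.
pose bx (b : V * R) := @box R n.+1 (fun i => b.1 ord0 (inord i)) b.2.
(* The absolute value makes [K b] nonnegative for all pairs, not only those of [l]. *)
pose K (b : V * R) := `|M / b.2| ^+ n.+1.
have K0 b : 0 <= K b by rewrite exprn_ge0.
pose g t : \bar R := (\sum_(b <- l) ((K b)%:E * (\1_(bx b) t)%:E))%E.
have d0 x : A x -> 0 <= 2 / (1 - enorm x ^+ 2).
  move=> /Au; rewrite /uball /= => x1.
  by rewrite divr_ge0// subr_ge0 expr_le1 ?enorm_ge0// ltW.
have gi0 (b : V * R) t : (0 <= (K b)%:E * (\1_(bx b) t)%:E)%E.
  by rewrite mule_ge0// lee_fin.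
rewrite /hvol integral_mkcond.
apply: (@le_trans _ _ (\int[mu]_t g t)%E).
  apply: le_integral_nonneg => t; rewrite patchE; case: ifPn => //.
  - move=> /set_mem St; by rewrite lee_fin exprn_ge0// d0.
  - move=> /set_mem St; have [b bl [xb Mb]] := cover _ St.
    have b0 := l0 _ bl.
    rewrite /g (big_rem b bl)/= (@le_trans _ _ ((K b)%:E * (\1_(bx b) t)%:E)%E)//.
      rewrite indicE mem_set ?mule1.
        by rewrite lee_fin lerXn2r ?nnegrE ?d0 ?(le_trans Mb) ?ler_norm.
      by move=> i; have := xb i; rewrite mxE inord_val.
    by rewrite leeDl// sume_ge0.
  - by move=> _; rewrite sume_ge0.
have mbx b : measurable (bx b) by exact: measurable_box.
rewrite ge0_integral_sum//=; last first.
  move=> b; apply: emeasurable_funM; first exact: measurable_cst.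
  by apply/measurable_EFinP; exact: measurable_indic.
have step b : b \in l ->
    (\int[mu]_t ((K b)%:E * (\1_(bx b) t)%:E))%E = ((2 * M) ^+ n.+1)%:E.
  move=> bl; have b0 := l0 _ bl.
  rewrite ge0_integralZl_EFin//; last first.
    by apply/measurable_EFinP; exact: measurable_indic.
  rewrite integral_indic// setIT.
  transitivity ((K b)%:E * ((2 * b.2) ^+ n.+1)%:E)%E.
    by congr (_ * _)%E; apply: lebesgue_box; exact: ltW.
  rewrite -EFinM /K ger0_norm ?divr_ge0 ?(ltW b0)// -exprMn; congr (_ ^+ _)%:E.
  by field; rewrite gt_eqF.
rewrite big_seq (eq_bigr _ step) -big_seq sumEFin lee_fin.
by rewrite big_const_seq count_predT iter_addr_0 -(mulr_natl ((2 * M) ^+ n.+1)).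
Qed.

End volume.

(** * Covering a neighbourhood of the hull by boxes *)

Section covering.
Variables (R : realType) (n : nat).
Local Notation V := 'rV[R]_n.+1.
Local Notation T := 'rV[R]_n.
Local Notation cell := (T * R)%type.
Local Notation N := (n.+1%:R : R).
Implicit Types (x z w : V) (H : set V).

Lemma pow2_bracket (y : R) : 1 <= y -> exists k : nat, 2 ^+ k <= y < 2 ^+ k.+1.
Proof.
move=> y1; have ex : exists k : nat, y < 2 ^+ k.
  have [k hk] := pow2_ge y; exists k.+1; apply: (le_lt_trans hk).
  by rewrite ltr_eXn2l ?ltr1n.
case: (ex_minnP ex) => -[|k] yk min; first by move: yk; rewrite expr0; lra.
exists k; rewrite yk andbT leNgt; apply/negP => /min.
by rewrite ltnn.
Qed.

Lemma cone_face x : x != 0 -> exists (i0 : 'I_n.+1) (b : bool) (t : T) (r : R),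
  [/\ 0 < r, x = r *: tau i0 ((-1) ^+ b) t & forall j, `|t ord0 j| <= 1].
Proof.
move=> x0; pose i0 := [arg max_(i > ord0) `|x ord0 i|]%O.
have imax i : `|x ord0 i| <= `|x ord0 i0|.
  by rewrite /i0; case: arg_maxP => // j _ /(_ i isT).
have r0 : 0 < `|x ord0 i0|.
  rewrite normr_gt0; apply: contra x0 => /eqP xi.
  apply/eqP/rowP => i; rewrite mxE; apply/eqP; rewrite -normr_le0.
  by rewrite (le_trans (imax i))// xi normr0.
exists i0, (x ord0 i0 < 0), (\row_j (x ord0 (lift i0 j) / `|x ord0 i0|)), `|x ord0 i0|.
split => //.
  apply/rowP => k; rewrite mxE; case: (unliftP i0 k) => [j|] ->.
    by rewrite tau_lift mxE mulrC divfK// gt_eqF.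
  by rewrite tau_face mulrC -numEsign.
move=> j; rewrite mxE normrM normfV normr_id ler_pdivrMr// mul1r.
exact: imax.
Qed.

Lemma klein_dist x : dot x x < 1 -> enorm (x - klein x) <= hgt (klein x).
Proof.
move=> x1; have d := one_add_dot_gt0 x; rewrite hgt_klein//.
have -> : x - klein x = - ((1 - dot x x) / (1 + dot x x)) *: x.
  rewrite /klein -[X in X - _]scale1r -scalerBl; congr (_ *: _).
  by field; rewrite gt_eqF.
have q0 : 0 <= (1 - dot x x) / (1 + dot x x).
  by rewrite divr_ge0 ?(ltW d)// subr_ge0 ltW.
by rewrite enormZ normrN ger0_norm// ler_piMr// ltW// enorm_lt1.
Qed.

Lemma near_klein x w (E : R) : dot x x < 1 -> dot w w < 1 -> 1 <= E ->
  hcosh x w <= E ->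
  [/\ enorm (x - klein w) <= 4 * E * hgt (klein w),
      hgt (klein w) <= 2 * E * (1 - dot x x) &
      hgt (klein x) <= 2 * E * hgt (klein w)].
Proof.
move=> x1 w1 E1 xw; have X1 := klein_lt1 x1; have W1 := klein_lt1 w1.
have XW : 1 - dot (klein w) (klein x) <= E * hgt (klein w) * hgt (klein x).
  rewrite dotC one_sub_dot_klein// [leRHS]mulrAC ler_wpM2r ?hgt_ge0//.
  by rewrite ler_wpM2r ?hgt_ge0.
have [h1 h2 h3] := kclose_bounds W1 X1 XW.
split => //.
- have := enorm_triangle (klein x) x (klein w); have := klein_dist x1.
  by rewrite (enormB (klein x) (klein w)); lra.
- apply: (le_trans h2); rewrite ler_wpM2l ?mulr_ge0//; first by lra.
  rewrite hgt_klein// ler_pdivrMr ?one_add_dot_gt0// ler_peMr ?lerDl ?dotxx_ge0//.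
  by rewrite subr_ge0 ltW.
Qed.

Variables (H : set V) (lam : R).
Local Notation K := (kleinset H).
Hypothesis lam1 : 1 < lam.
Hypothesis ncount_growth : forall (i0 : 'I_n.+1) (s : R), s * s = 1 ->
  exists C, forall k, ncount i0 s K k (0, 1) <= C * lam ^+ k.

(** The boxes live in the ball model, the nodes in the Klein model. A point moves by at most its
    Klein height between the two ([klein_dist]), so the same direction serves as centre. *)
Definition node_boxes (c : R) k (f : 'I_n.+1 * bool) : seq (V * R) :=
  [seq (theta f.1 ((-1) ^+ f.2) Q.1, c * Q.2) |
     Q <- [seq Q <- leaves k (0, 1) | `[< node f.1 ((-1) ^+ f.2) K Q >]]].

Lemma size_node_boxes c k f :
  (size (node_boxes c k f))%:R = ncount f.1 ((-1) ^+ f.2) K k (0, 1).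
Proof.
rewrite size_map size_filter -sum1_count natr_sum /ncount [RHS]big_mkcond/=.
rewrite big_mkcond /=; apply: eq_bigr => Q _.
by case: asboolP.
Qed.

(* The box (0, 1) is for the neighbourhood of the origin, which lies in no cone. *)
Definition all_boxes (c : R) m : seq (V * R) :=
  (0, 1) ::
  flatten [seq flatten [seq node_boxes c k f | f <- index_enum _] | k <- iota 0 m].

Lemma size_all_boxes : exists2 C, 0 < C & forall c m,
  (size (all_boxes c m))%:R <= C * lam ^+ m.
Proof.
have sg b : (-1) ^+ b * (-1) ^+ b = 1 :> R by rewrite -expr2 sqrr_sign.
have /choice[C HC] : forall f : 'I_n.+1 * bool, exists C, forall k,
    ncount f.1 ((-1) ^+ f.2) K k (0, 1) <= C * lam ^+ k.
  by move=> f; exact: ncount_growth.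
pose C1 := \sum_f `|C f|.
have C10 : 0 <= C1 by rewrite sumr_ge0.
have d0 : 0 < lam - 1 by rewrite subr_gt0.
exists (1 + C1 / (lam - 1)) => [|c m].
  by rewrite ltr_pwDl// divr_ge0// ltW.
have l1 : 1 <= lam ^+ m by rewrite exprn_ege1// ltW.
rewrite /= -natr1 addrC mulrDl mul1r lerD// -sum1_size big_flatten big_map natr_sum.
apply: (@le_trans _ _ (\sum_(k <- iota 0 m) C1 * lam ^+ k)).
  apply: ler_sum => k _; rewrite big_flatten big_map natr_sum mulr_suml.
  apply: ler_sum => f _; rewrite sum1_size size_node_boxes (le_trans (HC f k))//.
  by rewrite ler_wpM2r ?exprn_ge0 ?ler_norm// ltW// (lt_trans _ lam1).
rewrite -mulr_sumr -mulrA ler_wpM2l// mulrC ler_pdivlMr// mulrC.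
have -> : \sum_(k <- iota 0 m) lam ^+ k = \sum_(k < m) lam ^+ k.
  by rewrite -(big_mkord xpredT (fun k => lam ^+ k)) /index_iota subn0.
by rewrite -subrX1 gerBl.
Qed.

(** A point [w] of [H] close to a point of the ball has Klein height at least hgt (klein z) / (4 E
    exp r), so it makes a node of level below [m]. In the half-side, 4 E accounts for the distance
    from [x] to [klein w] and 3 N for that from [klein w] to the centre of the cell. *)
Lemma nbhd_covered (e r : R) z : dot z z < 1 -> 0 < e -> 0 <= r -> H `<=` @uball R n ->
  let E := expR e in let M := 8 * E * (4 * E + 3 * N) in
  forall m, 4 * E / hgt (klein z) * expR r < 2 ^+ m ->
  (hvol (hball z r `&` hnbhd e H) <=
    ((size (all_boxes (4 * E + 3 * N) m))%:R * (2 * M) ^+ n.+1)%:E)%E.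
Proof.
move=> z1 e0 r0 Hu E M m hm.
have E1 : 1 <= E by rewrite -expR0 ler_expR ltW.
have N1 : 1 <= N by rewrite ler1n.
have c0 : 0 < 4 * E + 3 * N by lra.
have M0 : 0 <= M by rewrite !mulr_ge0//; lra.
have root01 : 0 < ((0, 1) : cell).2 <= 1 by rewrite /= ltr01 lexx.
apply: hvol_cover => //.
- by move=> x [[]].
- move=> b; rewrite inE => /orP[/eqP -> //|/flattenP[l /mapP[k _ ->]]].
  move=> /flattenP[l' /mapP[f _ ->]] /mapP[Q]; rewrite mem_filter => /andP[_ Ql] ->.
  by rewrite /= mulr_gt0//; have [] := leaves_size01 root01 Ql.
move=> x [[ux zx] [_ [w Hw xw]]].
have x1 : dot x x < 1 by move: ux; rewrite uballE.
have w1 : dot w w < 1 by have := Hu _ Hw; rewrite uballE.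
have [xW hW hXW] := near_klein x1 w1 E1 (hcosh_le x1 w1 (ltW xw)).
have W1 := klein_lt1 w1; have hW0 := hgt_gt0 W1.
have hW1 := hgt_le1 (klein w).
rewrite sqr_enorm.
have dx : 0 < 1 - dot x x by rewrite subr_gt0.
have [W0|W0] := eqVneq (klein w) 0.
  exists (0, 1); first by rewrite mem_head.
  split => [i|].
    rewrite mxE subr0 (le_trans (coord_le_enorm _ _))//=.
    by apply: ltW; rewrite enorm_lt1.
  rewrite divr1 ler_pdivrMr//.
  have hW1' : hgt (klein w) = 1 by rewrite W0 /hgt dot0l subr0 sqrtr1.
  rewrite hW1' in hW; rewrite /M.
  have : 4 * (2 * E * (1 - dot x x)) <= (4 * E + 3 * N) * (2 * E * (1 - dot x x)).
    by rewrite ler_pM2r ?mulr_gt0//; lra.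
  by lra.
have [i0 [b [t [q [q0 WE t1]]]]] := cone_face W0.
have [k /andP[k1 k2]] : exists k : nat, 2 ^+ k <= (hgt (klein w))^-1 < 2 ^+ k.+1.
  by apply: pow2_bracket; rewrite invf_ge1.
have p0 : 0 < 2 ^+ k :> R by rewrite exprn_gt0.
have hk1 : hgt (klein w) <= 1 / 2 ^+ k.
  by rewrite div1r -[leLHS]invrK lef_pV2 ?posrE ?invr_gt0.
have hk2 : 1 / 2 ^+ k <= 2 * hgt (klein w).
  rewrite div1r -ler_pdivrMl// -invfM -exprS -[leRHS]invrK lef_pV2 ?posrE ?exprn_gt0 ?invr_gt0//.
  exact: ltW.
have km : (k < m)%N.
  have zx' := near_klein z1 x1 (E := expR r) _ (hcosh_le z1 x1 (ltW zx)).
  have [_ _ hZX] := zx' ltac:(by rewrite -expR0 ler_expR).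
  have hZ0 := hgt_gt0 (klein_lt1 z1).
  rewrite -(@ltr_eXn2l R 2) ?ltr1n//; apply: le_lt_trans hm; apply: (le_trans k1).
  rewrite mulrAC ler_pdivlMr// mulrC ler_pdivrMr//.
  apply: (le_trans hZX).
  have : 2 * expR r * hgt (klein x) <= 2 * expR r * (2 * E * hgt (klein w)).
    by rewrite ler_pM2l// mulr_gt0// expR_gt0.
  by lra.
have [Q QL Qt] : exists2 Q, Q \in leaves k ((0, 1) : cell) & in_cell Q t.
  by apply: leaves_cover => j; rewrite mxE subr0 t1.
have Q01 : 0 < Q.2 <= 1.
  by have [-> ->] := leaves_size01 root01 QL.
have Q2 : Q.2 = 1 / 2 ^+ k by rewrite (leaves_size QL).
have sg : (-1) ^+ b * (-1) ^+ b = 1 :> R by rewrite -expr2 sqrr_sign.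
have WQ : 1 - dot (klein w) (klein w) <= Q.2 ^+ 2.
  by rewrite -sqr_hgt ?(ltW W1)// Q2 ler_sqr ?nnegrE ?hgt_ge0 ?divr_ge0 ?(ltW p0).
exists (theta i0 ((-1) ^+ b) Q.1, (4 * E + 3 * N) * Q.2).
  rewrite inE; apply/orP; right; apply/flattenP.
  exists (flatten [seq node_boxes (4 * E + 3 * N) k f | f <- index_enum _]).
    by apply/mapP; exists k => //; rewrite mem_iota.
  apply/flattenP; exists (node_boxes (4 * E + 3 * N) k (i0, b)).
    by apply/mapP; exists (i0, b) => //; rewrite mem_index_enum.
  apply/mapP; exists Q => //; rewrite mem_filter QL andbT; apply/asboolP.
  exists t, q, (klein w); split => //; split => //.
  by rewrite kleinK.
split => [i|].
  have /= -> : x ord0 i - theta i0 ((-1) ^+ b) Q.1 ord0 i =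
      (x - theta i0 ((-1) ^+ b) Q.1) ord0 i by rewrite [RHS]mxE [X in _ = _ + X]mxE.
  apply: (le_trans (coord_le_enorm _ _)).
  apply: (le_trans (enorm_triangle (klein w) _ _)).
  have cQ : in_cell Q Q.1.
    by move=> j; rewrite subrr normr0 ltW//; case/andP: Q01.
  have := node_theta sg Q01 Qt cQ q0 WE W1 WQ.
  have : 4 * E * hgt (klein w) <= 4 * E * Q.2 by rewrite ler_pM2l ?Q2//; lra.
  by lra.
have Qp : 0 < Q.2 by case/andP: Q01.
rewrite /= invfM mulrA; have -> : M / (4 * E + 3 * N) / Q.2 = 8 * E / Q.2.
  by rewrite /M mulfK ?gt_eqF.
rewrite ler_pdivrMr// mulrAC ler_pdivlMr//.
by rewrite Q2; lra.
Qed.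

(** The radius [r] corresponds to level r / ln 2 + O(1), which turns growth by [lam] per level into
    the exponent ln lam / ln 2 per unit of radius. *)
Lemma volume_growth (e : R) z : dot z z < 1 -> 0 < e -> H `<=` @uball R n ->
  exists2 C, 0 < C & forall r, 0 <= r ->
  (hvol (hball z r `&` hnbhd e H) <= (C * expR (ln lam / ln 2 * r))%:E)%E.
Proof.
move=> z1 e0 Hu; have [C0 C00 HC] := size_all_boxes.
pose E := expR e; pose M := 8 * E * (4 * E + 3 * N).
have E1 : 1 <= E by rewrite -expR0 ler_expR ltW.
have N1 : 1 <= N by rewrite ler1n.
have M0 : 0 < M by rewrite !mulr_gt0//; lra.
have hZ0 := hgt_gt0 (klein_lt1 z1); have hZ1 := hgt_le1 (klein z).
pose Y := 4 * E / hgt (klein z).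
have Y1 : 1 <= Y by rewrite ler_pdivlMr// mul1r; lra.
have Y0 : 0 < Y by apply: lt_le_trans Y1.
have l20 : 0 < ln 2 :> R by rewrite ln_gt0// ltr1n.
have lam0 : 0 < lam by apply: lt_trans lam1.
have ll0 : 0 < ln lam by rewrite ln_gt0.
pose s := ln lam / ln 2.
have s0 : 0 < s by rewrite divr_gt0.
exists (C0 * lam * expR (s * ln Y) * (2 * M) ^+ n.+1).
  by rewrite !mulr_gt0 ?expR_gt0 ?exprn_gt0// mulr_gt0.
move=> r r0.
have er1 : 1 <= expR r by rewrite -expR0 ler_expR.
have [k /andP[k1 k2]] : exists k : nat, 2 ^+ k <= Y * expR r < 2 ^+ k.+1.
  by apply: pow2_bracket; rewrite mulr_ege1.
apply: (le_trans (nbhd_covered z1 e0 r0 Hu k2)).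
have M2 : 0 <= (2 * M) ^+ n.+1 by apply: exprn_ge0; apply: mulr_ge0 => //; exact: ltW.
rewrite lee_fin -/E -/M -/s [leRHS]mulrAC ler_wpM2r//.
apply: (le_trans (HC _ _)); rewrite exprS mulrA -[leRHS]mulrA ler_pM2l ?mulr_gt0//.
rewrite -expRD -mulrDr.
have -> : lam ^+ k = expR (s * ln (2 ^+ k)).
  rewrite lnXn// -[in LHS](lnK (x := lam)) ?posrE// -expRM_natl; congr expR.
  by rewrite /s -mulr_natl; field; rewrite gt_eqF.
rewrite ler_expR ler_pM2l// -[X in _ + X]expRK -lnM ?posrE ?expR_gt0//.
by rewrite ler_ln ?posrE ?exprn_gt0 ?(mulr_gt0 Y0 (expR_gt0 r)).
Qed.

End covering.

(** * From volume growth to entropy *)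

Section entropy.
Variables (R : realType) (n : nat).
Implicit Types (L : set 'rV[R]_n.+1).

Lemma lne_le_ln (x : \bar R) (c : R) : 0 < c -> (x <= c%:E)%E ->
  (lne x <= (ln c)%:E)%E.
Proof.
move: x => [x| |] c0; last by move=> _; exact: leNye.
  rewrite lee_fin => xc; have [x0|x0] := leP x 0; first by rewrite le0_lneNy// leNye.
  by rewrite lne_EFin// lee_fin ler_ln ?posrE.
by rewrite leye_eq.
Qed.

Lemma entropy_le L z (e C a s : R) : 0 < C -> a < s ->
  (forall r, 0 <= r ->
    (hvol (hball z r `&` hnbhd e (convex_hull L)) <= (C * expR (a * r))%:E)%E) ->
  (convex_core_entropy z e L <= s%:E)%E.
Proof.
move=> C0 as_ bound; have sa : 0 < s - a by rewrite subr_gt0.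
(* Beyond this radius the gap between [a] and [s] absorbs ln C / r. *)
pose r0 := Num.max 0 (ln C / (s - a)).
rewrite /convex_core_entropy limf_esupE.
apply: (le_trans (ereal_inf_lbound _)).
  exists [set r | r0 < r]; last by reflexivity.
  by apply: nbhs_pinfty_gt; exact: num_real.
apply: ge_ereal_sup => _ [r /= rr0 <-].
move: rr0; rewrite gt_max => /andP[r_gt0 rC].
have ri : 0 < r^-1 by rewrite invr_gt0.
have H : (lne (hvol (hball z r `&` hnbhd e (convex_hull L))) <=
    (ln C + a * r)%:E)%E.
  rewrite -[a * r in leRHS]expRK -lnM ?posrE ?expR_gt0//.
  by apply: lne_le_ln; [rewrite mulr_gt0 ?expR_gt0|apply: bound; exact: ltW].
apply: (@le_trans _ _ ((ln C + a * r)%:E * (r^-1)%:E)%E).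
  by apply: lee_wpmul2r => //; rewrite lee_fin ltW.
rewrite -EFinM lee_fin ler_pdivrMr//.
by move: rC; rewrite ltr_pdivrMr//; lra.
Qed.

End entropy.

Lemma weakly_tight_entropy (R : realType) (n : nat) (l : R) : (0 < n)%N -> 0 <= l ->
  exists2 s : R, s < n%:R & forall L : set 'rV[R]_n.+1, weakly_tight l L ->
    forall (z : 'rV[R]_n.+1) (e : R), uball z -> 0 < e ->
    (convex_core_entropy z e L <= s%:E)%E.
Proof.
move=> n0 l0; have el1 : 1 <= expR l by rewrite -expR0 ler_expR.
have E1 : 1 <= 2 * expR l by lra.
have [lam /andP[lam1 lamn] core] := core_count n0 E1.
have l20 : 0 < ln 2 :> R by rewrite ln_gt0// ltr1n.
have lam0 : 0 < lam by apply: lt_trans lam1.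
have an : ln lam / ln 2 < n%:R.
  rewrite ltr_pdivrMr// mulr_natl -lnXn// ltr_ln// posrE exprn_gt0//.
(* The midpoint leaves a gap on both sides: above the growth exponent, as [entropy_le] asks, and
   below [n]. *)
exists ((ln lam / ln 2 + n%:R) / 2) => [|L tight z e uz e0]; first by lra.
have [Phi [kap [kap0 disj tightK]]] := tight_klein tight.
have [Hu _] := convex_hull_hconvex L.
have z1 : dot z z < 1 by move: uz; rewrite uballE.
have [|C C0 HC] := @volume_growth _ _ (convex_hull L) lam lam1 _ e z z1 e0 Hu.
  move=> i0 s s1; have [[z0 Kz0]|K0] := pselect (exists z0, kleinset (convex_hull L) z0).
    apply: (core i0 s s1 _ Phi kap z0) => //.
      by apply: kleinset_convex; exact: convex_hull_hconvex.
    by move=> x [].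
  (* An empty hull has no nodes. *)
  exists 0 => k; rewrite mul0r /ncount big1// => Q _.
  case: asboolP => // -[t [r [x [_ _ _ Kx _]]]].
  by exfalso; apply: K0; exists x.
by apply: (entropy_le C0 _ HC); lra.
Qed.

Theorem theorem3p11 (R : realType) :
  exists s : nat -> R -> R,
    (forall (n : nat) (l : R), (1 <= n)%N -> 0 <= l ->
       s n l < n%:R /\
       forall L : set 'rV[R]_n.+1, L `<=` @usphere R n -> closed L ->
         weakly_tight l L ->
         forall (z : 'rV[R]_n.+1) (e : R), uball z -> 0 < e ->
           (convex_core_entropy z e L <= (s n l)%:E)%E) /\
    (forall (n : nat) (G : set ('rV[R]_n.+1 -> 'rV[R]_n.+1)), (1 <= n)%N ->
       kleinian G -> geometrically_tight G ->
       forall (z : 'rV[R]_n.+1) (e : R), uball z -> 0 < e ->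
         (convex_core_entropy z e (limit_set G) < (n%:R)%:E)%E).
Proof.
(* The function [s] is chosen on all pairs at once, with the default value 0 out of range. *)
have /choice[s Hs] : forall p : nat * R, exists s : R, (0 < p.1)%N -> 0 <= p.2 ->
    s < p.1%:R /\ forall L : set 'rV[R]_p.1.+1, weakly_tight p.2 L ->
      forall (z : 'rV[R]_p.1.+1) (e : R), uball z -> 0 < e ->
      (convex_core_entropy z e L <= s%:E)%E.
  move=> [n l] /=; have [n0|] := posnP n; first by exists 0.
  move=> n0; have [l0|l0] := leP 0 l; last by exists 0.
  by have [s sn Hs] := weakly_tight_entropy n0 l0; exists s.
exists (fun n l => s (n, l)); split => [n l n1 l0|n G n1 _ [l l0 tight] z e uz e0].
  by have [sn H] := Hs (n, l) n1 l0; split => // L _ _ tight z e; exact: H.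
have [sn H] := Hs (n, l) n1 l0.
by apply: (le_lt_trans (H _ tight _ _ uz e0)); rewrite lte_fin.
Qed.
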